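(* Let $d, d_1, d_2, \ldots, d_n$ be non-negative integers and suppose that $$f : (\mathbb{D}, ds^2_d) \to (\mathbb{D}, ds^2_{d_1}) \times (\mathbb{D}, ds^2_{d_2}) \times \cdots \times (\mathbb{D}, ds^2_{d_n})$$ is a holomorphic isometry such that all the component functions of $f$ are non-constant. Then $$d+1 \le \sum_{i=1}^n (d_i+1).$$ In case equality holds, there are unimodular constants $\alpha_1, \alpha_2, \ldots, \alpha_n \in \mathbb{C}$ such that $$f(z) = (\alpha_1 z, \alpha_2 z, \ldots, \alpha_n z)$$ after a possible reparametrization. Moreover (whether or not equality holds), for every $1 \le i \le n$ there exist integers $k_1, k_2, \ldots, k_{j_i}\in\{1,\ldots,n\}$ with $k_1 = i$ such that $$\sum_{r=1}^{j_i} (d_{k_r}+1) = d+1.$$ In particular, $d_i \le d$ for each $1 \le i \le n$.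
   Context: $\mathbb{D}\subset\mathbb{C}$ is the open unit disc and $K_{\mathbb{D}}(z)=K_{\mathbb{D}}(z,z)$ its Bergman kernel on the diagonal. For an integer $d\ge 0$, $\mu_d = K_{\mathbb{D}}^{-d}$ is a weight on $\mathbb{D}$, $K_{\mathbb{D},d}(z,w)$ is the reproducing kernel of the Hilbert space of holomorphic functions on $\mathbb{D}$ square integrable with respect to $\mu_d\, dV$ ($dV$ Lebesgue measure), and $K_{\mathbb{D},d}(z)=K_{\mathbb{D},d}(z,z)$. The weighted Bergman metric is $ds^2_d = \frac{\partial^2}{\partial z\partial\overline{z}} \log K_{\mathbb{D},d}(z)\, dz\otimes d\overline{z}$. A holomorphic isometry $f=(f_1,\ldots,f_n)$ from $(\mathbb{D},ds^2_d)$ into the product $(\mathbb{D}, ds^2_{d_1})\times\cdots\times(\mathbb{D}, ds^2_{d_n})$ is a holomorphic map $f:\mathbb{D}\to\mathbb{D}^n$ with $ds^2_d = \sum_{i=1}^n f_i^* ds^2_{d_i}$. A reparametrization of $f$ means a map $z\mapsto(\varphi_1\circ f_1\circ\psi(z),\ldots,\varphi_n\circ f_n\circ\psi(z))$ with $\psi,\varphi_1,\ldots,\varphi_n$ holomorphic automorphisms of $\mathbb{D}$. *)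

(* Defs.v *)
From HB Require Import structures.
From mathcomp Require Import all_boot all_order all_algebra.
From mathcomp Require Import complex.
From mathcomp Require Import all_classical all_reals all_analysis.

Set Implicit Arguments.
Unset Strict Implicit.
Unset Printing Implicit Defensive.

Import Order.TTheory GRing.Theory Num.Theory.
Import numFieldNormedType.Exports.

Local Open Scope classical_set_scope.
Local Open Scope ring_scope.
Local Open Scope complex_scope.

(* Functions on the disc are represented by total functions on R[i]; their
   values outside the disc never matter. *)
Definition disc (R : realType) : set R[i] := [set z | `|z| < 1].

(* Complex differentiability: R[i]^o is R[i] as a normed module over itself. *)
Definition cderivable (R : realType) (f : R[i] -> R[i]) (z : R[i]) : Prop :=
  derivable (f : R[i]^o -> R[i]^o) z 1.

Definition cderive (R : realType) (f : R[i] -> R[i]) (z : R[i]) : R[i] :=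
  derive1 (f : R[i]^o -> R[i]^o) z.

Definition holomorphic_on (R : realType) (U : set R[i]) (f : R[i] -> R[i])
  : Prop := forall z, U z -> cderivable f z.

(* Integrals over the disc are taken over plane R, which carries the product
   Lebesgue measure, through the identification (x, y) |-> x + iy. *)
Notation plane R := (measurableTypeR R * measurableTypeR R)%type.

Definition toC (R : realType) (p : plane R) : R[i] := p.1 +i* p.2.

Definition dV (R : realType) : {measure set (plane R) -> \bar R} :=
  (lebesgue_measure \x lebesgue_measure)%E.

Section weighted_bergman.
Variable R : realType.
Implicit Types (mu : R[i] -> R) (f g : R[i] -> R[i]).

Definition disc2 : set (plane R) := @toC R @^-1` @disc R.

Definition bergman_space mu : set (R[i] -> R[i]) := [set f |
  holomorphic_on (@disc R) f /\
  (@dV R).-integrable disc2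
    (fun p => (complex.Re `|f (toC p)| ^+ 2 * mu (toC p))%:E)].

Definition bergman_dot mu f g : R[i] :=
  let h (p : plane R) := f (toC p) * (g (toC p))^* in
  (\int[@dV R]_(p in disc2) (complex.Re (h p) * mu (toC p)))%R +i*
  (\int[@dV R]_(p in disc2) (complex.Im (h p) * mu (toC p)))%R.

Definition is_reproducing_kernel mu (K : R[i] -> R[i] -> R[i]) : Prop :=
  forall w, disc w ->
    bergman_space mu (K ^~ w) /\
    forall f, bergman_space mu f -> f w = bergman_dot mu f (K ^~ w).

(* The reproducing kernel; it is unique on the product of two discs. *)
Definition reproducing_kernel mu : R[i] -> R[i] -> R[i] :=
  xget (fun _ _ => 0) [set K | is_reproducing_kernel mu K].

(* Kernels are real on the diagonal. *)
Definition diagonal (K : R[i] -> R[i] -> R[i]) (z : R[i]) : R :=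
  complex.Re (K z z).

Definition bergman_kernel : R[i] -> R[i] -> R[i] :=
  reproducing_kernel (fun=> 1).

Definition bergman_weight (d : nat) (z : R[i]) : R :=
  diagonal bergman_kernel z ^- d.

Definition weighted_bergman_kernel (d : nat) : R[i] -> R[i] -> R[i] :=
  reproducing_kernel (bergman_weight d).

End weighted_bergman.

Section metric.
Variable R : realType.
Implicit Types (F : R[i] -> R[i]) (z : R[i]).

(* Derivative of a complex-valued function of a real variable. *)
Definition rderive (g : R -> R[i]) (t : R) : R[i] :=
  derive1 (fun s => complex.Re (g s)) t +i* derive1 (fun s => complex.Im (g s)) t.

Definition partial_x F z : R[i] := rderive (fun t => F (z + t%:C)) 0.
Definition partial_y F z : R[i] := rderive (fun t => F (z + t%:C * 'i)) 0.

Definition wirtinger F z : R[i] := (partial_x F z - 'i * partial_y F z) / 2.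
Definition wirtinger_bar F z : R[i] := (partial_x F z + 'i * partial_y F z) / 2.

(* A tensor g dz (x) d(conj z) is represented by its coefficient g. *)
Definition bergman_metric (d : nat) : R[i] -> R[i] :=
  wirtinger (wirtinger_bar
    (fun z => (ln (diagonal (@weighted_bergman_kernel R d) z))%:C)).

Definition pullback (f g : R[i] -> R[i]) (z : R[i]) : R[i] :=
  g (f z) * (cderive f z * (cderive f z)^*).

Definition holomorphic_isometry (d n : nat) (dd : 'I_n -> nat)
    (f : 'I_n -> R[i] -> R[i]) : Prop :=
  [/\ forall i, holomorphic_on (@disc R) (f i),
      forall i z, disc z -> disc (f i z) &
      forall z, disc z ->
        bergman_metric d z = \sum_(i < n) pullback (f i) (bergman_metric (dd i)) z].

Definition disc_automorphism (phi : R[i] -> R[i]) : Prop :=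
  holomorphic_on (@disc R) phi /\ (forall z, disc z -> disc (phi z)) /\
  exists psi : R[i] -> R[i],
    [/\ holomorphic_on (@disc R) psi,
        forall z, disc z -> disc (psi z),
        forall z, disc z -> psi (phi z) = z &
        forall z, disc z -> phi (psi z) = z].

Definition nonconstant_on_disc (f : R[i] -> R[i]) : Prop :=
  exists z w, [/\ disc z, disc w & f z <> f w].

End metric.

(* Main.v *)
(* The kernel of weight [K^-d] is [C (1 - z w^* )^-(2d+2)], obtained by expanding
   in the orthogonal monomials [z^k], so that [ds^2_d] is [2(d+1)] times the
   Poincare metric. With [a = d+1], [a_i = d_i+1] and [f_i(0) = 0] after moving
   by Moebius maps, polarizing the isometry equation and integrating it twice gives
   [prod_i (1 - f_i(z) g_i(w))^a_i = (1 - z w)^a], where [g_i(w) = (f_i(w^* ))^*].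
   Schwarz-Pick at one point yields [a <= sum a_i], and equality forces equality
   in Schwarz-Pick everywhere, so each [f_i] is a rotation. For the sums through
   a given [i], fix [w] and view the [a]-jets of the [f_j] at small [z] as points
   of an affine variety; it has a point at which [f_i = 1 / g_i(w)], and the order
   of vanishing of both sides of the product identity there gives
   [a = sum_j m_j a_j] with [m_i >= 1]. Replacing analytic continuation by such
   formal points avoids monodromy and branch points. *)
Require Import Defs.
From HB Require Import structures.
From mathcomp Require Import all_boot all_order all_algebra.
From mathcomp Require Import complex.
From mathcomp Require Import all_classical all_reals all_analysis.
From mathcomp Require Import measurable_realfun ring lra.
From mathcomp Require mpoly.

Set Implicit Arguments.
Unset Strict Implicit.
Unset Printing Implicit Defensive.

Import Order.TTheory GRing.Theory Num.Theory.
Import numFieldNormedType.Exports.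

Local Open Scope classical_set_scope.
Local Open Scope ring_scope.
Local Open Scope complex_scope.

(* Otherwise [z^*] denotes [Num.conj z] or [conjc z] depending on the scope. *)
Local Notation "z ^*" := (conjc z) : ring_scope.

(** * Complex differentiation *)

(** The kernels are specified only by their reproducing property, so a closed form must be shown to
    reproduce, and kernels to be unique on the disc, before the metric can be differentiated. The
    product identity is established for [z] and [w] of modulus below 1/2; the identity theorem links
    these small discs to the whole disc. For the sums through [i] the obstacle is that [F i] has
    values of modulus below 1 and so never equals [1 / g_i(w)]; the polynomial relations shared by
    all jets do not see this bound. Modulo their ideal, the coordinate recording the value of [F i]
    is transcendental, since [F i] takes uncountably many values. Over an uncountable field such a
    coordinate can be specialized to any element outside a countable set of exceptions, and the
    numbers [1 / g_i(w)] are uncountable, so one of them is reached. Jets of order [a] are taken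
    because [(1 - z w)^a] vanishes to order exactly [a] at the accompanying point [z = 1 / w]. *)

Section cmod.
Variable R : realType.
Implicit Types z w : R[i].

(** The norm of [R[i]] takes its values in [R[i]]; a modulus with values in [R] gives estimates in a
    totally ordered field, within reach of [lra]. *)
Definition cmod z : R := complex.Re `|z|.

Lemma cmodE z : `|z| = (cmod z)%:C.
Proof. by rewrite /cmod normc_def. Qed.
Lemma cmod_ge0 z : 0 <= cmod z.
Proof. by rewrite -lecR -cmodE normr_ge0. Qed.
Lemma cmodM z w : cmod (z * w) = cmod z * cmod w.
Proof. by apply: complexI; rewrite -cmodE normrM !cmodE rmorphM. Qed.
Lemma cmodD z w : cmod (z + w) <= cmod z + cmod w.
Proof. by rewrite -lecR rmorphD /= -!cmodE ler_normD. Qed.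
Lemma cmodN z : cmod (- z) = cmod z.
Proof. by rewrite /cmod normrN. Qed.
Lemma cmodB z w : cmod (z - w) <= cmod z + cmod w.
Proof. by rewrite -[cmod w]cmodN cmodD. Qed.
Lemma cmodC z w : cmod (z - w) = cmod (w - z).
Proof. by rewrite /cmod distrC. Qed.
Lemma cmodBr z w : cmod z - cmod w <= cmod (z - w).
Proof. by rewrite lerBlDr (le_trans _ (cmodD _ _))// subrK. Qed.
Lemma cmod0 : cmod 0 = 0.
Proof. by rewrite /cmod normr0. Qed.
Lemma cmod1 : cmod 1 = 1.
Proof. by rewrite /cmod normr1. Qed.
Lemma cmod_eq0 z : (cmod z == 0) = (z == 0).
Proof. by rewrite -[z == 0]normr_eq0 cmodE eq_complex /= eqxx andbT. Qed.
Lemma cmod_gt0 z : (0 < cmod z) = (z != 0).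
Proof. by rewrite lt_def cmod_ge0 andbT cmod_eq0. Qed.
Lemma cmodV z : cmod z^-1 = (cmod z)^-1.
Proof. by apply: complexI; rewrite -cmodE normfV cmodE fmorphV. Qed.
Lemma cmodX z n : cmod (z ^+ n) = cmod z ^+ n.
Proof. by apply: complexI; rewrite -cmodE normrX cmodE rmorphXn. Qed.
Lemma cmodR (r : R) : cmod r%:C = `|r|.
Proof. by rewrite /cmod normc_def /= expr0n addr0 sqrtr_sqr. Qed.
Lemma cmod_sqr z : cmod z ^+ 2 = complex.Re z ^+ 2 + complex.Im z ^+ 2.
Proof. by rewrite /cmod normc_def /= sqr_sqrtr // addr_ge0 // sqr_ge0. Qed.
Lemma cmodJ z : cmod z^* = cmod z.
Proof. by case: z => a b; rewrite /cmod !normc_def /= sqrrN. Qed.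
Lemma mulcJ z : z * z^* = (cmod z ^+ 2)%:C.
Proof.
rewrite cmod_sqr; case: z => a b /=.
by apply/eqP; rewrite eq_complex /=; apply/andP; split; apply/eqP; ring.
Qed.
Lemma Re_cmod z : `|complex.Re z| <= cmod z.
Proof.
rewrite -(@ler_pXn2r _ 2) ?nnegrE ?cmod_ge0 ?normr_ge0// cmod_sqr real_normK ?num_real//.
by rewrite lerDl sqr_ge0.
Qed.
Lemma Im_cmod z : `|complex.Im z| <= cmod z.
Proof.
rewrite -(@ler_pXn2r _ 2) ?nnegrE ?cmod_ge0 ?normr_ge0// cmod_sqr real_normK ?num_real//.
by rewrite lerDr sqr_ge0.
Qed.
Lemma cmod_le_ReIm z : cmod z <= `|complex.Re z| + `|complex.Im z|.
Proof.
rewrite -(@ler_pXn2r _ 2) ?nnegrE ?cmod_ge0 ?addr_ge0// cmod_sqr sqrrD !real_normK ?num_real//.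
by rewrite -addrA lerD2l lerDr mulrn_wge0 // mulr_ge0.
Qed.
Lemma discE z : disc z <-> cmod z < 1.
Proof. by rewrite /disc /= cmodE -[1]/(1%:C) ltcR. Qed.

Lemma cmod_sum (I : Type) (r : seq I) (P : pred I) (F : I -> R[i]) :
  cmod (\sum_(i <- r | P i) F i) <= \sum_(i <- r | P i) cmod (F i).
Proof.
elim/big_ind2 : _ => //; first by rewrite cmod0.
by move=> a b c d ab cd; exact: le_trans (cmodD _ _) (lerD ab cd).
Qed.

End cmod.

Section complex_differentiation.
Variable R : realType.
Implicit Types (f g : R[i] -> R[i]) (z l h : R[i]).

Definition ccont f z := forall e : R, 0 < e -> exists2 d : R, 0 < d &
  forall h, cmod h < d -> cmod (f (z + h) - f z) <= e.

(** The derivative [l] is an argument, so that the rules below compute it, and the bound is neither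
    strict nor divided by [h], so that [h = 0] is no exception. *)
Definition cdiff f z l := forall e : R, 0 < e -> exists2 d : R, 0 < d &
  forall h, cmod h < d -> cmod (f (z + h) - f z - l * h) <= e * cmod h.

Lemma cdiff_near f g z l (d : R) : 0 < d ->
  (forall h, cmod h < d -> f (z + h) = g (z + h)) -> cdiff f z l -> cdiff g z l.
Proof.
move=> d0 fg fl e e0; have [d1 d10 H] := fl e e0.
exists (Num.min d d1); first by rewrite lt_min d0.
move=> h; rewrite lt_min => /andP[hd hd1]; rewrite -fg// -[z in g z]addr0 -fg ?cmod0//.
by rewrite addr0; exact: H.
Qed.

Lemma cdiff_cont f z l : cdiff f z l -> ccont f z.
Proof.
move=> fl e e0; have [d d0 H] := fl 1 ltr01.
exists (Num.min d (e / (1 + cmod l))) => [|h].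
  by rewrite lt_min d0 divr_gt0// ltr_pwDl// cmod_ge0.
rewrite lt_min ltr_pdivlMr ?ltr_pwDl ?cmod_ge0// => /andP[/H{}H hd].
rewrite -[f (z + h) - f z](subrK (l * h)).
apply: le_trans (cmodD _ _) _; rewrite cmodM.
apply: le_trans (ltW hd); rewrite mulrDr mulr1 mul1r in H *.
by rewrite [_ * cmod l]mulrC lerD2r.
Qed.

Lemma cdiff_cst (c : R[i]) z : cdiff (fun=> c) z 0.
Proof.
move=> e e0; exists 1 => // h _; rewrite subrr sub0r mul0r oppr0 cmod0.
by rewrite mulr_ge0 ?cmod_ge0 ?ltW.
Qed.

Lemma cdiff_id z : cdiff id z 1.
Proof.
move=> e e0; exists 1 => // h _; rewrite mul1r [z + h]addrC addrK subrr cmod0.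
by rewrite mulr_ge0 ?cmod_ge0 ?ltW.
Qed.

Lemma cdiffD f g z l m : cdiff f z l -> cdiff g z m ->
  cdiff (fun w => f w + g w) z (l + m).
Proof.
move=> fl gm e e0; have [d d0 H] := fl _ (divr_gt0 e0 (ltr0Sn _ 1)).
have [d' d'0 H'] := gm _ (divr_gt0 e0 (ltr0Sn _ 1)).
exists (Num.min d d'); first by rewrite lt_min d0.
move=> h; rewrite lt_min => /andP[/H{}H /H'{}H'].
rewrite (_ : _ - _ = (f (z + h) - f z - l * h) + (g (z + h) - g z - m * h)); last by ring.
apply: le_trans (cmodD _ _) _; rewrite (splitr e) mulrDl; exact: lerD.
Qed.

Lemma cdiff_comp f g z l m : cdiff f z l -> cdiff g (f z) m ->
  cdiff (fun w => g (f w)) z (m * l).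
Proof.
move=> fl gm e e0.
have L0 : 0 < cmod l + 1 by rewrite ltr_wpDl// cmod_ge0.
have M0 : 0 < cmod m + 1 by rewrite ltr_wpDl// cmod_ge0.
have e1 : 0 < e / 2 / (cmod l + 1) by rewrite !divr_gt0.
have e2 : 0 < Num.min 1 (e / 2 / (cmod m + 1)) by rewrite lt_min ltr01 !divr_gt0.
have [d' d'0 H'] := gm _ e1.
have [d1 d10 H1] := cdiff_cont fl (divr_gt0 d'0 (ltr0Sn _ 1)).
have [d2 d20 H2] := fl _ e2.
exists (Num.min d1 d2); first by rewrite lt_min d10.
move=> h; rewrite lt_min => /andP[/H1{}H1 /H2{}H2].
pose k := f (z + h) - f z.
have kE : f (z + h) = f z + k by rewrite /k; ring.
have kd : cmod k < d' by apply: le_lt_trans H1 _; lra.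
have {}H' := H' _ kd; rewrite -kE in H'.
rewrite -/k in H2.
rewrite (_ : _ - _ = (g (f (z + h)) - g (f z) - m * k) + m * (k - l * h)); last by ring.
apply: le_trans (cmodD _ _) _; rewrite cmodM (splitr e) mulrDl.
have h0 := cmod_ge0 h.
have kh : cmod k <= (cmod l + 1) * cmod h.
  rewrite -[k](subrK (l * h)) (le_trans (cmodD _ _))// cmodM.
  rewrite mulrDl mul1r addrC lerD2l (le_trans H2)// ler_piMl//.
  by rewrite ge_min lexx.
apply: lerD.
  apply: le_trans H' _; rewrite -ler_pdivlMl// invf_div mulrA.
  by rewrite [X in _ <= X](_ : _ = (cmod l + 1) * cmod h)//; field; lra.
apply: le_trans (_ : (cmod m + 1) * ((e / 2 / (cmod m + 1)) * cmod h) <= _); last first.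
  rewrite le_eqVlt; apply/orP; left; apply/eqP; field; lra.
apply: ler_pM; rewrite ?cmod_ge0//; first by rewrite lerDl.
by apply: le_trans H2 _; apply: ler_wpM2r => //; rewrite ge_min lexx orbT.
Qed.

Lemma cdiffM f g z l m : cdiff f z l -> cdiff g z m ->
  cdiff (fun w => f w * g w) z (l * g z + f z * m).
Proof.
move=> fl gm e e0.
have F0 : 0 < cmod (f z) + 1 by rewrite ltr_wpDl// cmod_ge0.
have G0 : 0 < cmod (g z) + 1 by rewrite ltr_wpDl// cmod_ge0.
have L0 : 0 < cmod l + 1 by rewrite ltr_wpDl// cmod_ge0.
have e1 : 0 < e / 3 / (cmod (g z) + 1) by rewrite !divr_gt0.
have e2 : 0 < e / 3 / (cmod (f z) + 1) by rewrite !divr_gt0.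
have e3 : 0 < e / 3 / (cmod l + 1) by rewrite !divr_gt0.
have [d1 d10 H1] := fl _ e1.
have [d2 d20 H2] := gm _ e2.
have [d3 d30 H3] := cdiff_cont gm e3.
have [d4 d40 H4] := fl _ ltr01.
exists (Num.min (Num.min d1 d2) (Num.min d3 d4)); first by rewrite !lt_min d10 d20 d30.
move=> h; rewrite !lt_min => /andP[/andP[/H1{}H1 /H2{}H2] /andP[/H3{}H3 /H4{}H4]].
have h0 := cmod_ge0 h.
rewrite (_ : _ - _ = (f (z + h) - f z - l * h) * g z + f z * (g (z + h) - g z - m * h)
   + (f (z + h) - f z) * (g (z + h) - g z)); last by ring.
have fh : cmod (f (z + h) - f z) <= (cmod l + 1) * cmod h.
  rewrite -[f (z + h) - f z](subrK (l * h)) (le_trans (cmodD _ _))// cmodM.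
  by rewrite mulrDl addrC lerD2l.
apply: le_trans (cmodD _ _) _; apply: le_trans (lerD (cmodD _ _) (lexx _)) _.
rewrite !cmodM.
have -> : e * cmod h = (e / 3 / (cmod (g z) + 1)) * cmod h * (cmod (g z) + 1)
   + (cmod (f z) + 1) * ((e / 3 / (cmod (f z) + 1)) * cmod h)
   + (cmod l + 1) * cmod h * (e / 3 / (cmod l + 1)) by field; rewrite !gt_eqF.
by rewrite !lerD// ler_pM ?cmod_ge0 // lerDl.
Qed.

Lemma cdiffZ f z l c : cdiff f z l -> cdiff (fun w => c * f w) z (c * l).
Proof.
by move=> fl; have := cdiffM (cdiff_cst c z) fl; rewrite mul0r add0r.
Qed.

Lemma cdiffN f z l : cdiff f z l -> cdiff (fun w => - f w) z (- l).
Proof.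
move=> /(cdiffZ (-1)); rewrite mulN1r.
by apply: (@cdiff_near _ _ _ _ 1) => // h _; rewrite mulN1r.
Qed.

Lemma cdiffB f g z l m : cdiff f z l -> cdiff g z m ->
  cdiff (fun w => f w - g w) z (l - m).
Proof. by move=> fl /cdiffN; exact: cdiffD. Qed.

Lemma cdiffV z : z != 0 -> cdiff (fun w => w^-1) z (- (z ^- 2)).
Proof.
move=> z0 e e0; have cz : 0 < cmod z by rewrite cmod_gt0.
(* The first radius keeps [z + h] at distance [cmod z / 2] from 0; the second makes the exact
   remainder [h ^+ 2 / (z ^+ 2 * (z + h))] at most [e * cmod h]. *)
exists (Num.min (cmod z / 2) (e * (cmod z ^+ 3) / 2)).
  by rewrite lt_min !divr_gt0// mulr_gt0 // exprn_gt0.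
move=> h; rewrite lt_min => /andP[h1 h2].
have zh : cmod z / 2 <= cmod (z + h).
  rewrite -[h]opprK (le_trans _ (cmodBr _ _))// cmodN lerBrDr; lra.
have zh0 : z + h != 0 by rewrite -cmod_gt0; lra.
rewrite (_ : _ - _ = h ^+ 2 / (z ^+ 2 * (z + h))); last first.
  by field; rewrite z0 zh0.
rewrite cmodM cmodV cmodM !cmodX expr2 -mulrA mulrC ler_wpM2r ?cmod_ge0//.
rewrite ler_pdivrMr ?mulr_gt0 ?exprn_gt0 ?cmod_gt0//.
apply: (le_trans (ltW h2)).
rewrite (_ : _ / 2 = e * (cmod z ^+ 2 * (cmod z / 2))); last by field.
by rewrite ler_pM2l// ler_pM2l ?exprn_gt0.
Qed.

Lemma cdiffVf f z l : f z != 0 -> cdiff f z l ->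
  cdiff (fun w => (f w)^-1) z (- l / f z ^+ 2).
Proof.
move=> fz fl; rewrite mulNr mulrC -mulNr.
exact: cdiff_comp fl (cdiffV fz).
Qed.

Lemma cdiff_div f g z l m : g z != 0 -> cdiff f z l -> cdiff g z m ->
  cdiff (fun w => f w / g w) z ((l * g z - f z * m) / g z ^+ 2).
Proof.
move=> gz fl gm; have := cdiffM fl (cdiffVf gz gm).
rewrite (_ : l / g z + _ = (l * g z - f z * m) / g z ^+ 2) //.
by field.
Qed.

Lemma cdiffX n z : cdiff (fun w => w ^+ n) z (n%:R * z ^+ n.-1).
Proof.
elim: n => [|n IH]; first by rewrite mul0r; exact: cdiff_cst.
have := cdiffM (cdiff_id z) IH; rewrite (_ : _ + _ = n.+1%:R * z ^+ n.+1.-1).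
  by apply: (@cdiff_near _ _ _ _ 1) => // h _; rewrite exprS.
case: n {IH} => [|n] /=; first by rewrite !expr0; ring.
by rewrite -[in RHS]natr1 exprS; ring.
Qed.

Lemma cdiff_sum (I : Type) (r : seq I) (F : I -> R[i] -> R[i]) (L : I -> R[i]) z :
  (forall i, cdiff (F i) z (L i)) ->
  cdiff (fun w => \sum_(i <- r) F i w) z (\sum_(i <- r) L i).
Proof.
move=> FL; elim: r => [|i r IH].
  by rewrite big_nil; apply: (@cdiff_near (fun=> 0) _ _ _ 1) (cdiff_cst _ _) => // h _;
    rewrite big_nil.
rewrite big_cons; apply: (@cdiff_near _ _ _ _ 1) (cdiffD (FL i) IH) => // h _.
by rewrite big_cons.
Qed.

Lemma cdiff_unique f z l m : cdiff f z l -> cdiff f z m -> l = m.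
Proof.
move=> fl fm; apply/eqP; rewrite -subr_eq0 -cmod_eq0 eq_le cmod_ge0 andbT.
apply/ler_addgt0Pl => e e0; rewrite addr0.
have [d d0 H] := fl _ (divr_gt0 e0 (ltr0Sn _ 1)).
have [d' d'0 H'] := fm _ (divr_gt0 e0 (ltr0Sn _ 1)).
pose h : R[i] := (Num.min d d' / 2)%:C.
have m0 : 0 < Num.min d d' by rewrite lt_min d0.
have hm : cmod h = Num.min d d' / 2 by rewrite cmodR ger0_norm// divr_ge0// ltW.
have [hd hd'] : cmod h < d /\ cmod h < d'.
  by apply/andP; rewrite -lt_min hm; lra.
have h0 : 0 < cmod h by rewrite hm; lra.
rewrite -(ler_pM2r h0) -cmodM.
rewrite (_ : (l - m) * h = (f (z + h) - f z - m * h) - (f (z + h) - f z - l * h)); last by ring.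
by apply: le_trans (cmodB _ _) _; rewrite (splitr e) mulrDl lerD// ?H' ?H.
Qed.

Lemma cdiff_conj f z l : cdiff f z^* l -> cdiff (fun w => (f w^*)^*) z l^*.
Proof.
move=> fl e /fl[d d0 H]; exists d => // h hd.
by rewrite -[h in l^* * h]conjcK -rmorphM -!rmorphB cmodJ rmorphD -[cmod h]cmodJ H // cmodJ.
Qed.

Lemma nbhsC_cmod z (P : set (R[i]^o)) : nbhs (z : R[i]^o) P <->
  exists2 d : R, 0 < d & forall h, cmod h < d -> P (z + h).
Proof.
split=> [/nbhs_ballP[e /= e0 H]|[d d0 H]].
  have eE : e = (complex.Re e)%:C.
    by move: e0; rewrite ltcE; case: (e) => a b /= /andP[/eqP ->].
  exists (complex.Re e).
    by rewrite -ltcR -eE.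
  move=> h hd; apply: H; rewrite -ball_normE /ball_ /=.
  by rewrite opprD addrA subrr sub0r normrN cmodE eE ltcR.
apply/nbhs_ballP; exists d%:C => /=; first by rewrite ltcR.
move=> w; rewrite -ball_normE /ball_ /= => zw.
rewrite -(subrK z w) addrC; apply: H.
by rewrite -ltcR -cmodE distrC.
Qed.

End complex_differentiation.

(** * Agreement with the derivative of normed-module calculus *)

Section bridge.
Variable R : realType.
Implicit Types (f g : R[i] -> R[i]) (z l h : R[i]).

(** In the partial order of [R[i]], being comparable with 0 forces a vanishing imaginary part. *)
Lemma real_posC (e : R[i]) : 0 < e -> exists2 r : R, 0 < r & e = r%:C.
Proof.
by rewrite ltcE; case: e => a b /= /andP[/eqP -> a0]; exists a.
Qed.

Lemma cdiff_cvgP f z l : cdiff f z l <->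
  ((fun h : R[i]^o => h^-1 *: ((f : R[i]^o -> R[i]^o) (h + z) - f z)) @ (0 : R[i]^o)^' -->
   (l : R[i]^o)).
Proof.
split.
  move=> fl; apply/cvgrPdist_le => _ /real_posC[e e0 ->].
  have [d d0 H] := fl e e0.
  apply/nbhsC_cmod; exists d => // h hd; rewrite add0r => h0.
  rewrite cmodE lecR cmodC.
  have h0' : 0 < cmod h by rewrite cmod_gt0.
  rewrite -(ler_pM2r h0') -cmodM [h + z]addrC.
  rewrite (_ : _ * h = f (z + h) - f z - l * h); first exact: H.
  by rewrite mulrBl mulrC mulrA divff ?mul1r.
move=> /cvgrPdist_le H e e0.
have /H/nbhsC_cmod[d d0 {}H] : 0 < e%:C by rewrite ltcR.
exists d => // h hd; have [->|h0] := eqVneq h 0.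
  by rewrite addr0 mulr0 subrr subr0 cmod0 mulr0.
have := H h hd; rewrite add0r => /(_ h0).
rewrite cmodE lecR cmodC.
have h0' : 0 < cmod h by rewrite cmod_gt0.
rewrite -(ler_pM2r h0') -cmodM [h + z]addrC.
rewrite (_ : _ * h = f (z + h) - f z - l * h)//.
by rewrite mulrBl mulrC mulrA divff ?mul1r.
Qed.

Lemma cdiff_derivable f z l : cdiff f z l -> cderivable f z.
Proof.
move=> /cdiff_cvgP fl; apply/cvg_ex; exists (l : R[i]^o).
by apply: cvg_trans fl; apply: near_eq_cvg; near=> h; rewrite /= /GRing.scale /= mulr1.
Unshelve. all: by end_near. Qed.

Lemma cdiff_derive f z l : cdiff f z l -> cderive f z = l.
Proof.
by move=> /cdiff_cvgP fl; apply: (cvg_lim _ fl); exact: norm_hausdorff.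
Qed.

Lemma derivable_cdiff f z : cderivable f z -> cdiff f z (cderive f z).
Proof.
move=> /cvg_ex[l fl].
suff H : cdiff f z l by rewrite (cdiff_derive H).
apply/cdiff_cvgP; apply: cvg_trans fl; apply: near_eq_cvg; near=> h.
by rewrite /= /GRing.scale /= mulr1.
Unshelve. all: by end_near. Qed.

End bridge.

(** * Integrals of complex-valued functions *)

Section complex_integral.
Context {R : realType} {disp : measure_display} {T : measurableType disp}.
Variable mu : {measure set T -> \bar R}.
Implicit Types (D : set T) (f g h : T -> R[i]).

Definition cintegrable D h :=
  mu.-integrable D (EFin \o (fun x => complex.Re (h x))) /\
  mu.-integrable D (EFin \o (fun x => complex.Im (h x))).

Definition cint D h : R[i] :=
  (\int[mu]_(x in D) complex.Re (h x))%R +i* (\int[mu]_(x in D) complex.Im (h x))%R.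

Lemma eq_cint D f g : (forall x, D x -> f x = g x) -> cint D f = cint D g.
Proof.
by move=> fg; rewrite /cint; congr (_ +i* _); apply: eq_Rintegral => x; rewrite inE => /fg ->.
Qed.

Lemma eq_cintegrable D f g : measurable D -> (forall x, D x -> f x = g x) ->
  cintegrable D f -> cintegrable D g.
Proof.
move=> mD fg [f1 f2]; split; [apply: eq_integrable f1 | apply: eq_integrable f2] => //;
  by move=> x; rewrite inE => /fg /= ->.
Qed.

Lemma cintegrableD D f g : measurable D -> cintegrable D f -> cintegrable D g ->
  cintegrable D (fun x => f x + g x).
Proof.
move=> mD [f1 f2] [g1 g2]; split.
- apply: eq_integrable (integrableD mD f1 g1) => // x _ /=.
  by case: (f x) (g x) => a b [c d].
- apply: eq_integrable (integrableD mD f2 g2) => // x _ /=.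
  by case: (f x) (g x) => a b [c d].
Qed.

Lemma cintD D f g : measurable D -> cintegrable D f -> cintegrable D g ->
  cint D (fun x => f x + g x) = cint D f + cint D g.
Proof.
move=> mD [f1 f2] [g1 g2]; rewrite /cint.
have -> : forall a b c d : R, (a +i* b) + (c +i* d) = (a + c) +i* (b + d) by [].
rewrite -!RintegralD//.
by congr (_ +i* _); apply: eq_Rintegral => x _; case: (f x) (g x) => a b [c d].
Qed.

Lemma integrable_mulr D (r : R) (u : T -> R) : measurable D ->
  mu.-integrable D (EFin \o u) -> mu.-integrable D (EFin \o (fun x => r * u x)).
Proof. by move=> mD iu; apply: eq_integrable (integrableZl mD r iu). Qed.

Lemma cintegrableZ D (c : R[i]) f : measurable D -> cintegrable D f ->
  cintegrable D (fun x => c * f x).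
Proof.
move=> mD [f1 f2]; case: c => a b; split.
- apply: eq_integrable (integrableB mD (integrable_mulr a mD f1) (integrable_mulr b mD f2)) => //.
  by move=> x _ /=; case: (f x).
- apply: eq_integrable (integrableD mD (integrable_mulr a mD f2) (integrable_mulr b mD f1)) => //.
  by move=> x _ /=; case: (f x).
Qed.

Lemma cintZ D (c : R[i]) f : measurable D -> cintegrable D f ->
  cint D (fun x => c * f x) = c * cint D f.
Proof.
move=> mD [f1 f2]; case: c => a b; rewrite /cint.
have -> : forall a b c d : R, (a +i* b) * (c +i* d) = (a * c - b * d) +i* (a * d + b * c) by [].
rewrite -!RintegralZl// -RintegralB//; try exact: integrable_mulr.
rewrite -RintegralD//; try exact: integrable_mulr.
by congr (_ +i* _); apply: eq_Rintegral => x _; case: (f x).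
Qed.

Lemma cintegrableB D f g : measurable D -> cintegrable D f -> cintegrable D g ->
  cintegrable D (fun x => f x - g x).
Proof.
move=> mD If Ig; have := cintegrableD mD If (cintegrableZ (-1) mD Ig).
by apply: eq_cintegrable => // x _; rewrite mulN1r.
Qed.

Lemma cintB D f g : measurable D -> cintegrable D f -> cintegrable D g ->
  cint D (fun x => f x - g x) = cint D f - cint D g.
Proof.
move=> mD If Ig; rewrite -mulN1r -cintZ// -cintD//; last exact: cintegrableZ.
by apply: eq_cint => x _; rewrite mulN1r.
Qed.

Lemma cintegrable0 D : measurable D -> cintegrable D (fun=> 0).
Proof. by move=> mD; split; exact: integrable0. Qed.

Lemma cint0 D : cint D (fun=> 0) = 0.
Proof.
apply/eqP; rewrite eq_complex /= /Rintegral !integral0_eq //.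
by rewrite eqxx.
Qed.

Lemma cintegrable_sum D (I : Type) (r : seq I) (F : I -> T -> R[i]) : measurable D ->
  (forall i, cintegrable D (F i)) -> cintegrable D (fun x => \sum_(i <- r) F i x).
Proof.
move=> mD IF; elim: r => [|i r IH].
  by apply: eq_cintegrable (cintegrable0 mD) => // x _; rewrite big_nil.
apply: eq_cintegrable (cintegrableD mD (IF i) IH) => // x _.
by rewrite big_cons.
Qed.

Lemma cint_sum D (I : Type) (r : seq I) (F : I -> T -> R[i]) : measurable D ->
  (forall i, cintegrable D (F i)) ->
  cint D (fun x => \sum_(i <- r) F i x) = \sum_(i <- r) cint D (F i).
Proof.
move=> mD IF; elim: r => [|i r IH].
  by rewrite big_nil -[RHS](cint0 D); apply: eq_cint => x _; rewrite big_nil.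
rewrite big_cons -IH -cintD//; last exact: cintegrable_sum.
by apply: eq_cint => x _; rewrite big_cons.
Qed.

(* Rotating the integral onto the positive real axis reduces the bound to the real part. *)
Lemma cint_bound D f (g : T -> R) : measurable D -> cintegrable D f ->
  mu.-integrable D (EFin \o g) -> (forall x, D x -> cmod (f x) <= g x) ->
  cmod (cint D f) <= \int[mu]_(x in D) g x.
Proof.
move=> mD If Ig fg; set I := cint D f.
have [I0|I0] := eqVneq I 0.
  rewrite I0 cmod0; apply: Rintegral_ge0 => x /fg; apply: le_trans; exact: cmod_ge0.
have cI : cmod I != 0 by rewrite cmod_eq0.
pose u := I^* / (cmod I)%:C.
have cu : cmod u = 1 by rewrite cmodM cmodV cmodJ cmodR ger0_norm ?cmod_ge0// divff.
have -> : cmod I = complex.Re (u * I).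
  by rewrite mulrAC mulrC [_^* * I]mulrC mulcJ -fmorphV -rmorphM /= expr2 mulrA mulVf// mul1r.
rewrite -cintZ//; apply: le_Rintegral => //; first by case: (cintegrableZ u mD If).
move=> x Dx; apply: le_trans (fg x Dx); rewrite -[cmod (f x)]mul1r -cu -cmodM.
by apply: le_trans (ler_norm _) (Re_cmod _).
Qed.

Lemma cintegrable_setU D E f : measurable D -> measurable E -> D `<=` E ->
  cintegrable E f -> cintegrable D f.
Proof. by move=> mD mE DE [f1 f2]; split; [apply: integrableS f1|apply: integrableS f2]. Qed.

End complex_integral.

(** * Cauchy's formula and power series *)

Section bisection.
Variable R : realType.

Lemma exists_half_pow (K e : R) : 0 < e -> exists n : nat, K / 2 ^+ n < e.
Proof.
move=> e0; exists (Num.bound `|K / e|).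
rewrite ltr_pdivrMr ?exprn_gt0// mulrC -ltr_pdivrMr//.
apply: le_lt_trans (ler_norm _) _.
apply: lt_le_trans (archi_boundP (normr_ge0 (K / e))) _.
by rewrite -natrX ler_nat ltnW// ltn_expl.
Qed.

Lemma max4_le (r1 r2 r3 r4 k : R) : 4 * k <= r1 + r2 + r3 + r4 ->
  [\/ k <= r1, k <= r2, k <= r3 | k <= r4].
Proof.
move=> H; have [h1|h1] := leP k r1; first exact: Or41.
have [h2|h2] := leP k r2; first exact: Or42.
have [h3|h3] := leP k r3; first exact: Or43.
have [h4|h4] := leP k r4; first exact: Or44.
lra.
Qed.

(** Goursat's argument, for an arbitrary additive function of rectangles. If
    [cmod (W a0 b0 c0 d0) = eta > 0], repeated quartering keeps a rectangle with value at least
    [eta / 4 ^+ n] and sides shrunk by [2 ^+ n]; near the common point of these rectangles the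
    quadratic local bound allows only half of that. *)
Lemma bisection (W : R -> R -> R -> R -> R[i]) (a0 b0 c0 d0 : R) : a0 < b0 -> c0 < d0 ->
  (forall a m b c d, a0 <= a -> a <= m -> m <= b -> b <= b0 -> c0 <= c -> c <= d -> d <= d0 ->
     W a b c d = W a m c d + W m b c d) ->
  (forall a b c m d, a0 <= a -> a <= b -> b <= b0 -> c0 <= c -> c <= m -> m <= d -> d <= d0 ->
     W a b c d = W a b c m + W a b m d) ->
  (forall x y e, a0 <= x <= b0 -> c0 <= y <= d0 -> 0 < e -> exists2 del : R, 0 < del &
     forall a b c d, a0 <= a -> a <= x -> x <= b -> b <= b0 ->
       c0 <= c -> c <= y -> y <= d -> d <= d0 -> b - a < del -> d - c < del ->
       cmod (W a b c d) <= e * ((b - a) + (d - c)) ^+ 2) ->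
  W a0 b0 c0 d0 = 0.
Proof.
move=> ab cd addt addth loc; apply/eqP; rewrite -cmod_eq0 eq_le cmod_ge0 andbT leNgt.
apply/negP => W0; set eta := cmod _ in W0.
pose s n := (b0 - a0) / 2 ^+ n; pose t n := (d0 - c0) / 2 ^+ n.
have s_gt0 n : 0 < s n by rewrite divr_gt0 ?subr_gt0 ?exprn_gt0.
have t_gt0 n : 0 < t n by rewrite divr_gt0 ?subr_gt0 ?exprn_gt0.
have sS n : s n = s n.+1 + s n.+1.
  by rewrite /s exprS; field; rewrite expf_eq0 pnatr_eq0 andbF.
have tS n : t n = t n.+1 + t n.+1.
  by rewrite /t exprS; field; rewrite expf_eq0 pnatr_eq0 andbF.
pose P n (a c : R) := [/\ a0 <= a, a + s n <= b0, c0 <= c, c + t n <= d0 &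
   eta / 4 ^+ n <= cmod (W a (a + s n) c (c + t n))].
(* An implication, so that every [p] has a related [q] and [choice] applies to all [p]. *)
pose rel (p q : nat * (R * R)) := P p.1 p.2.1 p.2.2 ->
  [/\ q.1 = p.1.+1, P q.1 q.2.1 q.2.2, p.2.1 <= q.2.1, q.2.1 + s q.1 <= p.2.1 + s p.1 &
   p.2.2 <= q.2.2 /\ q.2.2 + t q.1 <= p.2.2 + t p.1].
have step p : exists q, rel p q.
  have [[]|nP] := pselect (P p.1 p.2.1 p.2.2); last by exists p.
  case: p => n [a c] /= a1 a2 c1 c2 We.
  have := s_gt0 n.+1; have := t_gt0 n.+1 => tp sp.
  have aE : a + s n = a + s n.+1 + s n.+1 by rewrite (sS n) addrA.
  have cE : c + t n = c + t n.+1 + t n.+1 by rewrite (tS n) addrA.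
  have a3 : a <= a + s n.+1 by rewrite lerDl ltW.
  have a4 : a + s n.+1 <= a + s n by rewrite aE lerDl ltW.
  have c3 : c <= c + t n.+1 by rewrite lerDl ltW.
  have c4 : c + t n.+1 <= c + t n by rewrite cE lerDl ltW.
  have a5 := le_trans a1 a3; have a6 := le_trans a4 a2.
  have c5 := le_trans c1 c3; have c6 := le_trans c4 c2.
  have a7 := le_trans a3 a4; have c7 := le_trans c3 c4.
  have : 4 * (eta / 4 ^+ n.+1) <= cmod (W a (a + s n.+1) c (c + t n.+1)) +
     cmod (W a (a + s n.+1) (c + t n.+1) (c + t n)) +
     cmod (W (a + s n.+1) (a + s n) c (c + t n.+1)) +
     cmod (W (a + s n.+1) (a + s n) (c + t n.+1) (c + t n)).
    rewrite [4 * _](_ : _ = eta / 4 ^+ n); last first.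
      by rewrite exprS; field; rewrite expf_eq0 pnatr_eq0 andbF.
    apply: le_trans We _.
    rewrite (addt a (a + s n.+1))// (addth a (a + s n.+1) c (c + t n.+1) (c + t n))//.
    rewrite (addth (a + s n.+1) (a + s n) c (c + t n.+1) (c + t n))//.
    by apply: le_trans (cmodD _ _) _; rewrite -addrA lerD// cmodD.
  move=> /max4_le[]H;
  [exists (n.+1, (a, c)) | exists (n.+1, (a, c + t n.+1)) |
   exists (n.+1, (a + s n.+1, c)) | exists (n.+1, (a + s n.+1, c + t n.+1))];
  by rewrite /rel /P /= => _; split; rewrite -?aE -?cE.
have [nxt nxtP] := choice step.
pose F n := iter n nxt (0%N, (a0, c0)).
have F0 : F 0 = (0%N, (a0, c0)) by [].
have FS n : rel (F n) (F n.+1) := nxtP (F n).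
have PF n : (F n).1 = n /\ P (F n).1 (F n).2.1 (F n).2.2.
  elim: n => [|n [IH1 IH2]].
    rewrite F0 /P /=; split => //.
    by rewrite /s /t !expr0 !divr1 [a0 + _]addrC subrK [c0 + _]addrC subrK.
  by have [G ? _ _ _] := FS n IH2; split=> //; rewrite G IH1.
pose A n := (F n).2.1; pose C n := (F n).2.2.
have AC n : [/\ A n <= A n.+1, A n.+1 + s n.+1 <= A n + s n,
                C n <= C n.+1 & C n.+1 + t n.+1 <= C n + t n].
  have [F1 F2] := PF n; have [G1 _ H1 H2 [H3 H4]] := FS n F2.
  by move: H2 H4; rewrite G1 F1.
have nest (B r : nat -> R) : (forall n, B n <= B n.+1 /\ B n.+1 + r n.+1 <= B n + r n) ->
    (forall n, 0 < r n) -> forall m n, B m <= B n + r n.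
  move=> H r0 m n.
  have up i j : B i <= B (i + j)%N /\ B (i + j)%N + r (i + j)%N <= B i + r i.
    elim: j => [|j [IH1 IH2]]; rewrite ?addn0// addnS.
    by have [h1 h2] := H (i + j)%N; split; [exact: le_trans h1|exact: le_trans IH2].
  have [mn|/ltnW nm] := leqP m n.
    have [h _] := up m (n - m)%N; rewrite subnKC// in h.
    by rewrite (le_trans h)// lerDl ltW.
  have [_ h] := up n (m - n)%N; rewrite subnKC// in h.
  by rewrite (le_trans _ h)// lerDl ltW.
have lim (B r : nat -> R) : (forall n, B n <= B n.+1 /\ B n.+1 + r n.+1 <= B n + r n) ->
    (forall n, 0 < r n) -> exists x, forall n, B n <= x <= B n + r n.
  move=> H r0; have N := nest B r H r0; exists (sup (range B)) => n.
  have hs : has_sup (range B).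
    by split; [exists (B 0), 0|exists (B 0 + r 0) => _ [m _ <-]].
  apply/andP; split; first by apply: ub_le_sup; [case: hs|exists n].
  by apply: ge_sup; [case: hs|move=> _ [m _ <-]].
have [|x xP] := lim A s _ s_gt0; first by move=> n; have [] := AC n.
have [|y yP] := lim C t _ t_gt0; first by move=> n; have [] := AC n.
have [/= _ [A0a A0b C0a C0b _]] := PF 0.
have x0 := xP 0; have y0 := yP 0.
have PA n : P n (A n) (C n) by have [F1 F2] := PF n; rewrite -[X in P X]F1.
have [A1 A2 C1 C2 _] := PA 0.
have K0 : 0 < ((b0 - a0) + (d0 - c0)) ^+ 2 by rewrite exprn_gt0// addr_gt0 ?subr_gt0.
(* With this value of [e] the local bound at stage [n] is exactly [eta / 2 / 4 ^+ n]. *)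
have [|||del del0 H] := loc x y (eta / 2 / ((b0 - a0) + (d0 - c0)) ^+ 2).
- by case/andP: x0 => l1 l2; rewrite (le_trans A1 l1) (le_trans l2 A2).
- by case/andP: y0 => l1 l2; rewrite (le_trans C1 l1) (le_trans l2 C2).
- by rewrite !divr_gt0.
have [n sn] := exists_half_pow (Num.max (b0 - a0) (d0 - c0)) del0.
have [An1 An2 Cn1 Cn2 Wn] := PA n.
have /andP[xn1 xn2] := xP n; have /andP[yn1 yn2] := yP n.
have sd : s n < del.
  apply: le_lt_trans sn; rewrite ler_pM2r ?invr_gt0 ?exprn_gt0//.
  by rewrite le_max lexx.
have td : t n < del.
  apply: le_lt_trans sn; rewrite ler_pM2r ?invr_gt0 ?exprn_gt0//.
  by rewrite le_max lexx orbT.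
have := H (A n) (A n + s n) (C n) (C n + t n).
rewrite ![_ + _ - _]addrAC !subrr !add0r => /(_ An1 xn1 xn2 An2 Cn1 yn1 yn2 Cn2 sd td) Wl.
have := le_trans Wn Wl.
rewrite [X in _ <= X](_ : _ = (eta / 2) / 4 ^+ n); last first.
  rewrite /s /t -mulrDl expr_div_n -exprM mulnC exprM.
  rewrite (_ : 2 ^+ 2 = 4); last by rewrite -natrX.
  by field; rewrite expf_eq0 pnatr_eq0 andbF /= !gt_eqF// addr_gt0 ?subr_gt0.
rewrite ler_pM2r ?invr_gt0 ?exprn_gt0//; clear -W0; lra.
Qed.

End bisection.

(** * Integrals of continuous functions over segments and over the circle *)

Section curves.
Variable R : realType.
Implicit Types (u v : R -> R[i]) (f : R[i] -> R[i]).
Local Notation mu := (@lebesgue_measure R).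

Definition rcont u t := forall e : R, 0 < e -> exists2 d : R, 0 < d &
  forall h : R, `|h| < d -> cmod (u (t + h) - u t) <= e.

Lemma eq_rcont u v t : u =1 v -> rcont u t -> rcont v t.
Proof. by move=> /funext ->. Qed.

Lemma rcont_cst (c : R[i]) t : rcont (fun=> c) t.
Proof. by move=> e e0; exists 1 => // h _; rewrite subrr cmod0 ltW. Qed.

Lemma rcont_id t : rcont (fun t => t%:C) t.
Proof.
by move=> e e0; exists e => // h hd; rewrite rmorphD /= addrAC subrr add0r cmodR ltW.
Qed.

Lemma rcont_comp f u t : ccont f (u t) -> rcont u t -> rcont (fun t => f (u t)) t.
Proof.
move=> cf cu e e0; have [d d0 H] := cf e e0.
have [d' d'0 H'] := cu _ (divr_gt0 d0 (ltr0Sn _ 1)).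
exists d' => // h hd'; rewrite -[u (t + h)](subrK (u t)) [_ - _ + _]addrC.
by apply: H; apply: le_lt_trans (H' h hd') _; lra.
Qed.

Lemma rcontD u v t : rcont u t -> rcont v t -> rcont (fun t => u t + v t) t.
Proof.
move=> cu cv e e0; have [d d0 H] := cu _ (divr_gt0 e0 (ltr0Sn _ 1)).
have [d' d'0 H'] := cv _ (divr_gt0 e0 (ltr0Sn _ 1)).
exists (Num.min d d'); first by rewrite lt_min d0.
move=> h; rewrite lt_min => /andP[/H{}H /H'{}H'].
rewrite opprD addrACA (splitr e); exact: le_trans (cmodD _ _) (lerD _ _).
Qed.

Lemma rcontM u v t : rcont u t -> rcont v t -> rcont (fun t => u t * v t) t.
Proof.
move=> cu cv e e0.
have U0 : 0 < cmod (u t) + 1 by rewrite ltr_wpDl// cmod_ge0.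
have V0 : 0 < cmod (v t) + 1 by rewrite ltr_wpDl// cmod_ge0.
have [d d0 H] := cu _ (divr_gt0 (divr_gt0 e0 (ltr0Sn _ 1)) V0).
have [d2 d20 H2] := cv _ (divr_gt0 (divr_gt0 e0 (ltr0Sn _ 1)) U0).
have [d3 d30 H3] := cv _ ltr01.
exists (Num.min d (Num.min d2 d3)); first by rewrite !lt_min d0 d20.
move=> h; rewrite !lt_min => /and3P[/H{}H /H2{}H2 /H3{}H3].
rewrite (_ : _ - _ = (u (t + h) - u t) * v (t + h) + u t * (v (t + h) - v t)); last by ring.
rewrite (splitr e); apply: le_trans (cmodD _ _) _; rewrite !cmodM; apply: lerD.
  rewrite -[X in _ <= X](@divfK _ (cmod (v t) + 1)) ?gt_eqF//.
  apply: ler_pM; rewrite ?cmod_ge0//.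
  by rewrite -lerBlDl; exact: le_trans (cmodBr _ _) H3.
rewrite mulrC -[X in _ <= X](@divfK _ (cmod (u t) + 1)) ?gt_eqF//.
by apply: ler_pM; rewrite ?cmod_ge0// lerDl.
Qed.

Lemma rcontB u v t : rcont u t -> rcont v t -> rcont (fun t => u t - v t) t.
Proof.
move=> cu cv; have := rcontD cu (rcontM (rcont_cst (-1) t) cv).
by under eq_fun do rewrite mulN1r.
Qed.

Lemma rcontV u t : u t != 0 -> rcont u t -> rcont (fun t => (u t)^-1) t.
Proof. by move=> /cdiffV/cdiff_cont cv cu; exact: (rcont_comp (f := GRing.inv)). Qed.

Lemma rcont_ReP u t : rcont u t ->
  {for t, continuous (fun t => complex.Re (u t))} /\
  {for t, continuous (fun t => complex.Im (u t))}.
Proof.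
move=> cu; have near_u e : 0 < e -> \forall x \near t, cmod (u x - u t) <= e.
  move=> /cu[d d0 H]; near=> x; have -> : u x = u (t + (x - t)) by rewrite addrC subrK.
  apply: H.
  by near: x; apply/nbhs_ballP; exists d => //= y; rewrite /ball /= distrC.
split; apply/(@cvgrPdist_le R R) => e e0; apply: filterS (near_u e e0) => x.
  apply: le_trans; rewrite cmodC (le_trans _ (Re_cmod _))//.
  by case: (u x) (u t) => a b [c d'].
apply: le_trans; rewrite cmodC (le_trans _ (Im_cmod _))//.
by case: (u x) (u t) => a b [c d'].
Unshelve. all: by end_near. Qed.

Lemma rcont_cintegrable (a b : R) u : (forall t, a <= t <= b -> rcont u t) ->
  cintegrable mu `[a, b] u.
Proof.
move=> cu; split; apply: continuous_compact_integrable; try exact: segment_compact;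
  apply: continuous_in_subspaceT => t; rewrite inE /= in_itv /= => /cu/rcont_ReP[]//.
Qed.

Definition segint (a b : R) u : R[i] := cint mu `[a, b] u.

Lemma eq_segint (a b : R) u v : (forall t, a <= t <= b -> u t = v t) ->
  segint a b u = segint a b v.
Proof. by move=> uv; apply: eq_cint => t /=; rewrite in_itv /= => /uv. Qed.

Lemma segintD (a b : R) u v : (forall t, a <= t <= b -> rcont u t) ->
  (forall t, a <= t <= b -> rcont v t) ->
  segint a b (fun t => u t + v t) = segint a b u + segint a b v.
Proof. by move=> cu cv; apply: cintD => //; exact: rcont_cintegrable. Qed.

Lemma segintB (a b : R) u v : (forall t, a <= t <= b -> rcont u t) ->
  (forall t, a <= t <= b -> rcont v t) ->
  segint a b (fun t => u t - v t) = segint a b u - segint a b v.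
Proof. by move=> cu cv; apply: cintB => //; exact: rcont_cintegrable. Qed.

Lemma segintZ (a b : R) (c : R[i]) u : (forall t, a <= t <= b -> rcont u t) ->
  segint a b (fun t => c * u t) = c * segint a b u.
Proof. by move=> cu; apply: cintZ => //; exact: rcont_cintegrable. Qed.

Lemma segint_sum (a b : R) (I : Type) (r : seq I) (F : I -> R -> R[i]) :
  (forall i t, a <= t <= b -> rcont (F i) t) ->
  segint a b (fun t => \sum_(i <- r) F i t) = \sum_(i <- r) segint a b (F i).
Proof. by move=> cF; apply: cint_sum => // i; exact: rcont_cintegrable (cF i). Qed.

Lemma rcont_sum (I : Type) (r : seq I) (F : I -> R -> R[i]) t :
  (forall i, rcont (F i) t) -> rcont (fun t => \sum_(i <- r) F i t) t.
Proof.
move=> cF; elim: r => [|i r IH].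
  by apply: eq_rcont (rcont_cst 0 t) => x; rewrite big_nil.
by apply: eq_rcont (rcontD (cF i) IH) => x; rewrite big_cons.
Qed.

Lemma dist_segment (a b x y : R) : a <= x <= b -> a <= y <= b -> `|x - y| <= b - a.
Proof. by move=> /andP[? ?] /andP[? ?]; rewrite ler_norml; apply/andP; split; lra. Qed.

Lemma segint_itv (a x b : R) u : a <= x -> x <= b -> (forall t, a <= t <= b -> rcont u t) ->
  segint a b u = segint a x u + segint x b u.
Proof.
move=> ax xb /rcont_cintegrable[u1 u2]; rewrite /segint /cint.
have -> : forall a b c d : R, (a +i* b) + (c +i* d) = (a + c) +i* (b + d) by [].
have H (w : R -> R) : mu.-integrable `[a, b] (EFin \o w) ->
   (\int[mu]_(t in `[a, b]) w t = \int[mu]_(t in `[a, x]) w t + \int[mu]_(t in `[x, b]) w t)%R.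
  move=> iw; rewrite -(Rintegral_itv_obnd_cbnd (r := x)); last first.
    apply: integrableS iw => //; apply: subset_itvr.
    by rewrite bnd_simp.
  by rewrite -(@Rintegral_itvB _ w (BLeft a)) ?bnd_simp// addrC subrK.
by rewrite -H// -H.
Qed.

Lemma segint_le (a b M : R) u : a <= b -> (forall t, a <= t <= b -> rcont u t) ->
  (forall t, a <= t <= b -> cmod (u t) <= M) ->
  cmod (segint a b u) <= M * (b - a).
Proof.
move=> ab cu uM; apply: le_trans (cint_bound _ (rcont_cintegrable cu) (g := fun=> M) _ _) _ => //.
- by apply: continuous_compact_integrable; [exact: segment_compact|apply: continuous_subspaceT; exact: cst_continuous].
rewrite Rintegral_cst//= lebesgue_measure_itv /= lte_fin.
case: ltP => [|ba]; rewrite -?EFinB//=.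
have -> : b = a by apply/eqP; rewrite eq_le ab ba.
by rewrite subrr mulr0.
Qed.

Lemma segint_cst (a b : R) (c : R[i]) : a <= b ->
  segint a b (fun=> c) = (b - a)%:C * c.
Proof.
move=> ab; have m : fine (mu `[a, b]) = b - a.
  rewrite lebesgue_measure_itv /= lte_fin.
  case: ltP => [|ba]; rewrite -?EFinB//=.
  have -> : b = a by apply/eqP; rewrite eq_le ab ba.
  by rewrite subrr.
rewrite /segint /cint !Rintegral_cst// m; case: c => x y.
by apply/eqP; rewrite eq_complex /= ; apply/andP; split; apply/eqP; ring.
Qed.

Definition expi (x : R) : R[i] := cos x +i* sin x.

Lemma expiD x y : expi (x + y) = expi x * expi y.
Proof. by rewrite /expi cosD sinD; congr (_ +i* _); rewrite addrC. Qed.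

Lemma expi0 : expi 0 = 1.
Proof. by rewrite /expi cos0 sin0. Qed.

Lemma cmod_expi x : cmod (expi x) = 1.
Proof.
apply/eqP; rewrite -(@eqrXn2 _ 2) ?cmod_ge0//.
by rewrite cmod_sqr expr1n /= cos2Dsin2.
Qed.

Lemma expi_neq0 x : expi x != 0.
Proof. by rewrite -cmod_gt0 cmod_expi. Qed.

Lemma expiN x : expi (- x) = (expi x)^-1.
Proof.
apply: (mulIf (expi_neq0 x)); rewrite mulVf ?expi_neq0//.
by rewrite -expiD addNr expi0.
Qed.

Lemma expiJ x : (expi x)^* = expi (- x).
Proof. by rewrite /expi cosN sinN. Qed.

Lemma expiMn x n : expi (n%:R * x) = expi x ^+ n.
Proof.
elim: n => [|n IH]; first by rewrite mul0r expi0.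
by rewrite -natr1 mulrDl mul1r expiD IH exprSr.
Qed.

Lemma expi_2pi : expi (2 * pi) = 1.
Proof. by rewrite /expi mulr_natl cos2pi sin2pi. Qed.

Lemma cmod_i : cmod ('i : R[i]) = 1.
Proof. by rewrite /cmod normc_def /= expr0n expr1n add0r sqrtr1. Qed.

Lemma segint_expi (k a b : R) : a <= b ->
  segint a b (fun t => ('i * k%:C) * expi (k * t)) = expi (k * b) - expi (k * a).
Proof.
rewrite le_eqVlt => /predU1P[<-|ab].
  by rewrite subrr /segint /cint set_itv1 !Rintegral_set1.
have sc (s c : R -> R) : (forall x : R, is_derive x 1 (s : R -> R) (c x)) ->
    continuous (c : R -> R) ->
   (\int[mu]_(t in `[a, b]) c t = s b - s a)%R.
  move=> ds cc; rewrite /Rintegral (@continuous_FTC2 _ c s a b)//.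
  - exact: continuous_subspaceT.
  - have cs : continuous s.
      move=> x; apply: differentiable_continuous; apply/derivable1_diffP.
      by have [] := ds x.
    split.
    + by move=> x _; have [] := ds x.
    + by apply: cvg_at_right_filter; exact: cs.
    + by apply: cvg_at_left_filter; exact: cs.
  - by move=> x _; rewrite derive1E; have [_ ->] := ds x.
rewrite /segint /cint /expi.
have -> : forall a b c d : R, (a +i* b) - (c +i* d) = (a - c) +i* (b - d) by [].
congr (_ +i* _).
  have dc (x : R) : is_derive x 1 (fun t => cos (k * t)) (- k * sin (k * x)).
    by apply: is_derive_eq; rewrite /GRing.scale /= ; ring.
  rewrite -(sc _ _ dc).
  - by apply: eq_Rintegral => t _ /=; ring.
  - move=> x; apply: cvgM; first exact: cvg_cst.
    apply: (continuous_comp (f := fun t => k * t) (g := sin)); last exact: continuous_sin.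
    by apply: cvgM; [exact: cvg_cst|exact: cvg_id].
have ds (x : R) : is_derive x 1 (fun t => sin (k * t)) (k * cos (k * x)).
  by apply: is_derive_eq; rewrite /GRing.scale /= ; ring.
rewrite -(sc _ _ ds).
- by apply: eq_Rintegral => t _ /=; ring.
- move=> x; apply: cvgM; first exact: cvg_cst.
  apply: (continuous_comp (f := fun t => k * t) (g := cos)); last exact: continuous_cos.
  by apply: cvgM; [exact: cvg_cst|exact: cvg_id].
Qed.

Lemma rcont_expiM (k t : R) : rcont (fun t => expi (k * t)) t.
Proof.
have cf (s : R -> R) : continuous s -> forall e : R, 0 < e -> exists2 d : R, 0 < d &
    forall h, `|h| < d -> `|s (t + h) - s t| <= e.
  move=> cs e e0.
  have /(@cvgrPdist_le R R)/(_ e e0)/nbhs_ballP[d d0 H] := cs t.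
  exists d => // h hd; rewrite distrC; apply: H.
  by rewrite /ball /= opprD addrA subrr sub0r normrN.
have ck : continuous (fun t : R => k * t).
  by move=> x; apply: cvgM; [exact: cvg_cst|exact: cvg_id].
have c1 : continuous (fun t => cos (k * t)).
  by move=> x; apply: (continuous_comp (f := fun t => k * t) (g := cos)); [exact: ck|exact: continuous_cos].
have c2 : continuous (fun t => sin (k * t)).
  by move=> x; apply: (continuous_comp (f := fun t => k * t) (g := sin)); [exact: ck|exact: continuous_sin].
move=> e e0; have e2 := divr_gt0 e0 (ltr0Sn R 1).
have [d1 d10 H1] := cf _ c1 _ e2; have [d2 d20 H2] := cf _ c2 _ e2.
exists (Num.min d1 d2); first by rewrite lt_min d10.
move=> h; rewrite lt_min => /andP[/H1{}H1 /H2{}H2].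
by apply: le_trans (cmod_le_ReIm _) _; rewrite (splitr e) lerD.
Qed.

Lemma rcont_expi t : rcont expi t.
Proof. by have := rcont_expiM 1 t; under eq_fun do rewrite mul1r. Qed.

Lemma segint_expi1 (a b : R) : a <= b ->
  segint a b (fun t => 'i * expi t) = expi b - expi a.
Proof.
move=> ab; have := segint_expi 1 ab; rewrite !mul1r => <-.
by apply: eq_segint => t _; rewrite mulr1 mul1r.
Qed.

Lemma expi_lip (a b : R) : cmod (expi b - expi a) <= `|b - a|.
Proof.
wlog ab : a b / a <= b.
  by move=> H; have [/H//|/ltW/H] := leP a b; rewrite cmodC distrC.
rewrite -segint_expi1// ger0_norm ?subr_ge0// -[b - a]mul1r.
apply: segint_le => // t _; last by rewrite cmodM cmod_expi cmod_i mulr1.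
by apply: rcontM; [exact: rcont_cst|exact: rcont_expi].
Qed.

Lemma segint_period (k : nat) : segint 0 (2 * pi) (fun t => expi (- (k%:R * t))) =
  if k == 0%N then (2 * pi)%:C else 0.
Proof.
have tp : 0 <= 2 * pi :> R by rewrite mulr_ge0// pi_ge0.
case: eqP => [->|/eqP k0].
  rewrite -[RHS]mulr1 -[2 * pi in RHS]subr0 -segint_cst//.
  by apply: eq_segint => t _; rewrite mul0r oppr0 expi0.
have := segint_expi (- k%:R) tp.
rewrite mulr0 expi0 mulNr expiN expiMn expi_2pi expr1n invr1 subrr segintZ//.
  move=> /eqP; rewrite mulf_eq0 => /orP[|/eqP H].
    by rewrite -cmod_eq0 cmodM cmod_i mul1r cmodR normr_eq0 oppr_eq0 pnatr_eq0 (negPf k0).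
  by rewrite -H; apply: eq_segint => t _; rewrite mulNr.
by move=> t _; exact: rcont_expiM.
Qed.

End curves.

(** * Cauchy's integral formula on a circle about 0 *)

Section cauchy_formula.
Context {R : realType}.
Local Notation mu := (@lebesgue_measure R).
Variables (f df : R[i] -> R[i]) (rho r : R) (z : R[i]).
Hypotheses (r_gt0 : 0 < r) (r_rho : r < rho) (zr : cmod z < r).
Hypothesis f_diff : forall w, cmod w < rho -> cdiff f w (df w).

Let gam t : R[i] := r%:C * expi t.
(** Contracts the circle linearly to [z], which is reached at [t = 0]. *)
Let zet (t x : R) : R[i] := z + t%:C * (gam x - z).
(** In the coordinates [t], [x] of [zet] the form [dw / (w - z)] reads [dt / t + kap x dx]; the
    second coefficient does not depend on [t]. *)
Let kap t : R[i] := 'i * (gam t / (gam t - z)).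

Let cmod_gam t : cmod (gam t) = r.
Proof. by rewrite cmodM cmodR cmod_expi mulr1 gtr0_norm. Qed.

Let gamB t : r - cmod z <= cmod (gam t - z).
Proof. by rewrite -[X in X - _](cmod_gam t) cmodBr. Qed.

Let del_gt0 : 0 < r - cmod z.
Proof. by rewrite subr_gt0. Qed.

Let gamB_neq0 t : gam t - z != 0.
Proof. by rewrite -cmod_gt0 (lt_le_trans del_gt0). Qed.

Let rcont_gam t : rcont gam t.
Proof. by apply: rcontM; [exact: rcont_cst|exact: rcont_expi]. Qed.

Let rcont_kap t : rcont kap t.
Proof.
apply: rcontM; first exact: rcont_cst.
apply: rcontM; first exact: rcont_gam.
by apply: rcontV => //; apply: rcontB; [exact: rcont_gam|exact: rcont_cst].
Qed.

Let cmod_kap t : cmod (kap t) <= r / (r - cmod z).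
Proof.
rewrite /kap cmodM cmod_i mul1r cmodM cmod_gam cmodV ler_wpM2l ?(ltW r_gt0)//.
by rewrite lef_pV2 ?posrE// (lt_le_trans del_gt0).
Qed.

Let zet_lt t x : 0 <= t <= 1 -> cmod (zet t x) < rho.
Proof.
move=> /andP[t0 t1].
have -> : zet t x = (1 - t)%:C * z + t%:C * gam x.
  by rewrite /zet rmorphB rmorph1; ring.
apply: le_lt_trans (cmodD _ _) _.
rewrite 2!cmodM !cmodR cmod_gam !ger0_norm ?subr_ge0//.
apply: le_lt_trans r_rho.
rewrite [X in _ <= X](_ : _ = (1 - t) * r + t * r); last by ring.
by rewrite lerD2r ler_wpM2l ?subr_ge0// ltW.
Qed.

Let rcont_zet_t t x : rcont (fun t => zet t x) t.
Proof.
apply: rcontD; first exact: rcont_cst.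
by apply: rcontM; [exact: rcont_id|exact: rcont_cst].
Qed.

Let rcont_zet_x t x : rcont (fun x => zet t x) x.
Proof.
apply: rcontD; first exact: rcont_cst.
apply: rcontM; first exact: rcont_cst.
by apply: rcontB; [exact: rcont_gam|exact: rcont_cst].
Qed.

Let rcont_ft t x : 0 <= t <= 1 -> rcont (fun t => f (zet t x)) t.
Proof.
move=> t01; apply: (rcont_comp (u := fun t => zet t x)) (rcont_zet_t t x).
exact: cdiff_cont (f_diff (zet_lt x t01)).
Qed.

Let rcont_fx t x : 0 <= t <= 1 -> rcont (fun x => f (zet t x)) x.
Proof.
move=> t01; apply: (rcont_comp (u := fun x => zet t x)) (rcont_zet_x t x).
exact: cdiff_cont (f_diff (zet_lt x t01)).
Qed.

(* The integral of [f w / (w - z) dw] around the image under [zet] of a rectangle. *)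
Let W (g : R -> R -> R[i]) (a b c d : R) : R[i] :=
  segint c d (fun x => (g b x - g a x) * kap x) -
  segint a b (fun t => (g t d - g t c) * (t%:C)^-1).

Let fz t x := f (zet t x).

Section rectangle.
Variable t0 : R.
Hypotheses (t0_gt0 : 0 < t0) (t0_lt1 : t0 < 1).

Let in01 t : t0 <= t <= 1 -> 0 <= t <= 1.
Proof. by case/andP => h ->; rewrite (le_trans _ h)// ltW. Qed.

Let tC_neq0 t : t0 <= t <= 1 -> t%:C != 0 :> R[i].
Proof. by case/andP => h _; rewrite -cmod_gt0 cmodR normr_gt0 gt_eqF// (lt_le_trans t0_gt0). Qed.

Let rcont_W1 a b x : t0 <= a <= 1 -> t0 <= b <= 1 ->
  rcont (fun x => (fz b x - fz a x) * kap x) x.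
Proof.
move=> /in01 a01 /in01 b01; apply: rcontM (rcont_kap x).
by apply: rcontB; exact: rcont_fx.
Qed.

Let rcont_W2 c d t : t0 <= t <= 1 -> rcont (fun t => (fz t d - fz t c) * (t%:C)^-1) t.
Proof.
move=> t01; apply: rcontM.
  by apply: rcontB; apply: rcont_ft; exact: in01.
by apply: rcontV; [exact: tC_neq0|exact: rcont_id].
Qed.

(** The first-order part of [f] at [zet x y] contributes nothing to [W]. The remainder is a small
    multiple of the size [S] of the rectangle, and integrating along the sides brings in a second
    factor [S]. *)
Let W_local x y e : t0 <= x <= 1 -> 0 <= y <= 2 * pi -> 0 < e -> exists2 del : R, 0 < del &
  forall a b c d, t0 <= a -> a <= x -> x <= b -> b <= 1 ->
    0 <= c -> c <= y -> y <= d -> d <= 2 * pi -> b - a < del -> d - c < del ->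
    cmod (W fz a b c d) <= e * ((b - a) + (d - c)) ^+ 2.
Proof.
move=> x01 y01 e0; have x01' := in01 x01.
(* Twice (for opposite sides) the Lipschitz constant [2 * r] of [zet], times the sum of the bounds
   for [kap] and [1 / t]: the estimates below then add up to [e * S ^+ 2]. *)
pose K := 4 * r * (r / (r - cmod z) + t0^-1).
have K0 : 0 < K by rewrite !mulr_gt0// addr_gt0 ?invr_gt0// divr_gt0.
set l := df (zet x y).
have [dl dl0 Hf] := f_diff (zet_lt y x01') (divr_gt0 e0 K0).
(* Makes [2 * r * S] smaller than [dl], so that the differentiability estimate applies on the whole
   rectangle. *)
exists (dl / (4 * r + 1)); first by rewrite divr_gt0// addr_gt0// mulr_gt0.
move=> a b c d ta ax xb b1 c0 cy yd d2 bad dcd.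
have ab := le_trans ax xb; have cd := le_trans cy yd.
have a01 : t0 <= a <= 1 by rewrite ta (le_trans ab).
have b01 : t0 <= b <= 1 by rewrite b1 (le_trans ta).
set S := (b - a) + (d - c).
have ba0 : 0 <= b - a by rewrite subr_ge0.
have dc0 : 0 <= d - c by rewrite subr_ge0.
have S0 : 0 <= S by rewrite addr_ge0.
pose E t th : R[i] := f (zet t th) - f (zet x y) - l * (zet t th - zet x y).
have zetB t th : a <= t <= b -> c <= th <= d -> cmod (zet t th - zet x y) <= 2 * r * S.
  move=> /andP[at_ tb] /andP[ct td].
  have -> : zet t th - zet x y = (t - x)%:C * (gam th - z) + x%:C * (r%:C * (expi th - expi y)).
    by rewrite /zet /gam rmorphB; ring.
  apply: le_trans (cmodD _ _) _; rewrite !cmodM !cmodR.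
  rewrite /S mulrDr; apply: lerD.
    rewrite mulrC; apply: ler_pM; rewrite ?cmod_ge0//.
      by rewrite (le_trans (cmodB _ _))// cmod_gam mulr_natl mulr2n lerD2l ltW.
    by apply: dist_segment; apply/andP.
  have -> : 2 * r * (d - c) = 2 * (r * (d - c)) by rewrite mulrA.
  have xe : `|x| <= 1 by case/andP: x01' => h1 h2; rewrite ger0_norm.
  have thy : `|th - y| <= d - c.
    by apply: dist_segment; apply/andP.
  have rr : 0 <= r * (d - c) by rewrite mulr_ge0// ltW.
  apply: le_trans (_ : 1 * (r * (d - c)) <= _); last first.
    by rewrite ler_wpM2r// ler1n.
  apply: ler_pM => //; first by rewrite mulr_ge0// cmod_ge0.
  by rewrite gtr0_norm// ler_pM2l// (le_trans (expi_lip _ _)).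
have EB t th : a <= t <= b -> c <= th <= d -> cmod (E t th) <= e / K * (2 * r * S).
  move=> tab thcd; have zB := zetB t th tab thcd.
  have zE : zet t th = zet x y + (zet t th - zet x y) by rewrite addrC subrK.
  apply: le_trans (_ : _ <= e / K * cmod (zet t th - zet x y)) _; last first.
    by rewrite ler_pM2l// divr_gt0.
  rewrite /E {1}zE; apply: Hf; apply: le_lt_trans zB _.
  have : S < dl / (4 * r + 1) + dl / (4 * r + 1) by rewrite ltrD.
  have rr : 0 < 4 * r + 1 by rewrite addr_gt0// mulr_gt0.
  rewrite -mulrDl ltr_pdivlMr// => SS.
  rewrite -(ltr_pM2l (ltr0Sn R 1)); apply: le_lt_trans (_ : S * (4 * r + 1) < _).
    by rewrite (_ : S * (4 * r + 1) = 2 * (2 * r * S) + S) ?lerDl//; ring.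
  by rewrite [2 * dl]mulr_natl mulr2n.
have in_ab t : a <= t <= b -> t0 <= t <= 1.
  by case/andP => h1 h2; rewrite (le_trans ta h1) (le_trans h2 b1).
have rE_x t th : t0 <= t <= 1 -> rcont (fun th => E t th) th.
  move=> t01; apply: rcontB.
    by apply: rcontB; [exact: rcont_fx (in01 t01)|exact: rcont_cst].
  apply: rcontM; first exact: rcont_cst.
  by apply: rcontB; [exact: rcont_zet_x|exact: rcont_cst].
have rE_t t th : t0 <= t <= 1 -> rcont (fun t => E t th) t.
  move=> t01; apply: rcontB.
    by apply: rcontB; [exact: rcont_ft (in01 t01)|exact: rcont_cst].
  apply: rcontM; first exact: rcont_cst.
  by apply: rcontB; [exact: rcont_zet_t|exact: rcont_cst].
(* [W] vanishes on affine functions of [zet]: the linear part adds the same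
   [lin * (expi d - expi c)] to both integrals. *)
have WE : W fz a b c d = W E a b c d.
  pose lin := l * (b - a)%:C * r%:C.
  have e1 : segint c d (fun th => (fz b th - fz a th) * kap th) =
      segint c d (fun th => (E b th - E a th) * kap th) + lin * (expi d - expi c).
    rewrite -segint_expi1// -segintZ//; last first.
      by move=> t _; apply: rcontM; [exact: rcont_cst|exact: rcont_expi].
    rewrite -segintD//.
    - apply: eq_segint => th _; rewrite /E /lin /kap rmorphB /fz /zet.
      have eg : r%:C * ('i * expi th) = 'i * gam th by rewrite /gam; ring.
      rewrite /= -[_ * r%:C * _]mulrA eg.
      by have := gamB_neq0 th; move: (gam th) => g g0; field.
    - move=> t _; apply: rcontM (rcont_kap t).
      by apply: rcontB; apply: rE_x.
    - move=> t _; apply: rcontM; first exact: rcont_cst.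
      by apply: rcontM; [exact: rcont_cst|exact: rcont_expi].
  have e2 : segint a b (fun t => (fz t d - fz t c) * (t%:C)^-1) =
      segint a b (fun t => (E t d - E t c) * (t%:C)^-1) + lin * (expi d - expi c).
    have -> : lin * (expi d - expi c) = (b - a)%:C * (l * r%:C * (expi d - expi c)).
      by rewrite /lin; ring.
    rewrite -segint_cst// -segintD//.
    - apply: eq_segint => t /in_ab/tC_neq0 tn.
      by rewrite /E /fz /zet /gam; field.
    - move=> t /in_ab tab; apply: rcontM.
        by apply: rcontB; exact: rE_t.
      by apply: rcontV; [exact: tC_neq0|exact: rcont_id].
    - by move=> t _; exact: rcont_cst.
  by rewrite /W e1 e2; ring.
rewrite WE; apply: le_trans (cmodB _ _) _.
pose M := e / K * (2 * r * S).
have M0 : 0 <= M by rewrite mulr_ge0 ?(divr_ge0 (ltW e0) (ltW K0))// mulr_ge0// mulr_ge0// ltW.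
have aab : a <= a <= b by rewrite lexx ab.
have bab : a <= b <= b by rewrite lexx ab.
have ccd : c <= c <= d by rewrite lexx cd.
have dcd' : c <= d <= d by rewrite lexx cd.
have B1 : cmod (segint c d (fun th => (E b th - E a th) * kap th)) <=
    (M + M) * (r / (r - cmod z)) * (d - c).
  apply: segint_le => // th thcd.
    by apply: rcontM (rcont_kap th); apply: rcontB; exact: rE_x.
  rewrite cmodM; apply: ler_pM; rewrite ?cmod_ge0//.
  by apply: le_trans (cmodB _ _) _; apply: lerD; exact: EB.
have B2 : cmod (segint a b (fun t => (E t d - E t c) * (t%:C)^-1)) <=
    (M + M) * t0^-1 * (b - a).
  apply: segint_le => // t tab; have tab' := in_ab t tab.
    apply: rcontM; first by apply: rcontB; exact: rE_t.
    by apply: rcontV; [exact: tC_neq0|exact: rcont_id].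
  have t_gt0 : 0 < t by case/andP: tab' => h _; exact: lt_le_trans h.
  rewrite cmodM; apply: ler_pM; rewrite ?cmod_ge0//.
    by apply: le_trans (cmodB _ _) _; apply: lerD; exact: EB.
  by rewrite cmodV cmodR gtr0_norm// lef_pV2 ?posrE//; case/andP: tab'.
apply: le_trans (lerD B1 B2) _.
have q0 : 0 <= r / (r - cmod z) by rewrite divr_ge0// ltW.
have t00 : 0 <= t0^-1 by rewrite invr_ge0 ltW.
have -> : e * S ^+ 2 = (M + M) * (r / (r - cmod z)) * S + (M + M) * t0^-1 * S.
  rewrite /M /K; field; rewrite !gt_eqF//=.
  rewrite addr_gt0 ?mulr_gt0//; lra.
have MM : 0 <= M + M by rewrite addr_ge0.
apply: lerD; apply: ler_wpM2l.
- by rewrite mulr_ge0.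
- by rewrite /S lerDr.
- by rewrite mulr_ge0.
- by rewrite /S lerDl.
Qed.

(** The bound [t0 > 0] keeps the coefficient [1 / t] of the form bounded, which the local estimate
    requires. *)
Lemma cauchy_rectangle : W fz t0 1 0 (2 * pi) = 0.
Proof.
have tp : 0 < 2 * pi :> R by rewrite mulr_gt0// pi_gt0.
apply: bisection => //.
- move=> a m b c d ta am mb b1 c0 cd d2.
  have ma : t0 <= m <= 1 by rewrite (le_trans ta am) (le_trans mb b1).
  have aa : t0 <= a <= 1 by rewrite ta (le_trans am)// (le_trans mb).
  have bb : t0 <= b <= 1 by rewrite b1 (le_trans ta)// (le_trans am).
  rewrite /W [in LHS](@segint_itv _ a m b)//; last first.
    move=> t /andP[h1 h2]; apply: rcont_W2.
    by rewrite (le_trans ta h1) (le_trans h2 b1).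
  rewrite [in LHS](@eq_segint _ c d _ (fun x => (fz b x - fz m x) * kap x + (fz m x - fz a x) * kap x)); last first.
    by move=> x _; ring.
  rewrite segintD//; first by ring.
  + by move=> t _; exact: rcont_W1.
  + by move=> t _; exact: rcont_W1.
- move=> a b c m d ta ab b1 c0 cm md d2.
  have aa : t0 <= a <= 1 by rewrite ta (le_trans ab).
  have bb : t0 <= b <= 1 by rewrite b1 (le_trans ta).
  have tt t : a <= t <= b -> t0 <= t <= 1.
    by case/andP => h1 h2; rewrite (le_trans ta h1) (le_trans h2 b1).
  rewrite /W [in LHS](@segint_itv _ c m d)//; last first.
    by move=> t _; exact: rcont_W1.
  rewrite [in LHS](@eq_segint _ a b _ (fun t => (fz t d - fz t m) * (t%:C)^-1 + (fz t m - fz t c) * (t%:C)^-1)); last first.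
    by move=> x _; ring.
  rewrite segintD//; first by ring.
  + by move=> t /tt; exact: rcont_W2.
  + by move=> t /tt; exact: rcont_W2.
Qed.

End rectangle.

Let gam_period : gam (2 * pi) = gam 0.
Proof. by rewrite /gam expi_2pi expi0. Qed.

(** The sides [x = 0] and [x = 2 * pi] of the rectangle have the same image, so their contributions
    cancel and only the two circles remain. *)
Let circle_const t0 : 0 < t0 -> t0 < 1 ->
  segint 0 (2 * pi) (fun x => fz 1 x * kap x) =
  segint 0 (2 * pi) (fun x => fz t0 x * kap x).
Proof.
move=> t00 t01; have := cauchy_rectangle t00 t01; rewrite /W.
rewrite (@eq_segint _ t0 1 _ (fun=> 0)); last first.
  by move=> t _; rewrite /fz /zet gam_period subrr mul0r.
rewrite /segint cint0 -/(segint _ _ _) subr0 (@eq_segint _ 0 (2 * pi) _ (fun x => fz 1 x * kap x - fz t0 x * kap x)); last first.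
  by move=> t _; ring.
rewrite segintB//.
- by move=> /eqP; rewrite subr_eq0 => /eqP.
- move=> t _; apply: rcontM (rcont_kap t).
  by apply: rcont_fx; rewrite ler01 lexx.
- move=> t _; apply: rcontM (rcont_kap t).
  by apply: rcont_fx; rewrite !ltW.
Qed.

(** The integral of [f (zet t x) * kap x] is the same for all [t] in []0, 1]]; as [t] tends to 0,
    [f (zet t x)] tends to [f z] uniformly in [x]. *)
Lemma cauchy_kap : segint 0 (2 * pi) (fun x => f (gam x) * kap x) =
  f z * segint 0 (2 * pi) kap.
Proof.
have tp : 0 < 2 * pi :> R by rewrite mulr_gt0// pi_gt0.
apply/eqP; rewrite -subr_eq0 -cmod_eq0 eq_le cmod_ge0 andbT.
apply/ler_addgt0Pl => e e0; rewrite addr0.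
pose M := r / (r - cmod z) * (2 * pi).
have M0 : 0 < M by rewrite mulr_gt0// divr_gt0.
have [d d0 H] := cdiff_cont (f_diff (lt_trans zr r_rho)) (divr_gt0 e0 M0).
(* [zet t x] differs from [z] by at most [2 * r * t], which is below [d]. *)
pose t := Num.min (1 / 2) (d / (4 * r)).
have t0 : 0 < t by rewrite lt_min !divr_gt0// mulr_gt0.
have t1 : t < 1 by rewrite gt_min; apply/orP; left; lra.
have t01 : 0 <= t <= 1 by rewrite !ltW.
rewrite (@eq_segint _ 0 (2 * pi) (fun x => f (gam x) * kap x) (fun x => fz 1 x * kap x)); last first.
  by move=> x _; rewrite /fz /zet rmorph1 mul1r addrC subrK.
rewrite (circle_const t0 t1) -segintZ//.
rewrite -segintB//.
- rewrite [X in _ <= X](_ : _ = e / M * (r / (r - cmod z)) * (2 * pi - 0)); last first.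
    by rewrite subr0 -mulrA -/M divfK// gt_eqF.
  apply: segint_le => [|x _|x _]; first exact: ltW.
    apply: rcontB; apply: rcontM; try exact: rcont_kap; last exact: rcont_cst.
    exact: rcont_fx.
  rewrite -mulrBl cmodM; apply: ler_pM; rewrite ?cmod_ge0//.
  rewrite /fz /zet; apply: H; rewrite cmodM cmodR gtr0_norm//.
  apply: le_lt_trans (_ : d / (4 * r) * (2 * r) < d).
    apply: ler_pM; rewrite ?cmod_ge0 ?(ltW t0)//.
      by rewrite ge_min lexx orbT.
    by rewrite (le_trans (cmodB _ _))// cmod_gam mulr_natl mulr2n lerD2l ltW.
  rewrite (_ : _ * _ = d / 2); last by field; rewrite gt_eqF.
  by rewrite ltr_pdivrMr// ltr_pMr// ltr1n.
- move=> x _; apply: rcontM (rcont_kap x); exact: rcont_fx.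
- by move=> x _; apply: rcontM (rcont_kap x); exact: rcont_cst.
Qed.

(** Expand [gam x / (gam x - z)] in the geometric series of [z / gam x]: by [segint_period] only the
    constant term survives integration, and the remainder decays like a power of [cmod z / r]. *)
Lemma cint_kap : segint 0 (2 * pi) kap = 'i * (2 * pi)%:C.
Proof.
have tp : 0 < 2 * pi :> R by rewrite mulr_gt0// pi_gt0.
have gam_neq0 x : gam x != 0 by rewrite -cmod_gt0 cmod_gam.
have gamV k x : (z / gam x) ^+ k = (z / r%:C) ^+ k * expi (- (k%:R * x)).
  by rewrite /gam invfM mulrA exprMn [expi (- _)]expiN expiMn exprVn.
have rc k x : rcont (fun x => (z / gam x) ^+ k) x.
  apply: eq_rcont (rcontM (rcont_cst ((z / r%:C) ^+ k) x) (rcont_expiM (- k%:R) x)) => t.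
  by rewrite gamV mulNr.
pose q := cmod z / r.
have q0 : 0 <= q by rewrite divr_ge0 ?cmod_ge0// ltW.
have q1 : q < 1 by rewrite ltr_pdivrMr// mul1r.
have tail N x : kap x = 'i * (\sum_(k < N) (z / gam x) ^+ k) + (z / gam x) ^+ N * kap x.
  have gz : 1 - z / gam x != 0.
    by rewrite -(mulfV (gam_neq0 x)) -mulrBl mulf_neq0// invr_eq0.
  have -> : \sum_(k < N) (z / gam x) ^+ k = (1 - (z / gam x) ^+ N) / (1 - z / gam x).
    by apply: (mulIf gz); rewrite divfK// mulrC -opprB mulNr -subrX1 opprB.
  rewrite /kap; set w := (z / gam x) ^+ N.
  have -> : gam x / (gam x - z) = (1 - z / gam x)^-1.
    by field; rewrite gamB_neq0 gam_neq0.
  by move: (1 - z / gam x) gz => u u0; field.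
have main N : segint 0 (2 * pi) kap =
    'i * (2 * pi)%:C + segint 0 (2 * pi) (fun x => (z / gam x) ^+ N.+1 * kap x).
  rewrite (eq_segint (fun x _ => tail N.+1 x)) segintD//.
  - congr (_ + _); rewrite segintZ//; last first.
      by move=> x _; apply: rcont_sum => i; exact: rc.
    congr (_ * _); rewrite segint_sum; last by move=> i x _; exact: rc.
    rewrite big_ord_recl /= big1 ?addr0.
      rewrite (eq_segint (fun x _ => gamV 0%N x)) segintZ//; last first.
        by move=> x _; apply: eq_rcont (rcont_expiM (- _%:R) x) => t; rewrite mulNr.
      by rewrite segint_period mul1r.
    move=> i _; rewrite (eq_segint (fun x _ => gamV (lift ord0 i) x)) segintZ//; last first.
      by move=> x _; apply: eq_rcont (rcont_expiM (- _%:R) x) => t; rewrite mulNr.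
    by rewrite segint_period mulr0.
  - by move=> x _; apply: rcontM; [exact: rcont_cst|apply: rcont_sum => i; exact: rc].
  - by move=> x _; apply: rcontM; [exact: rc|exact: rcont_kap].
apply/eqP; rewrite -subr_eq0 -cmod_eq0 eq_le cmod_ge0 andbT.
apply/ler_addgt0Pl => e e0; rewrite addr0.
pose M := r / (r - cmod z) * (2 * pi).
have M0 : 0 < M by rewrite mulr_gt0// divr_gt0.
have [N HN] : exists N, q ^+ N.+1 < e / M.
  have /cvgrPdist_lt/(_ _ (divr_gt0 e0 M0))[N _ /(_ N.+1 (leqnSn N))] :=
    @cvg_expr R q (eq_ind_r (fun x => x < 1) q1 (ger0_norm q0)).
  by rewrite sub0r normrN ger0_norm ?exprn_ge0// => ?; exists N.
rewrite (main N) addrAC subrr add0r.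
apply: le_trans (_ : q ^+ N.+1 * (r / (r - cmod z)) * (2 * pi - 0) <= _); last first.
  by rewrite subr0 -mulrA -/M -ler_pdivlMr// ltW.
apply: segint_le => [|x _|x _]; first exact: ltW.
  by apply: rcontM; [exact: rc|exact: rcont_kap].
rewrite cmodM; apply: ler_pM; rewrite ?cmod_ge0//.
by rewrite cmodX cmodM cmodV cmod_gam.
Qed.

End cauchy_formula.

(** * Taylor expansion with explicit remainder *)

Section power_series.
Variable R : realType.
Implicit Types (f g u : R[i] -> R[i]) (z w h : R[i]) (r rho : R).

Definition circ_cont r g := forall t, rcont (fun t => g (r%:C * expi t)) t.

(** The contour integral of [g w dw / w] over the circle, divided by [2 pi i]; Cauchy's kernel
    becomes [w / (w - z)]. *)
Definition cmean r g : R[i] :=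
  ((2 * pi)^-1)%:C * segint 0 (2 * pi) (fun t => g (r%:C * expi t)).

Lemma cmod_circ r t : 0 < r -> cmod (r%:C * expi t) = r.
Proof. by move=> r0; rewrite cmodM cmodR cmod_expi mulr1 gtr0_norm. Qed.

Let tp : 0 < 2 * pi :> R.
Proof. by rewrite mulr_gt0// pi_gt0. Qed.

Lemma eq_cmean r g u : 0 < r -> (forall w, cmod w = r -> g w = u w) ->
  cmean r g = cmean r u.
Proof.
by move=> r0 gu; rewrite /cmean; congr (_ * _); apply: eq_segint => t _; rewrite gu// cmod_circ.
Qed.

Lemma cmeanD r g u : circ_cont r g -> circ_cont r u ->
  cmean r (fun w => g w + u w) = cmean r g + cmean r u.
Proof. by move=> cg cu; rewrite /cmean segintD// mulrDr. Qed.

Lemma cmeanB r g u : circ_cont r g -> circ_cont r u ->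
  cmean r (fun w => g w - u w) = cmean r g - cmean r u.
Proof. by move=> cg cu; rewrite /cmean segintB// mulrBr. Qed.

Lemma cmeanZ r (c : R[i]) g : circ_cont r g ->
  cmean r (fun w => c * g w) = c * cmean r g.
Proof. by move=> cg; rewrite /cmean segintZ// mulrCA. Qed.

Lemma cmean_sum r (I : Type) (s : seq I) (F : I -> R[i] -> R[i]) :
  (forall i, circ_cont r (F i)) ->
  cmean r (fun w => \sum_(i <- s) F i w) = \sum_(i <- s) cmean r (F i).
Proof.
move=> cF; rewrite /cmean segint_sum ?mulr_sumr// => i t _; exact: cF.
Qed.

Lemma cmean_le r g (M : R) : 0 < r -> circ_cont r g -> (forall w, cmod w = r -> cmod (g w) <= M) ->
  cmod (cmean r g) <= M.
Proof.
move=> r0 cg gM; rewrite /cmean cmodM cmodR gtr0_norm ?invr_gt0// ler_pdivrMl//.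
rewrite [X in _ <= X](_ : _ = M * (2 * pi - 0)); last by rewrite subr0 mulrC.
apply: segint_le => [|t _|t _]; [exact: ltW|exact: cg|].
by apply: gM; rewrite cmod_circ.
Qed.

Lemma circ_contM r g u : circ_cont r g -> circ_cont r u -> circ_cont r (fun w => g w * u w).
Proof. by move=> cg cu t; apply: rcontM. Qed.
Lemma circ_contB r g u : circ_cont r g -> circ_cont r u -> circ_cont r (fun w => g w - u w).
Proof. by move=> cg cu t; apply: rcontB. Qed.
Lemma circ_cont_id r : circ_cont r id.
Proof. by move=> t; apply: rcontM; [exact: rcont_cst|exact: rcont_expi]. Qed.
Lemma circ_cont_cst r (c : R[i]) : circ_cont r (fun=> c).
Proof. by move=> t; exact: rcont_cst. Qed.
Lemma circ_contV r g : 0 < r -> (forall w, cmod w = r -> g w != 0) -> circ_cont r g ->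
  circ_cont r (fun w => (g w)^-1).
Proof. by move=> r0 g0 cg t; apply: rcontV (cg t); apply: g0; rewrite cmod_circ. Qed.
Lemma circ_contX r n g : circ_cont r g -> circ_cont r (fun w => g w ^+ n).
Proof.
move=> cg; elim: n => [|n IH] t; first by apply: eq_rcont (rcont_cst 1 t) => x; rewrite expr0.
by apply: eq_rcont (circ_contM cg IH t) => x; rewrite exprS.
Qed.
Lemma ccont_circ r g : 0 < r -> (forall w, cmod w = r -> ccont g w) -> circ_cont r g.
Proof.
move=> r0 cg t; apply: (rcont_comp (u := fun t => r%:C * expi t)) (circ_cont_id r t).
by apply: cg; rewrite cmod_circ.
Qed.

Lemma circ_neq0 r w : 0 < r -> cmod w = r -> w != 0.
Proof. by move=> r0 wr; rewrite -cmod_gt0 wr. Qed.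
Lemma circB_neq0 r z w : cmod z < r -> cmod w = r -> w - z != 0.
Proof. by move=> zr wr; rewrite -cmod_gt0 (lt_le_trans _ (cmodBr _ _))// wr subr_gt0. Qed.

Lemma circ_bound r g : circ_cont r g ->
  exists2 M : R, 0 <= M & forall t, 0 <= t <= 2 * pi -> cmod (g (r%:C * expi t)) <= M.
Proof.
move=> cg; pose u t := cmod (g (r%:C * expi t)).
have cu : {within `[0, 2 * pi], continuous u}.
  apply: continuous_subspaceT => t; apply/(@cvgrPdist_le R R) => e e0.
  have [d d0 H] := cg t e e0.
  near=> x; have -> : x = t + (x - t) by rewrite addrC subrK.
  rewrite distrC /u; apply: le_trans (_ : cmod (g (r%:C * expi (t + (x - t))) - g (r%:C * expi t)) <= _).
    rewrite ler_norml cmodBr andbT lerNl opprB cmodC; exact: cmodBr.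
  by apply: H; near: x; apply/nbhs_ballP; exists d => //= y; rewrite /ball /= distrC.
have [c _ uc] := EVT_max (ltW tp) cu.
by exists (u c); [exact: cmod_ge0|move=> t tt; apply: uc; rewrite in_itv].
Unshelve. all: by end_near. Qed.

Lemma cmean_le_mul r g u (M K : R) : 0 < r -> circ_cont r g -> circ_cont r u ->
  (forall t, 0 <= t <= 2 * pi -> cmod (g (r%:C * expi t)) <= M) ->
  (forall w, cmod w = r -> cmod (u w) <= K) ->
  cmod (cmean r (fun w => g w * u w)) <= M * K.
Proof.
move=> r0 cg cu gM uK; rewrite /cmean cmodM cmodR gtr0_norm ?invr_gt0// ler_pdivrMl//.
rewrite [X in _ <= X](_ : _ = M * K * (2 * pi - 0)); last by rewrite subr0 mulrC.
apply: segint_le => [|t _|t tt]; [exact: ltW|exact: circ_contM|].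
by rewrite cmodM ler_pM ?cmod_ge0// ?gM// uK// cmod_circ.
Qed.

Lemma circ_cont_ker r z m : 0 < r -> cmod z < r -> circ_cont r (fun w => (w - z) ^- m).
Proof.
move=> r0 zr; apply: circ_contV => // [w wr|]; first by rewrite expf_neq0// (circB_neq0 zr wr).
by apply: circ_contX; apply: circ_contB; [exact: circ_cont_id|exact: circ_cont_cst].
Qed.

Lemma eq_circ_cont r g u : g =1 u -> circ_cont r g -> circ_cont r u.
Proof. by move=> /funext ->. Qed.

Lemma circ_cont_ker1 r z : 0 < r -> cmod z < r -> circ_cont r (fun w => w / (w - z)).
Proof.
move=> r0 zr; apply: circ_contM; first exact: circ_cont_id.
by apply: eq_circ_cont (circ_cont_ker 1 r0 zr) => w; rewrite expr1.
Qed.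

Lemma cmod_ker r z m w : cmod z < r -> cmod w = r -> cmod ((w - z) ^- m) <= (r - cmod z) ^- m.
Proof.
move=> zr wr; have d0 : 0 < r - cmod z by rewrite subr_gt0.
have h : r - cmod z <= cmod (w - z) by rewrite -wr cmodBr.
rewrite cmodV cmodX lef_pV2 ?posrE ?exprn_gt0 ?(lt_le_trans d0 h)//.
by apply: lerXn2r; rewrite ?nnegrE ?cmod_ge0// ltW.
Qed.

Section cauchy.
Variables (f df : R[i] -> R[i]) (rho : R).
Hypothesis f_diff : forall w, cmod w < rho -> cdiff f w (df w).

Lemma holo_circ r : 0 < r -> r < rho -> circ_cont r f.
Proof.
by move=> r0 rr; apply: ccont_circ => // w wr; apply: cdiff_cont (f_diff _); rewrite wr.
Qed.

Lemma cauchy_mean r z : 0 < r -> r < rho -> cmod z < r ->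
  f z = cmean r (fun w => f w * (w / (w - z))).
Proof.
move=> r0 rr zr.
have cg : circ_cont r (fun w => f w * (w / (w - z))).
  by apply: circ_contM; [exact: holo_circ|exact: circ_cont_ker1].
have := cauchy_kap r0 rr zr f_diff; rewrite (cint_kap r0 zr) => E.
have i0 : 'i != 0 :> R[i] by rewrite -cmod_gt0 cmod_i.
have p0 : (2 * pi)%:C != 0 :> R[i] by rewrite -cmod_gt0 cmodR normr_gt0 gt_eqF.
have {}E : 'i * segint 0 (2 * pi) (fun t => f (r%:C * expi t) * ((r%:C * expi t) / (r%:C * expi t - z)))
   = f z * ('i * (2 * pi)%:C).
  rewrite -E -segintZ; first by apply: eq_segint => t _; rewrite mulrCA.
  by move=> t _; exact: cg.
apply: (mulIf (mulf_neq0 i0 p0)); rewrite -E /cmean fmorphV.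
have gen (c S i : R[i]) : c != 0 -> i * S = c^-1 * S * (i * c) by move=> c0; field.
exact: gen.
Qed.

(** Cauchy's integral for the coefficient of [z ^+ k]; its independence of [r] comes later from
    [series_unique]. *)
Definition taylor r k : R[i] := cmean r (fun w => f w * w ^- k).

Let circ_fV r k : 0 < r -> r < rho -> circ_cont r (fun w => f w * w ^- k).
Proof.
move=> r0 rr; apply: circ_contM; first exact: holo_circ.
apply: circ_contV => // [w wr|]; first by rewrite expf_neq0// (circ_neq0 r0 wr).
by apply: circ_contX; exact: circ_cont_id.
Qed.

(** The finite geometric sum for [w / (w - z)] in powers of [z / w], inserted in Cauchy's formula
    with its remainder kept as an exact integral. *)
Lemma taylorE r z N : 0 < r -> r < rho -> cmod z < r ->
  f z = \sum_(k < N) taylor r k * z ^+ k +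
        z ^+ N * cmean r (fun w => f w * (w ^- N * (w / (w - z)))).
Proof.
move=> r0 rr zr; rewrite {1}(cauchy_mean r0 rr zr).
have cR : circ_cont r (fun w => f w * (w ^- N * (w / (w - z)))).
  apply: eq_circ_cont (circ_contM (circ_fV N r0 rr) (circ_cont_ker1 r0 zr)) => w.
  by rewrite -mulrA.
rewrite -cmeanZ// (eq_cmean r0 (u := fun w => (\sum_(k < N) z ^+ k * (f w * w ^- k)) +
    z ^+ N * (f w * (w ^- N * (w / (w - z))))))//; last first.
  move=> w wr; have w0 := circ_neq0 r0 wr; have wz := circB_neq0 zr wr.
  under eq_bigr do rewrite mulrCA -exprVn -exprMn.
  have zw : 1 - z / w != 0 by rewrite -(mulfV w0) -mulrBl mulf_neq0// invr_eq0.
  have zww : w - z = w * (1 - z / w) by rewrite mulrBr mulr1 mulrCA mulfV// mulr1.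
  rewrite -mulr_sumr [z ^+ N * _]mulrCA -mulrDr; congr (_ * _).
  have -> : \sum_(k < N) (z / w) ^+ k = (1 - (z / w) ^+ N) / (1 - z / w).
    by apply: (mulIf zw); rewrite divfK// mulrC -opprB mulNr -subrX1 opprB.
  rewrite mulrA -exprVn -exprMn zww invfM mulrA divff// mul1r.
  by move: (1 - z / w) zw => v v0; field.
rewrite cmeanD.
- rewrite cmean_sum; last by move=> i; apply: circ_contM; [exact: circ_cont_cst|exact: circ_fV].
  by congr (_ + _); apply: eq_bigr => k _; rewrite cmeanZ 1?mulrC//; exact: circ_fV.
- by move=> t; apply: rcont_sum => i; apply: rcontM; [exact: rcont_cst|exact: (circ_fV i r0 rr t)].
- by apply: circ_contM; [exact: circ_cont_cst|].
Qed.

Lemma taylor_bound r : 0 < r -> r < rho -> exists2 M : R, 0 <= M &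
  (forall k, cmod (taylor r k) <= M / r ^+ k) /\
  (forall z N, cmod z < r ->
    cmod (f z - \sum_(k < N) taylor r k * z ^+ k) <= M * (cmod z / r) ^+ N * (r / (r - cmod z))).
Proof.
move=> r0 rr; have [M M0 fM] := circ_bound (holo_circ r0 rr).
exists M => //; split=> [k|z N zr].
  apply: cmean_le_mul fM _ => //; first exact: holo_circ.
    apply: circ_contV => // [w wr|]; first by rewrite expf_neq0// (circ_neq0 r0 wr).
    by apply: circ_contX; exact: circ_cont_id.
  by move=> w wr; rewrite cmodV cmodX wr.
rewrite {1}(taylorE N r0 rr zr) addrAC subrr add0r cmodM cmodX.
rewrite [X in _ <= X](_ : _ = cmod z ^+ N * (M * (r ^- N * (r / (r - cmod z))))); last first.
  by rewrite exprMn exprVn; ring.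
apply: ler_wpM2l; first by rewrite exprn_ge0// cmod_ge0.
apply: cmean_le_mul fM _ => //; first exact: holo_circ.
  apply: circ_contM; last exact: circ_cont_ker1.
  apply: circ_contV => // [w wr|]; first by rewrite expf_neq0// (circ_neq0 r0 wr).
  by apply: circ_contX; exact: circ_cont_id.
move=> w wr; rewrite cmodM cmodV cmodX wr cmodM wr.
rewrite ler_wpM2l ?invr_ge0 ?exprn_ge0 ?(ltW r0)// ler_wpM2l ?(ltW r0)//.
by have := cmod_ker 1 zr wr; rewrite !expr1.
Qed.

End cauchy.

(** The bound is asked for only away from 0, so that it survives division by ['X] in the
    induction. *)
Lemma poly_small (p : {poly R[i]}) N (M d : R) : 0 < d ->
  (forall z, z != 0 -> cmod z < d -> cmod p.[z] <= M * cmod z ^+ N) -> forall k, (k < N)%N -> p`_k = 0.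
Proof.
elim: N p => [//|N IH] p d0 pM k.
have [q [c pE]] : exists q c, p = q * 'X + c%:P.
  by elim/poly_ind: p {pM} => [|q c _]; [exists 0, 0; rewrite mul0r addr0|exists q, c].
have [B B0 qB] : exists2 B : R, 0 <= B & forall z, cmod z <= 1 -> cmod q.[z] <= B.
  exists (\sum_(i < size q) cmod q`_i); first by apply: sumr_ge0 => i _; exact: cmod_ge0.
  move=> z z1; rewrite horner_coef (le_trans (cmod_sum _ _ _))//; apply: ler_sum => i _.
  by rewrite cmodM cmodX ler_piMr ?cmod_ge0// exprn_ile1// cmod_ge0.
have c0 : c = 0.
  apply/eqP; rewrite -cmod_eq0 eq_le cmod_ge0 andbT; apply/ler_addgt0Pl => e e0; rewrite addr0.
  pose x := Num.min (Num.min 1 (d / 2)) (e / (B + `|M| + 1)).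
  have BM : 0 < B + `|M| + 1 by rewrite ltr_wpDl// addr_ge0.
  have x0 : 0 < x by rewrite !lt_min ltr01 !divr_gt0.
  have x1 : x <= 1 by rewrite !ge_min lexx.
  have xd : x < d.
    by rewrite !gt_min; apply/orP; left; apply/orP; right; rewrite ltr_pdivrMr// ltr_pMr// ltr1n.
  have xe : x * (B + `|M| + 1) <= e.
    by rewrite -ler_pdivlMr// !ge_min lexx !orbT.
  have cx : cmod x%:C = x by rewrite cmodR gtr0_norm.
  have := pM x%:C; rewrite cx -cmod_gt0 cx => /(_ x0 xd).
  rewrite pE !hornerE => H.
  rewrite (_ : c = (q.[x%:C] * x%:C + c) - q.[x%:C] * x%:C); last by ring.
  apply: le_trans (cmodB _ _) _; apply: le_trans xe.
  rewrite cmodM cx [x * _]mulrC -addrA [B + _]addrC mulrDl addrC lerD//; last by rewrite ler_wpM2r ?(ltW x0)// qB// cx.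
  apply: le_trans H _; rewrite exprS mulrA mulrAC ler_wpM2r ?(ltW x0)//.
  apply: le_trans (_ : `|M| <= _); last by rewrite lerDr.
  apply: le_trans (ler_norm _) _; rewrite normrM ler_piMr// ger0_norm ?exprn_ge0 ?(ltW x0)//.
  by rewrite exprn_ile1// ltW.
rewrite pE c0 addr0; case: k => [|k]; first by rewrite coefMX.
rewrite ltnS coefMX /= => kN; apply: IH kN => // z z0 zd.
have := pM z z0 zd; rewrite pE c0 addr0 !hornerE cmodM exprSr mulrA ler_pM2r// cmod_gt0//.
Qed.

End power_series.

(** * Power series, identity theorem and derivatives of holomorphic functions *)

Section holomorphic.
Variable R : realType.
Implicit Types (f g u : R[i] -> R[i]) (z w h : R[i]) (r rho : R).

Definition holo rho f := forall w, cmod w < rho -> exists l, cdiff f w l.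

Lemma holoP rho f : holo rho f -> exists df, forall w, cmod w < rho -> cdiff f w (df w).
Proof.
move=> hf; have /choice[df dfP] : forall w, exists l, cmod w < rho -> cdiff f w l.
  by move=> w; have [/hf[l fl]|_] := ltP (cmod w) rho; [exists l|exists 0].
by exists df.
Qed.

(** Coefficient and remainder estimates with explicit rates, in the role of convergence of the power
    series. *)
Definition series_bound f (c : nat -> R[i]) r (M : R) :=
  (forall k, cmod (c k) <= M / r ^+ k) /\
  (forall z N, cmod z < r ->
    cmod (f z - \sum_(k < N) c k * z ^+ k) <= M * (cmod z / r) ^+ N * (r / (r - cmod z))).

(** Two partial sums of equal length differ by a polynomial that is small of high order at 0. This
    lets a single coefficient sequence serve all radii in [holo_series]. *)
Lemma series_unique f c c' r r' M M' : 0 < r -> 0 < r' -> 0 <= M -> 0 <= M' ->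
  series_bound f c r M -> series_bound f c' r' M' -> c =1 c'.
Proof.
move=> r0 r'0 M0 M'0 [_ b] [_ b'] k.
pose d := Num.min (r / 2) (r' / 2).
have d0 : 0 < d by rewrite lt_min !divr_gt0.
pose p := \poly_(j < k.+1) (c j - c' j).
have pz z : p.[z] = \sum_(j < k.+1) c j * z ^+ j - \sum_(j < k.+1) c' j * z ^+ j.
  by rewrite horner_poly -sumrB; apply: eq_bigr => j _; rewrite mulrBl.
have half (s S : R) z : 0 < s -> 0 <= S -> cmod z < s / 2 ->
    S * (cmod z / s) ^+ k.+1 * (s / (s - cmod z)) <= S * 2 / s ^+ k.+1 * cmod z ^+ k.+1.
  move=> s0 S0 zs; rewrite expr_div_n.
  have -> : S * 2 / s ^+ k.+1 * cmod z ^+ k.+1 = S * (cmod z ^+ k.+1 / s ^+ k.+1) * 2 by ring.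
  apply: ler_wpM2l; first by rewrite mulr_ge0// divr_ge0// exprn_ge0 ?cmod_ge0// ltW.
  rewrite ler_pdivrMr; lra.
have : p`_k = 0.
  apply: (@poly_small _ _ k.+1 (M * 2 / r ^+ k.+1 + M' * 2 / r' ^+ k.+1) d) => // z _ zd.
  have zr : cmod z < r / 2 by apply: lt_le_trans zd _; rewrite ge_min lexx.
  have zr' : cmod z < r' / 2 by apply: lt_le_trans zd _; rewrite ge_min lexx orbT.
  rewrite pz -opprB (_ : _ - _ = (f z - \sum_(j < k.+1) c j * z ^+ j) - (f z - \sum_(j < k.+1) c' j * z ^+ j)); last by ring.
  rewrite cmodN (le_trans (cmodB _ _))// mulrDl lerD//.
    by apply: le_trans (b _ _ _) (half _ _ _ _ _ zr) => //; lra.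
  by apply: le_trans (b' _ _ _) (half _ _ _ _ _ zr') => //; lra.
by rewrite coef_poly ltnSn => /eqP; rewrite subr_eq0 => /eqP.
Qed.

Theorem holo_series rho f : 0 < rho -> holo rho f ->
  exists c, forall r, 0 < r -> r < rho -> exists2 M : R, 0 <= M & series_bound f c r M.
Proof.
move=> rho0 /holoP[df fd].
have h0 : 0 < rho / 2 by rewrite divr_gt0.
have h1 : rho / 2 < rho by rewrite ltr_pdivrMr// ltr_pMr// ltr1n.
exists (taylor f (rho / 2)) => r r0 rr.
have [M M0 b] := taylor_bound fd h0 h1.
have [M' M'0 b'] := taylor_bound fd r0 rr.
exists M'; first exact: M'0.
have {}b : series_bound f (taylor f (rho / 2)) (rho / 2) M by case: b => b1 b2; split.
have {}b' : series_bound f (taylor f r) r M' by case: b' => b1 b2; split.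
have tE := series_unique h0 r0 M0 M'0 b b'.
case: b' => b1 b2; split=> [k|z N zr]; first by rewrite tE.
by under eq_bigr do rewrite tE; apply: b2.
Qed.

Lemma series_cvg0 r z (M e : R) : cmod z < r -> 0 < e ->
  exists N, forall n, (N <= n)%N -> M * (cmod z / r) ^+ n * (r / (r - cmod z)) < e.
Proof.
move=> zr e0; have r0 : 0 < r by apply: le_lt_trans zr; exact: cmod_ge0.
have q0 : 0 <= cmod z / r by rewrite divr_ge0 ?cmod_ge0// ltW.
have q1 : `|cmod z / r| < 1 by rewrite ger0_norm// ltr_pdivrMr// mul1r.
have K0 : 0 < `|M| * (r / (r - cmod z)) + 1.
  by rewrite ltr_wpDl// mulr_ge0// divr_ge0 ?subr_ge0// ltW.
have /cvgrPdist_lt/(_ _ (divr_gt0 e0 K0))[N _ HN] := @cvg_expr R _ q1.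
exists N => n /HN; rewrite /= sub0r normrN ger0_norm ?exprn_ge0// ltr_pdivlMr// => H.
apply: le_lt_trans H.
rewrite mulrAC mulrC ler_wpM2l ?exprn_ge0//.
apply: le_trans (_ : `|M| * (r / (r - cmod z)) <= _); last by rewrite lerDl.
by rewrite ler_wpM2r ?ler_norm// divr_ge0 ?subr_ge0// ltW.
Qed.

(** If all coefficients before the [k]-th vanish, the remainder bound at zeros [z] closer and closer
    to 0 forces the [k]-th to vanish as well. The expansion about 0 is valid on the whole disc, so
    [f] vanishes there at once. *)
Theorem holo_zero rho f : holo rho f ->
  (forall e : R, 0 < e -> exists z, [/\ 0 < cmod z, cmod z < e & f z = 0]) ->
  forall z, cmod z < rho -> f z = 0.
Proof.
move=> hf acc z0 z0rho.
have rho0 : 0 < rho by apply: le_lt_trans z0rho; exact: cmod_ge0.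
have [c cP] := holo_series rho0 hf.
pose r := (cmod z0 + rho) / 2.
have [r0 zr rr] : [/\ 0 < r, cmod z0 < r & r < rho].
  by have := cmod_ge0 z0; rewrite /r; split; lra.
have [M M0 [b1 b2]] := cP r r0 rr.
have c0 k : c k = 0.
  elim/ltn_ind: k => k IH.
  apply/eqP; rewrite -cmod_eq0 eq_le cmod_ge0 andbT; apply/ler_addgt0Pl => e e0; rewrite addr0.
  pose K := M / r ^+ k.+1 * 2 + 1.
  have K0 : 0 < K by rewrite ltr_wpDl// mulr_ge0// divr_ge0// exprn_ge0// ltW.
  have [|z [z_gt0 ze fz]] := acc (Num.min (r / 2) (e / K)).
    by rewrite lt_min (divr_gt0 r0)// (divr_gt0 e0 K0).
  move: ze; rewrite lt_min (ltr_pdivlMr _ _ K0) => /andP[zr2 ze].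
  have zlr : cmod z < r by lra.
  have := b2 z k.+1 zlr; rewrite fz sub0r cmodN big_ord_recr /= big1 ?add0r; last first.
    by move=> j _; rewrite IH ?mul0r.
  rewrite cmodM cmodX => H.
  have zk : 0 < cmod z ^+ k by rewrite exprn_gt0.
  rewrite -(ler_pM2r zk); apply: le_trans H _.
  apply: le_trans (_ : cmod z * K * cmod z ^+ k <= _); last by rewrite ler_wpM2r// ltW.
  rewrite /K expr_div_n exprS.
  rewrite [X in X <= _](_ : _ = (M / r ^+ k.+1 * (r / (r - cmod z))) * (cmod z * cmod z ^+ k)); last by ring.
  rewrite [X in _ <= X](_ : _ = (M / r ^+ k.+1 * 2 + 1) * (cmod z * cmod z ^+ k)); last by ring.
  apply: ler_wpM2r; first by rewrite mulr_ge0// ltW.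
  apply: le_trans (_ : M / r ^+ k.+1 * 2 <= _); last by rewrite lerDl.
  apply: ler_wpM2l; first by rewrite divr_ge0// exprn_ge0// ltW.
  by rewrite ler_pdivrMr; lra.
apply/eqP; rewrite -cmod_eq0 eq_le cmod_ge0 andbT; apply/ler_addgt0Pl => e e0; rewrite addr0.
have [N HN] := series_cvg0 M zr e0.
have := b2 z0 N zr; rewrite big1 ?subr0; last by move=> j _; rewrite c0 mul0r.
by move=> H; apply: le_trans H (ltW (HN N (leqnn N))).
Qed.

Lemma cdiff_sq f z l (C d : R) : 0 < d ->
  (forall h, cmod h < d -> cmod (f (z + h) - f z - l * h) <= C * cmod h ^+ 2) -> cdiff f z l.
Proof.
move=> d0 H e e0; have K0 : 0 < `|C| + 1 by rewrite ltr_wpDl.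
exists (Num.min d (e / (`|C| + 1))); first by rewrite lt_min d0 divr_gt0.
move=> h; rewrite lt_min ltr_pdivlMr// => /andP[/H{}H he].
apply: le_trans H _; rewrite expr2 mulrA ler_wpM2r ?cmod_ge0//.
apply: le_trans (ltW he); rewrite mulrC ler_wpM2l ?cmod_ge0//.
by apply: le_trans (ler_norm _) _; rewrite lerDl.
Qed.

Lemma circ_ker_shift r z h w : cmod z < r -> cmod h < (r - cmod z) / 2 -> cmod w = r ->
  w - z != 0 /\ w - z - h != 0 /\ cmod (z + h) < r /\
  cmod (w - z - h)^-1 <= ((r - cmod z) / 2)^-1.
Proof.
move=> zr hd wr; have wz := circB_neq0 zr wr.
have zh : cmod (z + h) < r by apply: le_lt_trans (cmodD _ _) _; lra.
have wzh : w - z - h != 0 by rewrite -addrA -opprD; exact: circB_neq0 wr.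
split=> //; split=> //; split=> //; rewrite cmodV lef_pV2 ?posrE ?cmod_gt0//; last by lra.
rewrite (le_trans _ (cmodBr _ _))//.
have : r - cmod z <= cmod (w - z) by rewrite -wr cmodBr.
by move=> h1; rewrite lerBrDr; apply: le_trans h1; lra.
Qed.

(** The remainder of [(w - z)^-1] is exactly [h ^+ 2] times a kernel bounded on the circle, so the
    derivative passes under the integral by a direct estimate. *)
Lemma cdiff_cmean1 r u z : 0 < r -> circ_cont r u -> cmod z < r ->
  cdiff (fun z => cmean r (fun w => u w * (w - z)^-1)) z (cmean r (fun w => u w * (w - z) ^- 2)).
Proof.
move=> r0 cu zr; have [M M0 uM] := circ_bound cu.
pose d := r - cmod z; have d0 : 0 < d by rewrite subr_gt0.
have c1 z' : cmod z' < r -> circ_cont r (fun w => (w - z')^-1).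
  by move=> zr'; apply: eq_circ_cont (circ_cont_ker 1 r0 zr') => w; rewrite expr1.
apply: (@cdiff_sq _ _ _ (M * (d ^- 2 * (d / 2)^-1)) (d / 2)); first by rewrite divr_gt0.
move=> h hd.
have hsh w : cmod w = r -> _ := circ_ker_shift zr hd.
have zhr : cmod (z + h) < r by apply: le_lt_trans (cmodD _ _) _; rewrite /d in hd; lra.
have := c1 _ zhr; have := c1 _ zr; have := circ_cont_ker 2 r0 zr => c2 c3 c4.
rewrite -cmeanB; [|exact: circ_contM|exact: circ_contM].
rewrite [_ * h]mulrC -cmeanZ; last exact: circ_contM.
rewrite -cmeanB; last 2 first.
- by apply: circ_contB; apply: circ_contM.
- by apply: circ_contM; [exact: circ_cont_cst|exact: circ_contM].
rewrite (eq_cmean r0 (u := fun w => h ^+ 2 * (u w * ((w - z) ^- 2 * (w - (z + h))^-1)))); last first.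
  move=> w wr; have [a1 [a2 _]] := hsh w wr.
  by rewrite opprD addrA; field; rewrite a1 a2.
rewrite cmeanZ; last by apply: circ_contM => //; exact: circ_contM.
rewrite cmodM cmodX mulrC ler_wpM2r ?exprn_ge0 ?cmod_ge0//.
apply: cmean_le_mul uM _ => //; first exact: circ_contM.
move=> w wr; have [_ [_ [_ a4]]] := hsh w wr.
rewrite cmodM ler_pM ?cmod_ge0//; first exact: cmod_ker zr wr.
by rewrite opprD addrA.
Qed.

Lemma cdiff_cmean2 r u z : 0 < r -> circ_cont r u -> cmod z < r ->
  cdiff (fun z => cmean r (fun w => u w * (w - z) ^- 2)) z (2 * cmean r (fun w => u w * (w - z) ^- 3)).
Proof.
move=> r0 cu zr; have [M M0 uM] := circ_bound cu.
pose d := r - cmod z; have d0 : 0 < d by rewrite subr_gt0.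
(* On the circle [3 * (w - z) - 2 * h] is at most [6 * r], [w - z] at least [d] and [w - z - h] at
   least [d / 2] in modulus. *)
apply: (@cdiff_sq _ _ _ (M * ((6 * r) * (d ^- 3 * ((d / 2)^-1) ^+ 2)) ) (d / 2)); first by rewrite divr_gt0.
move=> h hd.
have hsh w : cmod w = r -> _ := circ_ker_shift zr hd.
have zhr : cmod (z + h) < r by apply: le_lt_trans (cmodD _ _) _; rewrite /d in hd; lra.
have := circ_cont_ker 2 r0 zhr; have := circ_cont_ker 2 r0 zr; have := circ_cont_ker 3 r0 zr => c2 c3 c4.
rewrite -cmeanB; [|exact: circ_contM|exact: circ_contM].
rewrite mulrAC -cmeanZ; last exact: circ_contM.
rewrite -cmeanB; last 2 first.
- by apply: circ_contB; apply: circ_contM.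
- by apply: circ_contM; [exact: circ_cont_cst|exact: circ_contM].
have c5 : circ_cont r (fun w => (3 * (w - z) - 2 * h) * ((w - z) ^- 3 * (w - (z + h)) ^- 2)).
  apply: circ_contM; last exact: circ_contM.
  apply: circ_contB; last exact: circ_cont_cst.
  apply: circ_contM; first exact: circ_cont_cst.
  by apply: circ_contB; [exact: circ_cont_id|exact: circ_cont_cst].
rewrite (eq_cmean r0 (u := fun w => h ^+ 2 * (u w * ((3 * (w - z) - 2 * h) * ((w - z) ^- 3 * (w - (z + h)) ^- 2))))); last first.
  move=> w wr; have [a1 [a2 _]] := hsh w wr.
  by rewrite opprD addrA; field; rewrite a1 a2.
rewrite cmeanZ; last by apply: circ_contM.
rewrite cmodM cmodX mulrC ler_wpM2r ?exprn_ge0 ?cmod_ge0//.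
apply: cmean_le_mul uM _ => //.
move=> w wr; have [_ [_ [_ a4]]] := hsh w wr.
have cn n : cmod (n%:R : R[i]) = n%:R.
  by rewrite -(rmorph_nat (real_complex R)) cmodR ger0_norm.
rewrite cmodM; apply: ler_pM; rewrite ?cmod_ge0//.
  apply: le_trans (cmodB _ _) _; rewrite !cmodM !cn.
  have := cmodB w z; rewrite wr => h1; have hz := cmod_ge0 z.
  by rewrite /d in hd; lra.
rewrite cmodM ler_pM ?cmod_ge0//; first exact: cmod_ker zr wr.
rewrite -exprVn cmodX; apply: lerXn2r; rewrite ?nnegrE ?cmod_ge0 ?invr_ge0 ?divr_ge0 ?(ltW d0)//.
by rewrite opprD addrA.
Qed.

(** Cauchy's formula writes [f] near [z] as a mean of [u w / (w - z)], so [df] is the mean of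
    [u w / (w - z) ^+ 2], which can be differentiated once more. *)
Theorem holo_deriv rho f df : (forall w, cmod w < rho -> cdiff f w (df w)) -> holo rho df.
Proof.
move=> fd z zrho; pose r := (cmod z + rho) / 2.
have [r0 zr rr] : [/\ 0 < r, cmod z < r & r < rho].
  by have := cmod_ge0 z; rewrite /r; split; lra.
pose u w := f w * w.
have cu : circ_cont r u by apply: circ_contM (circ_cont_id r); apply: holo_circ fd _ _ _.
exists (2 * cmean r (fun w => u w * (w - z) ^- 3)).
have near_z h : cmod h < r - cmod z -> cmod (z + h) < r.
  by move=> hd; apply: le_lt_trans (cmodD _ _) _; lra.
have fE w : cmod w < r -> f w = cmean r (fun x => u x * (x - w)^-1).
  by move=> wr; rewrite (cauchy_mean fd r0 rr wr); apply: eq_cmean => // x _; rewrite /u mulrA.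
apply: (cdiff_near (d := r - cmod z)) (cdiff_cmean2 r0 cu zr); first by rewrite subr_gt0.
move=> h /near_z zhr; have zhrho := lt_trans zhr rr.
apply: cdiff_unique (fd _ zhrho).
apply: (cdiff_near (d := r - cmod (z + h))) (cdiff_cmean1 r0 cu zhr); first by rewrite subr_gt0.
move=> k kd; rewrite fE//; apply: le_lt_trans (cmodD _ _) _; lra.
Qed.

End holomorphic.

(** * Area integrals over discs *)

Section plane_measure.
Variable R : realType.
Local Open Scope ereal_scope.
Local Notation leb := (@lebesgue_measure R).
Local Notation T := (measurableTypeR R).

Lemma measurable_shift (t : R) : measurable_fun setT (fun x : T => (x + t)%R : T).
Proof. by apply: measurable_funD => //; exact: measurable_cst. Qed.

Lemma measurable_scaler (r : R) : measurable_fun setT (fun x : T => (r * x)%R : T).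
Proof. by apply: measurable_funM => //; exact: measurable_cst. Qed.

Lemma lebesgue_shift (t : R) (A : set T) : measurable A ->
  leb ((fun x : T => (x + t)%R) @^-1` A) = leb A.
Proof.
move=> mA; pose f : {mfun T >-> T} := HB.pack (fun x : T => (x + t)%R : T)
  (isMeasurableFun.Build _ _ _ _ _ (measurable_shift t)).
rewrite -[LHS]/(pushforward leb f A); apply/esym.
apply: lebesgue_measure_unique => //= _ [[a b]] _ <-.
rewrite /pushforward.
have -> : f @^-1` `]a, b] = `](a - t)%R, (b - t)%R]%classic.
  by apply/seteqP; split => x /=; rewrite !in_itv /= ltrBlDr lerBrDr.
rewrite !lebesgue_measure_itv/= !lte_fin ltrD2r.
by case: ifP => // _; rewrite -!EFinB; congr EFin; ring.
Qed.

Lemma lebesgue_scale (r : R) (A : set T) : (0 < r)%R -> measurable A ->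
  leb ((fun x : T => (r * x)%R) @^-1` A) = (r^-1)%:E * leb A.
Proof.
move=> r0 mA; pose f : {mfun T >-> T} := HB.pack (fun x : T => (r * x)%R : T)
  (isMeasurableFun.Build _ _ _ _ _ (measurable_scaler r)).
pose m := mscale (NngNum (ltW r0)) (pushforward leb f).
have : leb A = m (measurable_scaler r) A.
  apply: lebesgue_measure_unique => //= _ [[a b]] _ <-.
  rewrite /m /mscale /= /pushforward.
  have -> : (fun x : T => (r * x)%R) @^-1` `]a, b] = `](a / r)%R, (b / r)%R]%classic.
    by apply/seteqP; split => x /=; rewrite !in_itv /= ltr_pdivrMr// ler_pdivlMr// [(x * r)%R]mulrC.
  rewrite !lebesgue_measure_itv/= !lte_fin ltr_pM2r ?invr_gt0//.
  case: ifP => // _; last by rewrite mule0.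
  by rewrite -!EFinB -EFinM; congr EFin; field; rewrite gt_eqF.
move=> ->; rewrite /m /mscale /= muleA -EFinM mulVf ?gt_eqF// mul1e.
by [].
Qed.

Lemma plane_unique (m : {measure set (plane R) -> \bar R}) :
  (forall A B : set T, measurable A -> measurable B -> m (A `*` B) = leb A * leb B) ->
  forall X, measurable X -> dV R X = m X.
Proof. exact: product_measure_unique. Qed.

Lemma dV2E (X : set (plane R)) : measurable X -> dV R X = (leb \x^ leb) X.
Proof.
by apply: product_measure_unique => A B mA mB; rewrite /= product_measure2E.
Qed.

Definition shear1 (t : R) (p : plane R) : plane R := ((p.1 + t * p.2)%R, p.2).
Definition shear2 (t : R) (p : plane R) : plane R := (p.1, (p.2 + t * p.1)%R).
Definition dil (r : R) (p : plane R) : plane R := ((r * p.1)%R, (r * p.2)%R).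

Lemma measurable_shear1 t : measurable_fun setT (shear1 t).
Proof.
apply: measurable_fun_pair; last exact: measurable_snd.
apply: measurable_funD; first exact: measurable_fst.
by apply: measurable_funM; [exact: measurable_cst|exact: measurable_snd].
Qed.

Lemma measurable_shear2 t : measurable_fun setT (shear2 t).
Proof.
apply: measurable_fun_pair; first exact: measurable_fst.
apply: measurable_funD; first exact: measurable_snd.
by apply: measurable_funM; [exact: measurable_cst|exact: measurable_fst].
Qed.

Lemma measurable_dil r : measurable_fun setT (dil r).
Proof.
by apply: measurable_fun_pair; apply: measurable_funM; try exact: measurable_cst;
  [exact: measurable_fst|exact: measurable_snd].
Qed.

Lemma preimage_measurable (f : plane R -> plane R) X : measurable_fun setT f ->
  measurable X -> measurable (f @^-1` X).
Proof. by move=> mf mX; rewrite -[_ @^-1` _]setTI; exact: mf. Qed.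

(** Uniqueness of the product measure reduces the claim to rectangles. Their slices at a fixed
    second coordinate are merely translated, hence the passage to the product measure that
    integrates over that coordinate last. *)
Lemma dV_shear1 t X : measurable X -> dV R (shear1 t @^-1` X) = dV R X.
Proof.
move=> mX; pose f : {mfun plane R >-> plane R} := HB.pack (shear1 t)
  (isMeasurableFun.Build _ _ _ _ _ (measurable_shear1 t)).
rewrite -[LHS]/(pushforward (dV R) f X); apply/esym.
apply: plane_unique => // A B mA mB.
transitivity ((leb \x^ leb) (shear1 t @^-1` (A `*` B))).
  apply: dV2E; apply: preimage_measurable; [exact: measurable_shear1|exact: measurableX].
rewrite /product_measure2 /= -product_measure2E// /product_measure2.
apply: eq_integral => y _ /=; have [yB|yB] := boolP (y \in B).
  rewrite in_ysectionX// -[RHS](lebesgue_shift (t * y))//; congr (leb _).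
  apply/seteqP; split => x; rewrite /ysection /= inE /=.
    by case.
  by move=> xA; split => //; rewrite inE in yB.
rewrite notin_ysectionX// measure0; apply/eqP; rewrite (_ : ysection _ _ = set0) ?measure0//.
apply/seteqP; split => x //; rewrite /ysection /= inE /= => -[_].
by move: yB; rewrite notin_setE.
Qed.

Lemma dV_shear2 t X : measurable X -> dV R (shear2 t @^-1` X) = dV R X.
Proof.
move=> mX; pose f : {mfun plane R >-> plane R} := HB.pack (shear2 t)
  (isMeasurableFun.Build _ _ _ _ _ (measurable_shear2 t)).
rewrite -[LHS]/(pushforward (dV R) f X); apply/esym.
apply: plane_unique => // A B mA mB; rewrite /pushforward.
rewrite /dV /product_measure1 /= -product_measure1E// /product_measure1.
apply: eq_integral => x _ /=; have [xA|xA] := boolP (x \in A).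
  rewrite in_xsectionX// -[RHS](lebesgue_shift (t * x))//; congr (leb _).
  apply/seteqP; split => y; rewrite /xsection /= inE /=.
    by case.
  by move=> yB; split => //; rewrite inE in xA.
rewrite notin_xsectionX// measure0; apply/eqP; rewrite (_ : xsection _ _ = set0) ?measure0//.
apply/seteqP; split => y //; rewrite /xsection /= inE /= => -[+ _].
by move: xA; rewrite notin_setE.
Qed.

Lemma dV_dil r X : (0 < r)%R -> measurable X -> dV R X = (r ^+ 2)%:E * dV R (dil r @^-1` X).
Proof.
move=> r0 mX; pose f : {mfun plane R >-> plane R} := HB.pack (dil r)
  (isMeasurableFun.Build _ _ _ _ _ (measurable_dil r)).
have r2 : (0 <= r ^+ 2)%R by rewrite sqr_ge0.
pose m := mscale (NngNum r2) (pushforward (dV R) f).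
apply: (plane_unique (m := m (measurable_dil r))) => // A B mA mB.
rewrite -[LHS]/((r ^+ 2)%:E * (leb \x leb) (dil r @^-1` (A `*` B))).
have -> : dil r @^-1` (A `*` B) = ((fun x : T => (r * x)%R) @^-1` A) `*` ((fun x : T => (r * x)%R) @^-1` B).
  by [].
have ms C : measurable C -> measurable ((fun x : T => (r * x)%R) @^-1` C).
  by move=> mC; rewrite -[_ @^-1` _]setTI; exact: measurable_scaler.
rewrite product_measure1E; [|exact: ms|exact: ms].
transitivity ((r ^+ 2)%:E * (((r^-1)%:E * leb A) * ((r^-1)%:E * leb B))).
  by congr (_ * (_ * _)); exact: lebesgue_scale.
have e1 : (r ^+ 2 * (r^-1 * r^-1) = 1)%R by field; rewrite gt_eqF.
by rewrite muleACA -EFinM [LHS]muleA -EFinM e1 mul1e.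
Qed.

Definition prot (x : R) (p : plane R) : plane R :=
  ((cos x * p.1 - sin x * p.2)%R, (sin x * p.1 + cos x * p.2)%R).

(* A rotation is a product of three shears. *)
Lemma prot_shear x : sin x != 0%R ->
  prot x = shear1 ((cos x - 1) / sin x) \o shear2 (sin x) \o shear1 ((cos x - 1) / sin x).
Proof.
move=> s0; apply/funext => -[a b]; rewrite /prot /shear1 /shear2 /=.
have c2 := cos2Dsin2 x.
have cE : (cos x ^+ 2 = 1 - sin x ^+ 2)%R by rewrite -c2 addrK.
congr (_, _).
  rewrite [RHS](_ : _ = (a * cos x + b * ((cos x ^+ 2 - 1) / sin x)))%R; last by field.
  by rewrite cE; field.
by field.
Qed.

Lemma measurable_prot x : measurable_fun setT (prot x).
Proof.
by apply: measurable_fun_pair; [apply: measurable_funB|apply: measurable_funD];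
  apply: measurable_funM; try exact: measurable_cst; (exact: measurable_fst || exact: measurable_snd).
Qed.

Lemma dV_prot x X : sin x != 0%R -> measurable X -> dV R (prot x @^-1` X) = dV R X.
Proof.
move=> s0 mX; rewrite (prot_shear s0) !comp_preimage.
have m1 := preimage_measurable (measurable_shear1 ((cos x - 1) / sin x)) mX.
have m2 := preimage_measurable (measurable_shear2 (sin x)) m1.
by rewrite dV_shear1// dV_shear2// dV_shear1.
Qed.

End plane_measure.

(** * Measurability and absolute continuity for complex integrands *)

Section complex_measurable.
Context {R : realType} {disp : measure_display} {T : measurableType disp}.
Implicit Types (D : set T) (f g h : T -> R[i]).

Definition cmeas D h := measurable_fun D (fun x => complex.Re (h x)) /\
  measurable_fun D (fun x => complex.Im (h x)).

Lemma eq_cmeas D f g : f =1 g -> cmeas D f -> cmeas D g.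
Proof. by move=> /funext ->. Qed.

Lemma cmeas_cst D (c : R[i]) : cmeas D (fun=> c).
Proof. by split; exact: measurable_cst. Qed.

Lemma cmeasD D f g : cmeas D f -> cmeas D g -> cmeas D (fun x => f x + g x).
Proof.
move=> [f1 f2] [g1 g2]; split.
  by apply: eq_measurable_fun (measurable_funD f1 g1) => x _ /=; case: (f x) (g x) => a b [c d].
by apply: eq_measurable_fun (measurable_funD f2 g2) => x _ /=; case: (f x) (g x) => a b [c d].
Qed.

Lemma cmeasM D f g : cmeas D f -> cmeas D g -> cmeas D (fun x => f x * g x).
Proof.
move=> [f1 f2] [g1 g2]; split.
  apply: eq_measurable_fun (measurable_funB (measurable_funM f1 g1) (measurable_funM f2 g2)) => x _ /=.
  by case: (f x) (g x) => a b [c d].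
apply: eq_measurable_fun (measurable_funD (measurable_funM f1 g2) (measurable_funM f2 g1)) => x _ /=.
by case: (f x) (g x) => a b [c d].
Qed.

Lemma cmeasB D f g : cmeas D f -> cmeas D g -> cmeas D (fun x => f x - g x).
Proof.
move=> mf mg; apply: eq_cmeas (cmeasD mf (cmeasM (cmeas_cst D (-1)) mg)) => x.
by rewrite mulN1r.
Qed.

Lemma cmeasX D n f : cmeas D f -> cmeas D (fun x => f x ^+ n).
Proof.
move=> mf; elim: n => [|n IH].
  by apply: eq_cmeas (cmeas_cst D 1) => x; rewrite expr0.
by apply: eq_cmeas (cmeasM mf IH) => x; rewrite exprS.
Qed.

Lemma cmeasJ D f : cmeas D f -> cmeas D (fun x => (f x)^*).
Proof.
move=> [f1 f2]; split.
  by apply: eq_measurable_fun f1 => x _ /=; case: (f x).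
by apply: eq_measurable_fun (measurable_funN f2) => x _ /=; case: (f x).
Qed.

Lemma cmeas_sum D (I : Type) (r : seq I) (F : I -> T -> R[i]) :
  (forall i, cmeas D (F i)) -> cmeas D (fun x => \sum_(i <- r) F i x).
Proof.
move=> mF; elim: r => [|i r IH].
  by apply: eq_cmeas (cmeas_cst D 0) => x; rewrite big_nil.
by apply: eq_cmeas (cmeasD (mF i) IH) => x; rewrite big_cons.
Qed.

Lemma cmeas_lim D (F : nat -> T -> R[i]) h : (forall n, cmeas D (F n)) ->
  (forall x, D x -> forall e : R, 0 < e -> exists N, forall n, (N <= n)%N -> cmod (F n x - h x) <= e) ->
  cmeas D h.
Proof.
move=> mF Fh; split.
  apply: (measurable_fun_cvg (h := fun n x => complex.Re (F n x))) => [n|x Dx].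
    by case: (mF n).
  apply/(@cvgrPdist_le R R) => e e0; have [N HN] := Fh x Dx e e0.
  exists N => // n /= Nn; apply: le_trans (HN n Nn); rewrite cmodC (le_trans _ (Re_cmod _))//.
  by case: (h x) (F n x) => a b [c d].
apply: (measurable_fun_cvg (h := fun n x => complex.Im (F n x))) => [n|x Dx].
  by case: (mF n).
apply/(@cvgrPdist_le R R) => e e0; have [N HN] := Fh x Dx e e0.
exists N => // n /= Nn; apply: le_trans (HN n Nn); rewrite cmodC (le_trans _ (Im_cmod _))//.
by case: (h x) (F n x) => a b [c d].
Qed.

Lemma cmeasS D E f : measurable E -> D `<=` E -> cmeas E f -> cmeas D f.
Proof. by move=> mE DE [f1 f2]; split; [exact: measurable_funS f1|exact: measurable_funS f2]. Qed.

Variable mu : {measure set T -> \bar R}.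

Lemma cintegrable_dom D h (g : T -> R) : measurable D -> cmeas D h ->
  mu.-integrable D (EFin \o g) -> (forall x, D x -> cmod (h x) <= g x) -> cintegrable mu D h.
Proof.
move=> mD [h1 h2] ig hg; split.
  apply: le_integrable ig => //; first exact/measurable_EFinP.
  move=> x Dx; rewrite /= lee_fin (le_trans (Re_cmod _))// (le_trans (hg x Dx))//.
  exact: ler_norm.
apply: le_integrable ig => //; first exact/measurable_EFinP.
move=> x Dx; rewrite /= lee_fin (le_trans (Im_cmod _))// (le_trans (hg x Dx))//.
exact: ler_norm.
Qed.

Lemma integrable_cst D (M : R) : measurable D -> (mu D < +oo)%E -> mu.-integrable D (EFin \o (fun=> M)).
Proof.
move=> mD fD; apply: measurable_bounded_integrable => //.
by exists `|M|; split; [exact: num_real|move=> y My x _ /=; exact: ltW].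
Qed.

Lemma cintegrable_bounded D h (M : R) : measurable D -> (mu D < +oo)%E -> cmeas D h ->
  (forall x, D x -> cmod (h x) <= M) -> cintegrable mu D h.
Proof.
move=> mD fD mh hM; apply: (cintegrable_dom (g := fun=> M)) => //.
exact: integrable_cst.
Qed.

Lemma cintegrable_meas D h : cintegrable mu D h -> cmeas D h.
Proof. by move=> [/measurable_int/measurable_EFinP h1 /measurable_int/measurable_EFinP h2]. Qed.

Lemma cintegrable_cmod D h : measurable D -> cintegrable mu D h ->
  mu.-integrable D (EFin \o (fun x => cmod (h x))).
Proof.
move=> mD [h1 h2]; have [m1 m2] := cintegrable_meas (conj h1 h2).
have ig := integrableD mD (integrable_norm h1) (integrable_norm h2).
apply: le_integrable ig => //.
  apply/measurable_EFinP.
  have : measurable_fun D (fun x => Num.sqrt (complex.Re (h x) ^+ 2 + complex.Im (h x) ^+ 2)).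
    have ms : measurable_fun setT (@Num.sqrt R).
      by apply: continuous_measurable_fun; exact: sqrt_continuous.
    apply: (measurableT_comp ms).
    by apply: measurable_funD; apply: measurable_funX.
  by apply: eq_measurable_fun => x _; rewrite /cmod normc_def.
move=> x Dx /=; rewrite lee_fin ger0_norm ?cmod_ge0// ger0_norm ?addr_ge0//.
exact: cmod_le_ReIm.
Qed.

Lemma cint_le_Rint D h : measurable D -> cintegrable mu D h ->
  cmod (cint mu D h) <= \int[mu]_(x in D) cmod (h x).
Proof. by move=> mD ih; apply: cint_bound => //; exact: cintegrable_cmod. Qed.

Lemma cint_setU D E h : measurable D -> measurable E -> [disjoint D & E] ->
  cintegrable mu (D `|` E) h -> cint mu (D `|` E) h = cint mu D h + cint mu E h.
Proof.
move=> mD mE DE [h1 h2]; rewrite /cint.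
have -> : forall a b c d : R, (a +i* b) + (c +i* d) = (a + c) +i* (b + d) by [].
by rewrite -!Rintegral_setU.
Qed.

Lemma cint_small D h (e : R) : measurable D -> cintegrable mu D h -> 0 < e ->
  exists2 d : R, 0 < d & forall A, measurable A -> A `<=` D -> (mu A < d%:E)%E ->
    cmod (cint mu A h) <= e.
Proof.
move=> mD ih e0.
pose g := (fun x => cmod (h x)) \_ D.
have ig : mu.-integrable setT (EFin \o g).
  rewrite /g -restrict_EFin.
  exact: ((integrable_mkcond _ mD).1 (cintegrable_cmod mD ih)).
have [d [d0 H]] := integral_normr_continuous ig e0.
exists d => // A mA AD Ad; have iA := cintegrable_setU mA mD AD ih.
apply: le_trans (cint_le_Rint mA iA) _; apply: le_trans (ltW (H A mA Ad)).
rewrite le_eqVlt; apply/orP; left; apply/eqP; apply: eq_Rintegral => x; rewrite inE => Ax.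
by rewrite /g patchE mem_set ?ger0_norm ?cmod_ge0//; exact: AD.
Qed.

End complex_measurable.

Section change_of_variables.
Variable R : realType.

Lemma cint_preserving (phi : plane R -> plane R) D (h : plane R -> R[i]) :
  measurable_fun setT phi -> (forall X, measurable X -> dV R (phi @^-1` X) = dV R X) ->
  measurable D -> cmeas setT h -> cintegrable (dV R) (phi @^-1` D) (h \o phi) ->
  cint (dV R) D h = cint (dV R) (phi @^-1` D) (h \o phi).
Proof.
move=> mphi pphi mD [m1 m2] [i1 i2].
have H (g : plane R -> R) : measurable_fun setT g ->
    (dV R).-integrable (phi @^-1` D) (EFin \o (g \o phi)) ->
    (\int[dV R]_(x in D) g x = \int[dV R]_(x in phi @^-1` D) (g \o phi) x)%R.
  move=> mg ig; rewrite /Rintegral; congr fine.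
  transitivity (\int[pushforward (dV R) phi]_(y in D) (EFin \o g) y)%E.
    by apply: eq_measure_integral => A mA _; rewrite -pphi.
  by apply: integral_pushforward => //; exact/measurable_EFinP.
by rewrite /cint; congr (_ +i* _); rewrite H.
Qed.

End change_of_variables.

Section conjugation.
Variable R : realType.
Implicit Types z w : R[i].
Lemma cconjM z w : (z * w)^* = z^* * w^*. Proof. exact: rmorphM. Qed.
Lemma cconjD z w : (z + w)^* = z^* + w^*. Proof. exact: rmorphD. Qed.
Lemma cconjB z w : (z - w)^* = z^* - w^*. Proof. exact: rmorphB. Qed.
Lemma cconjX z n : (z ^+ n)^* = z^* ^+ n. Proof. exact: rmorphXn. Qed.
Lemma cconjV z : (z^-1)^* = z^*^-1. Proof. exact: fmorphV. Qed.
Lemma cconj0 : 0^* = 0 :> R[i]. Proof. exact: rmorph0. Qed.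
Lemma cconj1 : 1^* = 1 :> R[i]. Proof. exact: rmorph1. Qed.
Lemma cconjR (r : R) : r%:C^* = r%:C. Proof. exact: conjc_real. Qed.
End conjugation.

(** * Integrals of weighted monomials over the disc *)

Section disc_integrals.
Variable R : realType.
Local Notation P := (plane R).
Implicit Types (r s : R) (p : P) (n k m : nat).

Definition cball r : set P := [set p | cmod (toC p) < r].

Lemma disc2E : @disc2 R = cball 1.
Proof. by apply/seteqP; split => p /=; rewrite /disc2 /cball /=; move/discE. Qed.

Lemma cmeas_toC : cmeas setT (@toC R).
Proof. by split; [exact: measurable_fst|exact: measurable_snd]. Qed.

Lemma measurable_cmod_sqr : measurable_fun setT (fun p : P => cmod (toC p) ^+ 2).
Proof.
have [m1 m2] := cmeas_toC.
apply: eq_measurable_fun (measurable_funD (measurable_funX 2 m1) (measurable_funX 2 m2)).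
by move=> p _; rewrite cmod_sqr.
Qed.

Lemma measurable_cball r : measurable (cball r).
Proof.
have [r0|r0] := leP r 0.
  rewrite (_ : cball r = set0)//; apply/seteqP; split => p //=; rewrite /cball /=.
  by move=> /(le_lt_trans (cmod_ge0 _)) /lt_le_trans /(_ r0); rewrite ltxx.
rewrite (_ : cball r = setT `&` (fun p => cmod (toC p) ^+ 2) @^-1` `]-oo, (r ^+ 2)[).
  by apply: measurable_cmod_sqr => //; exact: measurable_itv.
apply/seteqP; split => p; rewrite /cball /= in_itv /= ltr_pXn2r ?nnegrE ?cmod_ge0 ?(ltW r0)//.
by case.
Qed.

Lemma dV_box (a b c d : R) : dV R (`[a, b]%classic `*` `[c, d]%classic) =
  (lebesgue_measure `[a, b] * lebesgue_measure `[c, d])%E.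
Proof. exact: product_measure1E. Qed.

Lemma dV_cball_fin r : (dV R (cball r) < +oo)%E.
Proof.
have sub : cball r `<=` `[- r, r]%classic `*` `[- r, r]%classic.
  move=> p; rewrite /cball /= => pr; rewrite !in_itv /= -!ler_norml.
  by split; [exact: le_trans (Re_cmod (toC p)) (ltW pr)|exact: le_trans (Im_cmod (toC p)) (ltW pr)].
apply: (@le_lt_trans _ _ (dV R (`[- r, r]%classic `*` `[- r, r]%classic))).
  by apply: le_measure => //; rewrite inE; [exact: measurable_cball|exact: measurableX].
by rewrite dV_box !lebesgue_measure_itv /= lte_fin; case: ifP => _; rewrite -?EFinB -?EFinM ?mule0 ltry.
Qed.

(** Kept abstract: it enters the kernels as a multiplicative constant, which disappears from the
    metric. *)
Definition area : R := fine (dV R (cball 1)).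

Lemma dV_cball1 : dV R (cball 1) = area%:E.
Proof. by rewrite /area fineK// ge0_fin_numE// dV_cball_fin. Qed.

Lemma area_gt0 : 0 < area.
Proof.
rewrite -lte_fin -dV_cball1.
apply: (@lt_le_trans _ _ (dV R (`[0, 2^-1]%classic `*` `[0, 2^-1]%classic))).
  rewrite dV_box !lebesgue_measure_itv /= lte_fin invr_gt0 ltr0n /= -!EFinB -EFinM lte_fin.
  by rewrite subr0 mulr_gt0.
apply: le_measure => //; rewrite ?inE; [exact: measurableX|exact: measurable_cball|].
move=> p /=; rewrite !in_itv /= => -[/andP[p1 p2] /andP[p3 p4]]; rewrite /cball /=.
rewrite -(@ltr_pXn2r _ 2) ?nnegrE ?cmod_ge0// cmod_sqr expr1n /=.
have h1 : p.1 ^+ 2 <= 2^-1 ^+ 2 by apply: lerXn2r; rewrite ?nnegrE.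
have h2 : p.2 ^+ 2 <= 2^-1 ^+ 2 by apply: lerXn2r; rewrite ?nnegrE.
apply: le_lt_trans (lerD h1 h2) _; lra.
Qed.

Lemma toC_prot (x : R) p : toC (prot x p) = expi x * toC p.
Proof. by rewrite /toC /prot /expi /=; apply/eqP; rewrite eq_complex /= eqxx /= [X in X == _]addrC. Qed.

Lemma toC_dil r p : toC (dil r p) = r%:C * toC p.
Proof. by rewrite /toC /dil; apply/eqP; rewrite eq_complex /= !mul0r subr0 addr0 !eqxx. Qed.

Lemma prot_cball x r : prot x @^-1` cball r = cball r.
Proof. by apply/seteqP; split => p; rewrite /cball /= toC_prot cmodM cmod_expi mul1r. Qed.

Lemma dil_cball r : 0 < r -> dil r @^-1` cball r = cball 1.
Proof.
by move=> r0; apply/seteqP; split => p; rewrite /cball /= toC_dil cmodM cmodR gtr0_norm// gtr_pMr.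
Qed.

Definition mono n k m p : R[i] :=
  toC p ^+ n * (toC p)^* ^+ k * (1 - toC p * (toC p)^*) ^+ m.

Lemma cmeas_mono n k m : cmeas setT (mono n k m).
Proof.
apply: cmeasM; first apply: cmeasM.
- by apply: cmeasX; exact: cmeas_toC.
- by apply: cmeasX; apply: cmeasJ; exact: cmeas_toC.
apply: cmeasX; apply: cmeasB; first exact: cmeas_cst.
by apply: cmeasM; [exact: cmeas_toC|apply: cmeasJ; exact: cmeas_toC].
Qed.

Lemma cmod_weight m p : cball 1 p -> cmod ((1 - toC p * (toC p)^*) ^+ m) <= 1.
Proof.
rewrite /cball /= => p1; rewrite cmodX exprn_ile1 ?cmod_ge0//.
rewrite mulcJ -[1]/(1%:C) -rmorphB cmodR ger0_norm ?lerBlDr ?lerDl ?sqr_ge0//.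
by rewrite subr_ge0 exprn_ile1 ?cmod_ge0// ltW.
Qed.

Lemma mono_le1 n k m p : cball 1 p -> cmod (mono n k m p) <= 1.
Proof.
move=> p1; rewrite cmodM mulr_ile1 ?cmod_ge0 ?cmod_weight//.
by rewrite cmodM !cmodX cmodJ mulr_ile1 ?exprn_ge0 ?exprn_ile1 ?cmod_ge0//; exact: ltW.
Qed.

Lemma cmod_sqX_le1 (z : R[i]) k : cmod z < 1 -> (cmod z ^+ 2) ^+ k <= 1.
Proof. by move=> z1; rewrite -exprM exprn_ile1 ?cmod_ge0 ?ltW. Qed.

Lemma cball_sub r s : r <= s -> cball r `<=` cball s.
Proof. by move=> rs p; rewrite /cball /= => /lt_le_trans; exact. Qed.

Lemma cintegrable_mono r n k m : r <= 1 -> cintegrable (dV R) (cball r) (mono n k m).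
Proof.
move=> r1; apply: (cintegrable_bounded (M := 1)).
- exact: measurable_cball.
- exact: dV_cball_fin.
- by apply: cmeasS (cmeas_mono n k m).
- by move=> p /(cball_sub r1); exact: mono_le1.
Qed.

(** A rotation by [x] preserves the disc and its measure but multiplies the integrand by
    [expi x ^+ n * (expi x)^* ^+ k]; an angle for which this factor is not 1 forces the integral to
    vanish. The angle must also have [sin x != 0], for the factorization of rotations into
    shears. *)
Lemma mono_orthogonal r n k m : r <= 1 -> n != k ->
  cint (dV R) (cball r) (mono n k m) = 0.
Proof.
move=> r1 nk.
have [x [sx wx]] : exists x : R, sin x != 0 /\ expi x ^+ n * (expi x)^* ^+ k != 1.
  wlog ltnk : n k nk / (n < k)%N.
    move=> H; have [nk'|kn|E] := ltngtP n k; [exact: H|..|by rewrite E eqxx in nk].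
    have [||x [sx wx]] := H k n => //; first by rewrite eq_sym.
    exists x; split => //; apply: contra wx; rewrite expiJ expiN => /eqP E; apply/eqP.
    by rewrite -[LHS]invrK invfM -!exprVn invrK mulrC E invr1.
  (* The factor becomes the inverse of [expi (pi / 2)], and [x] lies strictly between 0 and [pi]. *)
  pose x : R := pi / 2 / (k - n)%:R.
  have d0 : 0 < (k - n)%:R :> R by rewrite ltr0n subn_gt0.
  have x0 : 0 < x by rewrite !divr_gt0// pi_gt0.
  have xp : x < pi.
    apply: le_lt_trans (_ : pi / 2 < _).
      by rewrite ler_pdivrMr// ler_peMr ?divr_ge0 ?pi_ge0// ler1n subn_gt0.
    by rewrite ltr_pdivrMr// ltr_pMr ?pi_gt0// ltr1n.
  exists x; split; first by rewrite gt_eqF// sin_gt0_pi// x0.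
  rewrite -(subnK (ltnW ltnk)) exprD mulrCA -exprMn (mulcJ (expi x)) cmod_expi expr1n rmorph1 expr1n mulr1.
  rewrite expiJ expiN exprVn -expiMn /x mulrC divfK; last by rewrite gt_eqF.
  by rewrite /expi cos_pihalf sin_pihalf invr_eq1 eq_complex /= eq_sym oner_eq0.
set I := cint _ _ _.
suff : I = (expi x ^+ n * (expi x)^* ^+ k) * I.
  move=> /eqP; rewrite -subr_eq0 -{1}[I]mul1r -mulrBl mulf_eq0 => /orP[|/eqP//].
  by rewrite subr_eq0 eq_sym (negPf wx).
have mprot : mono n k m \o prot x = fun p => (expi x ^+ n * (expi x)^* ^+ k) * mono n k m p.
  apply/funext => p; rewrite /mono /comp toC_prot cconjM !exprMn.
  rewrite [expi x * _ * (_ * _)]mulrACA (mulcJ (expi x)) cmod_expi expr1n rmorph1 mul1r.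
  by ring.
rewrite {1}/I (cint_preserving (measurable_prot x)).
- rewrite prot_cball mprot cintZ//; first exact: measurable_cball.
  exact: cintegrable_mono.
- by move=> X mX; exact: dV_prot.
- exact: measurable_cball.
- exact: cmeas_mono.
- rewrite prot_cball mprot; apply: cintegrableZ; first exact: measurable_cball.
  exact: cintegrable_mono.
Qed.

Definition radial k r : R := (\int[dV R]_(p in cball r) (cmod (toC p) ^+ 2) ^+ k)%R.

Lemma measurable_radial k D : measurable_fun D (fun p : P => (cmod (toC p) ^+ 2) ^+ k).
Proof. by apply: measurable_funX; apply: measurable_funS measurable_cmod_sqr. Qed.

Lemma integrable_radial k D : measurable D -> D `<=` cball 1 ->
  (dV R).-integrable D (EFin \o (fun p => (cmod (toC p) ^+ 2) ^+ k)).
Proof.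
move=> mD D1.
have fD : (dV R D < +oo)%E.
  by apply: le_lt_trans (dV_cball_fin 1); apply: le_measure; rewrite ?inE//; exact: measurable_cball.
apply: le_integrable (integrable_cst 1 mD fD) => //.
  by apply/measurable_EFinP; exact: measurable_radial.
move=> p /D1; rewrite /cball /= => p1; rewrite !lee_fin normr1 ger0_norm ?exprn_ge0 ?cmod_ge0//.
exact: cmod_sqX_le1.
Qed.

Lemma ge0_integral_dil r D (f : P -> R) : 0 < r -> measurable D ->
  measurable_fun setT f -> (forall p, 0 <= f p) ->
  (\int[dV R]_(p in D) (f p)%:E = (r ^+ 2)%:E * \int[dV R]_(p in dil r @^-1` D) (f (dil r p))%:E)%E.
Proof.
move=> r0 mD mf f0.
have r2 : 0 <= r ^+ 2 by rewrite sqr_ge0.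
pose pf := measure_function_pushforward__canonical__measure_function_Measure (dV R) (measurable_dil r).
have mfD : measurable_fun D (EFin \o f).
  by apply/measurable_EFinP; exact: measurable_funS mf.
have f0' p : D p -> (0 <= (EFin \o f) p)%E by move=> _; rewrite lee_fin.
have e1 : (\int[dV R]_(p in D) (EFin \o f) p = \int[mscale (NngNum r2) pf]_(p in D) (EFin \o f) p)%E.
  by apply: eq_measure_integral => A mA _; exact: dV_dil.
have e2 := @ge0_integral_mscale _ _ R pf D mD (NngNum r2) (EFin \o f) mfD f0'.
have f0'' : {in D, forall p, (0 <= (EFin \o f) p)%E} by move=> p _; rewrite lee_fin.
have e3 := ge0_integral_pushforward (measurable_dil r) (dV R) mD mfD f0''.
by apply: (etrans e1); apply: (etrans e2); exact: congr1 e3.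
Qed.

Lemma radial_dil k r : 0 < r -> r <= 1 -> radial k r = (r ^+ 2) ^+ k.+1 * radial k 1.
Proof.
move=> r0 r1; rewrite /radial.
have ge0 p : 0 <= (cmod (toC p) ^+ 2) ^+ k by rewrite exprn_ge0// sqr_ge0.
have i1 := integrable_radial k (measurable_cball 1) (@subset_refl _ _).
have E : (\int[dV R]_(p in cball r) ((cmod (toC p) ^+ 2) ^+ k)%:E =
   (r ^+ 2)%:E * \int[dV R]_(p in cball 1) ((r ^+ 2) ^+ k * (cmod (toC p) ^+ 2) ^+ k)%:E)%E.
  rewrite (ge0_integral_dil r0 (measurable_cball r) (@measurable_radial k setT) ge0) dil_cball//.
  congr (_ * _)%E; apply: eq_integral => p _.
  congr EFin; rewrite -exprMn; congr (_ ^+ _); rewrite -exprMn; congr (_ ^+ _).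
  by rewrite toC_dil cmodM cmodR gtr0_norm.
rewrite {1}/Rintegral E fineM//; last first.
  by apply: integrable_fin_num; [exact: measurable_cball|exact: (integrable_mulr _ (measurable_cball 1) i1)].
rewrite -[fine (integral _ _ _)]/(Rintegral _ _ _) RintegralZl//; last exact: measurable_cball.
rewrite -[fine _]/(r ^+ 2) /radial [(r ^+ 2) ^+ k.+1]exprS; exact: mulrA.
Qed.

(* Scaling gives [radial k r = r^(2k+2) radial k 1]; on the annulus between [r] and
   [1] the integrand lies between [r^(2k)] and [1]. *)
Lemma radial_squeeze k q : 0 < q -> q < 1 ->
  q ^+ k * area <= k.+1%:R * radial k 1 /\ q ^+ k * (k.+1%:R * radial k 1) <= area.
Proof.
move=> q0 q1; pose r := Num.sqrt q.
have rq : r ^+ 2 = q by rewrite sqr_sqrtr// ltW.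
have r0 : 0 < r by rewrite sqrtr_gt0.
have r1 : r < 1 by rewrite -[1]sqrtr1 ltr_sqrt.
set M := radial k 1.
have m1 := measurable_cball 1; have mr := measurable_cball r.
have mD : measurable (cball 1 `\` cball r) by exact: measurableD.
have split_ j : radial j 1 = radial j r + (\int[dV R]_(p in cball 1 `\` cball r) (cmod (toC p) ^+ 2) ^+ j)%R.
  have cU : cball 1 = cball r `|` (cball 1 `\` cball r).
    by rewrite setDUK//; exact: cball_sub (ltW r1).
  rewrite /radial {1}cU Rintegral_setU//.
    by rewrite -cU; exact: integrable_radial.
  by rewrite disj_set2E setDIK.
have r01 : radial 0 1 = area.
  rewrite /radial /area; under eq_Rintegral do rewrite expr0.
  by rewrite Rintegral_cst// mul1r.
have a1 : area = q * area + (\int[dV R]_(p in cball 1 `\` cball r) 1)%R.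
  by rewrite -{1}r01 split_ radial_dil ?(ltW r1)// rq expr1 r01.
have a2 : M = q ^+ k.+1 * M + (\int[dV R]_(p in cball 1 `\` cball r) (cmod (toC p) ^+ 2) ^+ k)%R.
  by rewrite {1}/M split_ radial_dil ?(ltW r1)// rq.
have iD j : (dV R).-integrable (cball 1 `\` cball r) (EFin \o (fun p => (cmod (toC p) ^+ 2) ^+ j)).
  by apply: integrable_radial => //; exact: subDsetl.
have up : (\int[dV R]_(p in cball 1 `\` cball r) (cmod (toC p) ^+ 2) ^+ k <=
    \int[dV R]_(p in cball 1 `\` cball r) 1)%R.
  apply: le_Rintegral => //; first exact: (iD 0%N).
  by move=> p [p1 _]; exact: cmod_sqX_le1.
have lo : (q ^+ k * \int[dV R]_(p in cball 1 `\` cball r) 1 <=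
   \int[dV R]_(p in cball 1 `\` cball r) (cmod (toC p) ^+ 2) ^+ k)%R.
  rewrite -RintegralZl//; last exact: (iD 0%N).
  apply: le_Rintegral => //; first exact: (integrable_mulr _ mD (iD 0%N)).
  move=> p [_]; rewrite /cball /= => /negP; rewrite -leNgt => rp.
  rewrite mulr1 -rq; apply: lerXn2r; rewrite ?nnegrE ?sqr_ge0//.
  by apply: lerXn2r; rewrite ?nnegrE ?cmod_ge0// ltW.
set S := (\int[dV R]_(p in _) 1)%R in a1 up lo.
have SE : S = (1 - q) * area by rewrite mulrBl mul1r; apply/eqP; rewrite eq_sym subr_eq addrC -a1.
pose G := \sum_(j < k.+1) q ^+ j.
have GE : 1 - q ^+ k.+1 = (1 - q) * G by rewrite -opprB subrX1 -mulNr opprB.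
have E2 : (\int[dV R]_(p in cball 1 `\` cball r) (cmod (toC p) ^+ 2) ^+ k)%R = (1 - q) * (G * M).
  by rewrite mulrA -GE mulrBl mul1r; apply/eqP; rewrite eq_sym subr_eq addrC -a2.
have q10 : 0 < 1 - q by rewrite subr_gt0.
have {}up : G * M <= area by rewrite -(ler_pM2l q10) -E2 -SE.
have {}lo : q ^+ k * area <= G * M.
  by rewrite -(ler_pM2l q10) -E2 mulrCA -SE.
have M0 : 0 <= M by apply: Rintegral_ge0 => p _; rewrite exprn_ge0// sqr_ge0.
have G1 : G <= k.+1%:R.
  rewrite -[k.+1 in X in _ <= X]card_ord -sumr_const; apply: ler_sum => j _.
  by rewrite exprn_ile1// ltW.
have G2 : q ^+ k * k.+1%:R <= G.
  rewrite -[k.+1 in X in X <= _]card_ord mulr_natr -sumr_const; apply: ler_sum => j _.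
  by rewrite ler_wiXn2l// ?ltW// -ltnS.
split; first by rewrite (le_trans lo)// ler_wpM2r.
by rewrite mulrA (le_trans _ up)// ler_wpM2r.
Qed.

Lemma bernoulli k (d : R) : 0 <= d -> d <= 1 -> 1 - k%:R * d <= (1 - d) ^+ k.
Proof.
move=> d0 d1; elim: k => [|k IH]; first by rewrite mul0r subr0 expr0.
have h : 0 <= 1 - d by rewrite subr_ge0.
rewrite exprS; apply: le_trans (ler_wpM2l h IH).
rewrite -natr1 mulrDl mul1r -subr_ge0.
rewrite [X in 0 <= X](_ : _ = k%:R * d * d); last by ring.
by rewrite !mulr_ge0.
Qed.

Lemma pow_near1 k (x y : R) : 0 <= x -> (forall q, 0 < q -> q < 1 -> q ^+ k * x <= y) -> x <= y.
Proof.
move=> x0 H; apply/ler_addgt0Pl => e e0.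
have K0 : 0 < k%:R * x + 1 by rewrite ltr_wpDl// mulr_ge0.
pose d := Num.min (2^-1) (e / (k%:R * x + 1)).
have d0 : 0 < d by rewrite lt_min invr_gt0 ltr0n divr_gt0.
have d1 : d <= 2^-1 by rewrite ge_min lexx.
have de : d * (k%:R * x + 1) <= e by rewrite -ler_pdivlMr// ge_min lexx orbT.
have q0 : 0 < 1 - d by clear -d1; lra.
have q1 : 1 - d < 1 by clear -d0; lra.
have d2 : d <= 1 by clear -d1; lra.
have := H _ q0 q1; have := ler_wpM2r x0 (bernoulli k (ltW d0) d2) => h1 h2.
have {h1 h2} := le_trans h1 h2.
rewrite mulrBl mul1r lerBlDr => h; apply: le_trans h _; rewrite addrC lerD2r.
apply: le_trans de; rewrite mulrAC mulrC ler_wpM2l ?(ltW d0)//.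
by rewrite lerDl.
Qed.

(** The two inequalities of [radial_squeeze] close up as [q] tends to 1, which gives this integral
    without polar coordinates. *)
Lemma radialE k : radial k 1 = area / k.+1%:R.
Proof.
have M0 : 0 <= radial k 1 by apply: Rintegral_ge0 => p _; rewrite exprn_ge0// sqr_ge0.
apply: (@mulfI _ k.+1%:R); first by rewrite pnatr_eq0.
rewrite mulrCA divff ?pnatr_eq0// mulr1; apply/eqP; rewrite eq_le; apply/andP; split.
  by apply: (@pow_near1 k) => [|q q0 q1]; [rewrite mulr_ge0|have [] := radial_squeeze k q0 q1].
by apply: (@pow_near1 k) => [|q q0 q1]; [exact: ltW area_gt0|have [] := radial_squeeze k q0 q1].
Qed.

(** A Beta integral, by induction on [m]: multiplying out one factor [1 - z z^*] gives a difference
    of two integrals with exponent [m], and [radialE] is the case [m = 0]. *)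
Lemma mono_norm k m : cint (dV R) (cball 1) (mono k k m) =
  (area * (k`!%:R * m`!%:R / (k + m).+1`!%:R))%:C.
Proof.
elim: m k => [|m IH] k.
  have mE p : mono k k 0 p = ((cmod (toC p) ^+ 2) ^+ k)%:C.
    by rewrite /mono expr0 mulr1 -exprMn mulcJ -rmorphXn.
  rewrite /cint; under eq_Rintegral do rewrite mE /=.
  under [X in _ +i* X]eq_Rintegral do rewrite mE /=.
  rewrite -/(radial k 1) radialE addn0 factS natrM mulr1.
  rewrite (_ : (\int[dV R]_(x in cball 1) 0)%R = 0); last by rewrite /Rintegral integral0_eq.
  by congr (_ +i* _); field; rewrite nat1r !pnatr_eq0 /= -lt0n fact_gt0.
have c1 := @cintegrable_mono 1.
have -> : cint (dV R) (cball 1) (mono k k m.+1) =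
    cint (dV R) (cball 1) (mono k k m) - cint (dV R) (cball 1) (mono k.+1 k.+1 m).
  rewrite -cintB; [|exact: measurable_cball|exact: c1|exact: c1].
  by apply: eq_cint => p _; rewrite /mono !exprS; ring.
rewrite !IH -rmorphB /=; congr (_%:C).
rewrite addSn addnS.
have f0 n : n`!%:R != 0 :> R by rewrite pnatr_eq0 -lt0n fact_gt0.
have s0 n : n.+1%:R != 0 :> R by rewrite pnatr_eq0.
have fS n : n.+1`!%:R = (n%:R + 1) * n`!%:R :> R by rewrite factS natrM -natr1.
rewrite !fS -!natr1 natrD; field; rewrite f0 /= -natrD ?natr1 ?natrD ?s0.
by [].
Qed.

End disc_integrals.

(** * Taylor coefficients as integrals over the disc *)

Section disc_convergence.
Variable R : realType.
Local Notation P := (plane R).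
Implicit Types (r e : R) (p : P).

Lemma dV_annulus r : 0 < r -> r < 1 -> dV R (cball 1 `\` cball r) = ((1 - r ^+ 2) * area R)%:E.
Proof.
move=> r0 r1; have sub : (cball r : set P) `<=` cball 1 by exact: cball_sub (ltW r1).
have cr : dV R (cball r) = (r ^+ 2 * area R)%:E.
  have := @radial_dil R 0 r r0 (ltW r1); rewrite expr1.
  have E s : radial 0 s = fine (dV R (cball s)).
    rewrite /radial; under eq_Rintegral do rewrite expr0.
    by rewrite Rintegral_cst ?mul1r//; exact: measurable_cball.
  by rewrite !E -/(area R) => <-; rewrite fineK// ge0_fin_numE// dV_cball_fin.
rewrite measureD; [|exact: measurable_cball|exact: measurable_cball|exact: dV_cball_fin].
rewrite setIidr//; transitivity (dV R (cball 1) - dV R (cball r))%E; first by [].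
by rewrite dV_cball1 cr -EFinB mulrBl mul1r.
Qed.

(** By absolute continuity of the integral: what lies outside [cball r] has area
    [(1 - r ^+ 2) * area R], which is as small as desired. *)
Lemma cint_exhaust (h : P -> R[i]) : cintegrable (dV R) (cball 1) h ->
  (forall r, 0 < r -> r < 1 -> cint (dV R) (cball r) h = 0) -> cint (dV R) (cball 1) h = 0.
Proof.
move=> ih h0; apply/eqP; rewrite -cmod_eq0 eq_le cmod_ge0 andbT; apply/ler_addgt0Pl => e e0.
have m1 := @measurable_cball R 1.
have [d d0 H] := cint_small m1 ih e0.
have A0 := area_gt0 R.
pose t := Num.min 2^-1 (d / 2 / area R).
have t0 : 0 < t by rewrite lt_min invr_gt0 ltr0n !divr_gt0.
have t1 : t < 1 by rewrite gt_min invf_lt1 ?ltr0n// ltr1n.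
have td : t * area R < d.
  apply: (@le_lt_trans _ _ (d / 2)); first by rewrite -ler_pdivlMr// ge_min lexx orbT.
  by rewrite ltr_pdivrMr// ltr_pMr// ltr1n.
pose r := Num.sqrt (1 - t).
have q0 : 0 < 1 - t by rewrite subr_gt0.
have rq : r ^+ 2 = 1 - t by rewrite sqr_sqrtr// ltW.
have r0 : 0 < r by rewrite sqrtr_gt0.
have r1 : r < 1 by rewrite -[1]sqrtr1 ltr_sqrt// ltrBlDr ltrDl.
have mr := @measurable_cball R r.
have mD : measurable (cball 1 `\` cball r : set P) by exact: measurableD.
have cU : cball 1 = cball r `|` (cball 1 `\` cball r) :> set P.
  by rewrite setDUK//; exact: cball_sub (ltW r1).
rewrite cU cint_setU// -?cU//; last by rewrite disj_set2E setDIK.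
rewrite h0// add0r addr0; apply: H => //.
by rewrite dV_annulus// rq lte_fin opprB addrCA subrr addr0.
Qed.

Lemma cint_approx (D : set P) (f g : P -> R[i]) e : measurable D -> (dV R D < +oo)%E ->
  cintegrable (dV R) D f -> cintegrable (dV R) D g ->
  (forall p, D p -> cmod (f p - g p) <= e) ->
  cmod (cint (dV R) D f - cint (dV R) D g) <= e * fine (dV R D).
Proof.
move=> mD fD jf jg fg; rewrite -cintB// -Rintegral_cst//.
by apply: cint_bound => //; [exact: cintegrableB|exact: integrable_cst].
Qed.

Lemma holo_cmeas (f : R[i] -> R[i]) : holo 1 f -> cmeas (cball 1) (f \o @toC R).
Proof.
move=> hf; have [c cP] := holo_series ltr01 hf.
apply: (cmeas_lim (F := fun N p => \sum_(k < N) c k * toC p ^+ k)) => [N|p].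
  apply: cmeasS (measurableT) (@subsetT _ _) _; apply: cmeas_sum => k.
  by apply: cmeasM (cmeas_cst _ _) (cmeasX k _); exact: cmeas_toC.
rewrite /cball /= => p1 e e0; pose r := (cmod (toC p) + 1) / 2.
have [r0 pr r1] : [/\ 0 < r, cmod (toC p) < r & r < 1].
  by have := cmod_ge0 (toC p); rewrite /r; split; lra.
have [M M0 [_ bM]] := cP r r0 r1.
have [N HN] := series_cvg0 M pr e0.
by exists N => n Nn; rewrite cmodC (le_trans (bM _ n pr))// ltW// HN.
Qed.

(** On a smaller disc the power series converges uniformly and may be integrated term by term, and
    orthogonality leaves only the [k]-th term. Near the boundary only integrability of [h] is known,
    so the whole disc is reached by exhaustion. *)
Lemma holo_coef_int (f : R[i] -> R[i]) (c : nat -> R[i]) k m :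
  (forall r, 0 < r -> r < 1 -> exists2 M : R, 0 <= M & series_bound f c r M) ->
  let h p := f (toC p) * (toC p)^* ^+ k * (1 - toC p * (toC p)^*) ^+ m in
  cintegrable (dV R) (cball 1) h ->
  cint (dV R) (cball 1) h = c k * cint (dV R) (cball 1) (mono k k m).
Proof.
move=> cP h ih; have m1 := @measurable_cball R 1.
have im n r : r <= 1 -> cintegrable (dV R) (cball r) (mono n k m) by move=> r1; exact: cintegrable_mono.
rewrite -cintZ//; last exact: im.
apply/eqP; rewrite -subr_eq0 -cintB//; last exact: cintegrableZ (im _ _ _).
apply/eqP; apply: cint_exhaust => [|r r0 r1]; first by apply: cintegrableB => //; apply: cintegrableZ => //; exact: im.
have mr := @measurable_cball R r.
have ihr : cintegrable (dV R) (cball r) h by apply: cintegrable_setU ih => //; exact: cball_sub (ltW r1).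
have imr n := im n r (ltW r1).
(* An intermediate radius, so that the remainder bound for radius [s] is uniform on [cball r]. *)
pose s := (r + 1) / 2.
have [s0 rs s1] : [/\ 0 < s, r < s & s < 1] by rewrite /s; split; lra.
have [M M0 [_ bM]] := cP s s0 s1.
clearbody s; apply/eqP; rewrite (cintB mr ihr (cintegrableZ (c k) mr (imr k))) (cintZ (c k) mr (imr k)) -cmod_eq0 eq_le cmod_ge0 andbT.
apply/ler_addgt0Pl => e e0; rewrite addr0.
have V0 : 0 <= fine (dV R (cball r)) by rewrite fine_ge0.
have e1 : 0 < e / (fine (dV R (cball r)) + 1) by rewrite divr_gt0// ltr_wpDl.
have rs' : cmod (r%:C) < s by rewrite cmodR gtr0_norm.
have [N0 HN] := series_cvg0 M rs' e1.
pose N := maxn N0 k.+1; have kN : (k < N)%N by rewrite leq_max leqnn orbT.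
have {}HN := HN N (leq_maxl _ _).
pose g p := \sum_(j < N) c j * mono j k m p.
have ig : cintegrable (dV R) (cball r) g by apply: cintegrable_sum => // j; exact: cintegrableZ.
have gE : cint (dV R) (cball r) g = c k * cint (dV R) (cball r) (mono k k m).
  rewrite cint_sum//; last by move=> j; exact: cintegrableZ.
  rewrite (bigD1 (Ordinal kN))//= cintZ// big1 ?addr0// => j jk.
  rewrite cintZ// mono_orthogonal ?mulr0 ?(ltW r1)//.
rewrite -gE; apply: le_trans (@cint_approx _ _ _ (e / (fine (dV R (cball r)) + 1)) mr _ ihr ig _) _.
- exact: dV_cball_fin.
- move=> p pr; have pr' : cmod (toC p) < r := pr.
  have ps : cmod (toC p) < s by exact: lt_trans rs.
  rewrite /g /h /mono; rewrite (_ : _ - _ =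
     (f (toC p) - \sum_(j < N) c j * toC p ^+ j) * ((toC p)^* ^+ k * (1 - toC p * (toC p)^*) ^+ m)); last first.
    rewrite mulrBl mulrA; congr (_ - _); rewrite mulr_suml; apply: eq_bigr => j _; ring.
  rewrite cmodM; apply: (@le_trans _ _ (M * (cmod (r%:C) / s) ^+ N * (s / (s - cmod (r%:C))) * 1)).
    apply: ler_pM; rewrite ?cmod_ge0//.
      apply: le_trans (bM _ N ps) _; rewrite cmodR (gtr0_norm r0).
      have sp : 0 < s - cmod (toC p) by rewrite subr_gt0.
      have sr : 0 < s - r by rewrite subr_gt0.
      have qn : 0 <= cmod (toC p) / s by rewrite divr_ge0 ?cmod_ge0 ?(ltW s0).
      apply: ler_pM; rewrite ?mulr_ge0 ?exprn_ge0 ?invr_ge0 ?(ltW s0) ?(ltW sp)//.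
        rewrite ler_wpM2l// lerXn2r ?nnegrE ?divr_ge0 ?cmod_ge0 ?(ltW s0) ?(ltW r0)//.
        by rewrite ler_wpM2r ?invr_ge0 ?(ltW s0) ?(ltW pr').
      rewrite ler_wpM2l ?(ltW s0)// lef_pV2 ?posrE//.
      by rewrite lerD2l lerN2 ltW.
    rewrite -[X in _ <= X]mulr1 cmodM ler_pM ?cmod_ge0//.
      by rewrite cmodX cmodJ exprn_ile1 ?cmod_ge0// ltW// (lt_trans pr').
    by apply: cmod_weight; rewrite /cball /= (lt_trans pr').
  by rewrite mulr1 ltW.
rewrite -mulrA ler_piMr ?(ltW e0)// mulrC ler_pdivrMr ?ltr_wpDl// mul1r lerDl//.
Qed.

End disc_convergence.

(** * The reproducing kernel of a radial weight *)

Section binomial_series.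

(** Partial sums of the binomial series of [(1 - u) ^- s.+1], over a general ring because both real
    and complex arguments occur. *)
Definition binser (A : comNzRingType) s N (u : A) : A := \sum_(k < N) 'C(k + s, s)%:R * u ^+ k.

(** Pascal's rule: multiplication by [1 - u] lowers the exponent by one, up to a single boundary
    term. *)
Lemma binserS (A : comNzRingType) s N (u : A) :
  (1 - u) * binser s.+1 N u + 'C(N + s, s.+1)%:R * u ^+ N = binser s N u.
Proof.
rewrite /binser; elim: N => [|N IH]; first by rewrite !big_ord0 mulr0 add0r add0n bin_small// mul0r.
rewrite !big_ord_recr /= -IH addSn addnS binS natrD exprS; ring.
Qed.

Variable R : realType.
Implicit Types (q e : R) (u : R[i]).

Lemma binser_le s N q : 0 <= q -> q < 1 -> (1 - q) ^+ s.+1 * binser s N q <= 1.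
Proof.
move=> q0 q1; have q1' : 0 <= 1 - q by rewrite subr_ge0 ltW.
elim: s => [|s IH].
  have -> : binser 0 N q = \sum_(k < N) q ^+ k.
    by apply: eq_bigr => k _; rewrite bin0 mul1r.
  rewrite expr1 -opprB mulNr -subrX1 opprB lerBlDr lerDl exprn_ge0//.
apply: le_trans IH; rewrite exprSr -mulrA ler_wpM2l ?exprn_ge0//.
by rewrite -[X in _ <= X]binserS lerDl mulr_ge0// exprn_ge0.
Qed.

Lemma bin_pow_le s k q : 0 <= q -> q < 1 -> 'C(k + s, s)%:R * q ^+ k <= (1 - q) ^- s.+1.
Proof.
move=> q0 q1; have q1' : 0 < (1 - q) ^+ s.+1 by rewrite exprn_gt0// subr_gt0.
rewrite -[X in _ <= X]mul1r ler_pdivlMr// mulrC; apply: le_trans (binser_le s k.+1 q0 q1).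
rewrite ler_wpM2l ?(ltW q1')// /binser big_ord_recr /= lerDr sumr_ge0// => j _.
by rewrite mulr_ge0// exprn_ge0.
Qed.

(** For [t] between [q] and 1 the numbers ['C(n + s, s)%:R * t ^+ n] are bounded by [bin_pow_le],
    and [(q / t) ^+ n] tends to 0. *)
Lemma bin_pow_cvg0 s q e : 0 <= q -> q < 1 -> 0 < e ->
  exists N, forall n, (N <= n)%N -> 'C(n + s, s)%:R * q ^+ n <= e.
Proof.
move=> q0 q1 e0; pose t := (q + 1) / 2.
have [t0 qt t1] : [/\ 0 < t, q < t & t < 1] by rewrite /t; split; lra.
have qt' : cmod (q%:C) < t by rewrite cmodR ger0_norm.
have [N HN] := series_cvg0 ((1 - t) ^- s.+1) qt' e0.
exists N => n /HN /ltW; rewrite cmodR ger0_norm//; apply: le_trans.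
have tq : 0 < t - q by rewrite subr_gt0.
have K0 : 0 <= (1 - t) ^- s.+1 by rewrite invr_ge0 exprn_ge0// subr_ge0 ltW.
rewrite -[X in X <= _]mulr1; apply: ler_pM => //.
- by rewrite mulr_ge0// exprn_ge0.
- rewrite -{1}[q](divfK (lt0r_neq0 t0)) exprMn mulrCA mulrC.
  by apply: ler_wpM2r; [rewrite exprn_ge0// divr_ge0// ltW|exact: bin_pow_le (ltW t0) t1].
- by rewrite ler_pdivlMr// mul1r lerBlDr lerDl.
Qed.

(** Convergence is uniform in [cmod u <= q], as the integration against the kernel requires. By
    [binserS], raising [s] adds only a boundary term, which [bin_pow_cvg0] makes small. *)
Lemma binser_cvg s q e : 0 <= q -> q < 1 -> 0 < e ->
  exists N, forall n u, (N <= n)%N -> cmod u <= q ->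
    cmod (1 - (1 - u) ^+ s.+1 * binser s n u) <= e.
Proof.
move=> q0 q1; elim: s e => [|s IH] e e0.
  have [N HN] := bin_pow_cvg0 0 q0 q1 e0.
  exists N => n u /HN; rewrite bin0 mul1r => qn uq.
  have -> : binser 0 n u = \sum_(k < n) u ^+ k.
    by apply: eq_bigr => k _; rewrite bin0 mul1r.
  rewrite expr1 -[1 - u]opprB mulNr -subrX1 opprK addrCA subrr addr0 cmodX.
  by apply: le_trans qn; rewrite lerXn2r ?nnegrE ?cmod_ge0.
have e2 : 0 < e / 2 by rewrite divr_gt0.
have [N1 H1] := IH _ e2.
have p0 : 0 < 2 ^+ s.+1 :> R by rewrite exprn_gt0.
have [N2 H2] := bin_pow_cvg0 s.+1 q0 q1 (divr_gt0 e2 p0).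
exists (maxn N1 N2) => n u; rewrite geq_max => /andP[n1 n2] uq.
have -> : 1 - (1 - u) ^+ s.+2 * binser s.+1 n u =
    (1 - (1 - u) ^+ s.+1 * binser s n u) + (1 - u) ^+ s.+1 * ('C(n + s, s.+1)%:R * u ^+ n).
  by rewrite -[binser s n u]binserS [(1 - u) ^+ s.+2]exprSr; ring.
apply: le_trans (cmodD _ _) _; rewrite (splitr e); apply: lerD; first exact: H1.
have {}H2 := H2 n n2.
rewrite cmodM mulrC -ler_pdivlMr; last first.
  rewrite cmodX exprn_gt0// (lt_le_trans _ (cmodBr _ _))// cmod1 subr_gt0 (le_lt_trans uq)//.
have c1 : cmod (1 - u) <= 2 by rewrite (le_trans (cmodB _ _))// cmod1 -[2]/(1 + 1) lerD2l (le_trans uq)// ltW.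
have c0 : 0 < cmod (1 - u) by rewrite (lt_le_trans _ (cmodBr _ _))// cmod1 subr_gt0 (le_lt_trans uq).
apply: (@le_trans _ _ (e / 2 / 2 ^+ s.+1)); last first.
  by rewrite ler_wpM2l ?(ltW e2)// lef_pV2 ?posrE ?cmodX ?exprn_gt0// lerXn2r ?nnegrE ?cmod_ge0.
apply: le_trans H2; rewrite cmodM -[X in cmod X](rmorph_nat (real_complex R)) cmodR ger0_norm//.
apply: ler_pM; rewrite ?cmod_ge0 ?ler_nat//; first by rewrite addnS leq_bin2l.
by rewrite cmodX lerXn2r ?nnegrE ?cmod_ge0.
Qed.

End binomial_series.

Lemma prod_le_sqr (R : realDomainType) (a b : R) : 0 <= a -> 0 <= b -> a * b <= a ^+ 2 + b ^+ 2.
Proof. by move=> a0 b0; nra. Qed.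

Lemma cdiffXf (R : realType) n (f : R[i] -> R[i]) z l :
  cdiff f z l -> cdiff (fun w => f w ^+ n) z (n%:R * f z ^+ n.-1 * l).
Proof. by move=> fl; exact: (cdiff_comp fl (cdiffX n (f z))). Qed.

(** The [k]-th coefficient of the kernel is the inverse of the squared norm of the [k]-th monomial,
    as read off from [mono_norm]. *)
Lemma kern_coef (F : numFieldType) (A kap : F) k m : A != 0 -> kap != 0 ->
  m.+1%:R / (A * kap) * kap * 'C(k + m.+1, m.+1)%:R *
  (A * (k`!%:R * m`!%:R / (k + m).+1`!%:R)) = 1.
Proof.
move=> A0 k0; have := @bin_fact (k + m.+1) m.+1 (leq_addl _ _).
rewrite addnK addnS factS => /(congr1 (fun n => n%:R : F)) E.
have f0 n : n`!%:R != 0 :> F by rewrite pnatr_eq0 -lt0n fact_gt0.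
have b0 : 'C((k + m).+1, m.+1)%:R != 0 :> F by rewrite pnatr_eq0 -lt0n bin_gt0 ltnS leq_addl.
move: (f0 m) (f0 k) E b0; move: (k + m).+1`! m`! k`! ('C(_, _)) => a b c e f1 f2 <- e0.
by rewrite !natrM; field; rewrite ?f2 ?f1 ?e0 ?A0 ?k0 nat1r pnatr_eq0.
Qed.

Section reproducing.
Variables (R : realType) (m : nat) (kap : R) (mu : R[i] -> R).
Hypothesis kap0 : 0 < kap.
Hypothesis muE : forall z, disc z -> mu z = kap * (1 - cmod z ^+ 2) ^+ m.
Local Notation P := (plane R).
Implicit Types (f g : R[i] -> R[i]) (p : P) (z w u : R[i]).

Let wgt p : R := kap * (1 - cmod (toC p) ^+ 2) ^+ m.

Let m1 : measurable (cball 1 : set P). Proof. exact: measurable_cball. Qed.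

Let wgt_ge0 p : cball 1 p -> 0 <= wgt p.
Proof.
rewrite /cball /= => p1; rewrite mulr_ge0 ?(ltW kap0)// exprn_ge0// subr_ge0.
by rewrite exprn_ile1 ?cmod_ge0// ltW.
Qed.

Let wgtE p : cball 1 p -> mu (toC p) = wgt p.
Proof. by move=> p1; rewrite muE//; exact/discE. Qed.

Let measurable_wgt : measurable_fun setT wgt.
Proof.
apply: measurable_funM; first exact: measurable_cst.
apply: measurable_funX; apply: measurable_funB; first exact: measurable_cst.
exact: measurable_cmod_sqr.
Qed.

Let cmeas_wgt : cmeas (cball 1) (fun p => (wgt p)%:C).
Proof. by split; [exact: measurable_funS measurable_wgt|exact: measurable_cst]. Qed.

Lemma bergman_spaceP f : bergman_space mu f <->
  holo 1 f /\ (dV R).-integrable (cball 1) (EFin \o (fun p => cmod (f (toC p)) ^+ 2 * wgt p)).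
Proof.
rewrite /bergman_space disc2E /=; split => -[hf jf]; split.
- by move=> w /discE /hf /derivable_cdiff; exists (cderive f w).
- by apply: eq_integrable jf => //= p; rewrite inE => /wgtE ->.
- by move=> z /discE /hf[l]; exact: cdiff_derivable.
- by apply: eq_integrable jf => //= p; rewrite inE => /wgtE ->.
Qed.

(** The bound [a * b <= a ^+ 2 + b ^+ 2] takes the place of the Cauchy-Schwarz inequality. *)
Lemma dot_cintegrable f g : bergman_space mu f -> bergman_space mu g ->
  cintegrable (dV R) (cball 1) (fun p => f (toC p) * (g (toC p))^* * (wgt p)%:C).
Proof.
move=> /bergman_spaceP[hf jf] /bergman_spaceP[hg jg].
apply: (cintegrable_dom (g := fun p => cmod (f (toC p)) ^+ 2 * wgt p + cmod (g (toC p)) ^+ 2 * wgt p)) => //.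
- apply: cmeasM (cmeas_wgt); apply: cmeasM; first exact: holo_cmeas.
  by apply: cmeasJ; exact: holo_cmeas.
- by apply: eq_integrable (integrableD m1 jf jg) => // p _; rewrite /= EFinD.
- move=> p p1; have w0 := wgt_ge0 p1; rewrite !cmodM cmodJ cmodR ger0_norm// -mulrDl ler_wpM2r//.
  by apply: prod_le_sqr; exact: cmod_ge0.
Qed.

Lemma bergman_dotE f g : bergman_dot mu f g =
  cint (dV R) (cball 1) (fun p => f (toC p) * (g (toC p))^* * (wgt p)%:C).
Proof.
rewrite /bergman_dot disc2E /cint /=; congr (_ +i* _); apply: eq_Rintegral => p; rewrite inE => /wgtE ->.
  by case: (f (toC p)) (g (toC p)) => a b [c d] /=; rewrite mulr0 subr0.
by case: (f (toC p)) (g (toC p)) => a b [c d] /=; rewrite mulr0 add0r.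
Qed.

Lemma bergman_dotC f g : bergman_space mu f -> bergman_space mu g ->
  bergman_dot mu g f = (bergman_dot mu f g)^*.
Proof.
move=> bf bg; rewrite !bergman_dotE /cint /=; have [_ j2] := dot_cintegrable bf bg.
congr (_ +i* _).
  apply: eq_Rintegral => p _.
  by case: (f (toC p)) (g (toC p)) => a b [c d] /=; ring.
rewrite -[RHS]mulN1r -RintegralZl//; apply: eq_Rintegral => p _.
by case: (f (toC p)) (g (toC p)) => a b [c d] /=; ring.
Qed.

(* Reproducing [K1 _ w] by [K2 _ z] shows [K1 z w = (K2 w z)^*]. *)
Lemma kernel_unique (K1 K2 : R[i] -> R[i] -> R[i]) :
  is_reproducing_kernel mu K1 -> is_reproducing_kernel mu K2 ->
  forall z w, disc z -> disc w -> K1 z w = K2 z w.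
Proof.
have H K K' z w : is_reproducing_kernel mu K -> is_reproducing_kernel mu K' ->
    disc z -> disc w -> K z w = (K' w z)^*.
  move=> rK rK' dz dw; have [bK rKw] := rK w dw; have [bK' rKz] := rK' z dz.
  by rewrite (rKz _ bK) (rKw _ bK') bergman_dotC.
move=> r1 r2 z w dz dw; rewrite (H _ _ _ _ r1 r2)// (H _ _ _ _ r2 r2)//.
by rewrite conjcK.
Qed.

(** Closed form of the sum over [k] of the [k]-th power of [z * w^*] divided by the squared norm of
    the [k]-th monomial for the weight [mu]. *)
Definition kern z w : R[i] := (m.+1%:R / (area R * kap))%:C * (1 - z * w^*) ^- m.+2.

Let kern_neq0 z w : cmod z < 1 -> cmod w < 1 -> 1 - z * w^* != 0.
Proof.
move=> z1 w1; rewrite subr_eq0 eq_sym; apply/eqP => /(congr1 (@cmod R)).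
rewrite cmod1 cmodM cmodJ => /eqP; rewrite lt_eqF//.
by apply: (le_lt_trans _ w1); rewrite ler_piMl ?cmod_ge0// ltW.
Qed.

Lemma kern_holo w : cmod w < 1 -> holo 1 (kern ^~ w).
Proof.
move=> w1 z z1; eexists; apply: cdiffZ; apply: cdiffVf; first by rewrite expf_neq0// kern_neq0.
apply: cdiffXf; apply: cdiffB; first exact: cdiff_cst.
by apply: cdiffM; [exact: cdiff_id|exact: cdiff_cst].
Qed.

Lemma kern_bergman w : cmod w < 1 -> bergman_space mu (kern ^~ w).
Proof.
move=> w1; have kh := kern_holo w1; apply/bergman_spaceP; split => //.
pose M := (m.+1%:R / (area R * kap) * (1 - cmod w) ^- m.+2) ^+ 2 * kap.
have iM : (dV R).-integrable (cball 1) (EFin \o (fun=> M)).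
  by apply: integrable_cst => //; exact: dV_cball_fin.
have d0 : 0 < 1 - cmod w by rewrite subr_gt0.
have c0 : 0 <= m.+1%:R / (area R * kap) by rewrite divr_ge0// mulr_ge0 ?(ltW (area_gt0 R)) ?ltW.
apply: le_integrable iM => //.
  apply/measurable_EFinP; apply: measurable_funM; last exact: measurable_funS measurable_wgt.
  have [h1 h2] := holo_cmeas kh.
  apply: eq_measurable_fun (measurable_funD (measurable_funX 2 h1) (measurable_funX 2 h2)).
  by move=> p _; rewrite cmod_sqr.
move=> p p1; have w0 := wgt_ge0 p1; rewrite /= lee_fin ger0_norm; last by rewrite mulr_ge0// sqr_ge0.
apply: le_trans (ler_norm _); apply: ler_pM; rewrite ?sqr_ge0//.
  rewrite lerXn2r ?nnegrE ?cmod_ge0//; first by rewrite mulr_ge0// invr_ge0 exprn_ge0// ltW.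
  rewrite cmodM cmodR ger0_norm// ler_wpM2l// cmodV cmodX lef_pV2 ?posrE ?exprn_gt0//.
    apply: lerXn2r; rewrite ?nnegrE ?cmod_ge0 ?(ltW d0)//.
    apply: le_trans (cmodBr _ _); rewrite cmod1 lerD2l lerN2 cmodM cmodJ ler_piMl ?cmod_ge0//.
    exact: ltW p1.
  by rewrite cmod_gt0 kern_neq0.
rewrite /wgt ler_piMr ?(ltW kap0)// exprn_ile1//; last by rewrite lerBlDr lerDl sqr_ge0.
by rewrite subr_ge0 exprn_ile1 ?cmod_ge0// ltW.
Qed.

(** Pairing [f] with the constant 1 shows that [f] itself is integrable against the weight. *)
Let const_bergman : bergman_space mu (fun=> 1).
Proof.
apply/bergman_spaceP; split; first by move=> z _; exists 0; exact: cdiff_cst.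
have jM : (dV R).-integrable (cball 1) (EFin \o (fun=> kap)).
  by apply: integrable_cst => //; exact: dV_cball_fin.
apply: le_integrable jM => //.
  apply/measurable_EFinP; apply: measurable_funM; first exact: measurable_cst.
  exact: measurable_funS measurable_wgt.
move=> p p1; have w0 := wgt_ge0 p1; rewrite /= lee_fin cmod1 expr1n mul1r ger0_norm//.
apply: le_trans (ler_norm _); rewrite /wgt ler_piMr ?(ltW kap0)// exprn_ile1//.
  by rewrite subr_ge0 exprn_ile1 ?cmod_ge0// ltW.
by rewrite lerBlDr lerDl sqr_ge0.
Qed.

(** Pairing [f] with the partial sums of the binomial series of [kern] yields the Taylor partial
    sums of [f] at [w], by [holo_coef_int]. For fixed [w] the series converges uniformly on the
    disc, since [cmod ((toC p)^* * w) <= cmod w < 1], and [f] is integrable against the weight, so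
    both sides pass to the limit. *)
Theorem kern_reproducing : is_reproducing_kernel mu kern.
Proof.
move=> w /discE w1; split; first exact: kern_bergman.
move=> f bf; rewrite bergman_dotE.
have [hf _] := (bergman_spaceP f).1 bf.
have [c cP] := holo_series ltr01 hf.
pose C : R[i] := (m.+1%:R / (area R * kap))%:C.
pose h k p := f (toC p) * (toC p)^* ^+ k * (1 - toC p * (toC p)^*) ^+ m.
have wE p : (wgt p)%:C = kap%:C * (1 - toC p * (toC p)^*) ^+ m.
  by rewrite mulcJ /wgt rmorphM rmorphXn rmorphB.
have jf : cintegrable (dV R) (cball 1) (fun p => f (toC p) * (wgt p)%:C).
  by apply: eq_cintegrable (dot_cintegrable bf const_bergman) => // p _; rewrite cconj1 mulr1.
have cf := cintegrable_cmod m1 jf.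
have kapC : kap%:C != 0 by rewrite -cmod_gt0 cmodR gtr0_norm.
have jh k : cintegrable (dV R) (cball 1) (h k).
  apply: (cintegrable_dom (g := fun p => kap^-1 * cmod (f (toC p) * (wgt p)%:C))) => //.
  - apply: cmeasM; first apply: cmeasM; first exact: holo_cmeas.
      by apply: cmeasX; apply: cmeasJ; apply: cmeasS (cmeas_toC R).
    apply: cmeasX; apply: cmeasB; first exact: cmeas_cst.
    by apply: cmeasM; [|apply: cmeasJ]; apply: cmeasS (cmeas_toC R).
  - exact: integrable_mulr.
  - move=> p p1; rewrite /h wE [kap%:C * _]mulrC mulrA [X in kap^-1 * X]cmodM cmodR gtr0_norm//.
    rewrite [X in _ <= X]mulrC mulfK ?gt_eqF// mulrAC [X in X <= _]cmodM.
    apply: ler_piMr; first exact: cmod_ge0.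
    by rewrite cmodX cmodJ exprn_ile1 ?cmod_ge0// ltW.
have ckI k : cint (dV R) (cball 1) (h k) = c k * (area R * (k`!%:R * m`!%:R / (k + m).+1`!%:R))%:C.
  by rewrite -mono_norm; apply: (holo_coef_int cP (jh k)).
pose I := \int[dV R]_(p in cball 1) cmod (f (toC p) * (wgt p)%:C).
have I0 : 0 <= I by apply: Rintegral_ge0 => p _; exact: cmod_ge0.
(* the N-th partial sum of the binomial series of the kernel *)
pose g N p := f (toC p) * (C * binser m.+1 N ((toC p)^* * w)) * (wgt p)%:C.
have gE N p : g N p = \sum_(k < N) (C * kap%:C * 'C(k + m.+1, m.+1)%:R * w ^+ k) * h k p.
  rewrite /g /binser wE /h mulr_sumr mulr_sumr mulr_suml; apply: eq_bigr => k _; rewrite exprMn; ring.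
have jg N : cintegrable (dV R) (cball 1) (g N).
  apply: (eq_cintegrable (f := fun p => \sum_(k < N) (C * kap%:C * 'C(k + m.+1, m.+1)%:R * w ^+ k) * h k p)) => //.
  by apply: cintegrable_sum => // k; exact: cintegrableZ.
have gI N : cint (dV R) (cball 1) (g N) = \sum_(k < N) c k * w ^+ k.
  have -> : cint (dV R) (cball 1) (g N) = cint (dV R) (cball 1)
      (fun p => \sum_(k < N) (C * kap%:C * 'C(k + m.+1, m.+1)%:R * w ^+ k) * h k p).
    by apply: eq_cint => p _; exact: gE.
  rewrite cint_sum//; last by move=> k; exact: cintegrableZ.
  apply: eq_bigr => k _; rewrite cintZ// ckI.
  rewrite (_ : _ * _ = (C * kap%:C * 'C(k + m.+1, m.+1)%:R *
     (area R * (k`!%:R * m`!%:R / (k + m).+1`!%:R))%:C) * (c k * w ^+ k)); last by ring.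
  rewrite -[RHS]mul1r; congr (_ * _).
  rewrite /C -(rmorph_nat (real_complex R) 'C(_, _)) -!(rmorphM (real_complex R)) -[RHS]/(1%:C); congr (_%:C).
  by apply: kern_coef; rewrite gt_eqF// area_gt0.
pose K p := f (toC p) * (kern (toC p) w)^* * (wgt p)%:C.
have jK : cintegrable (dV R) (cball 1) K by exact: dot_cintegrable (kern_bergman w1).
have d0 : 0 < 1 - cmod w by rewrite subr_gt0.
have gK e : 0 < e -> exists N0, forall N, (N0 <= N)%N ->
    cmod (cint (dV R) (cball 1) K - \sum_(k < N) c k * w ^+ k) <= e.
  move=> e0; pose D := cmod C * (1 - cmod w) ^- m.+2 * I + 1.
  have D0 : 0 < D by rewrite ltr_wpDl// !mulr_ge0 ?cmod_ge0// invr_ge0 exprn_ge0// ltW.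
  have [N0 HN] := binser_cvg m.+1 (cmod_ge0 w) w1 (divr_gt0 e0 D0).
  exists N0 => N /HN{}HN; rewrite -gI -cintB//.
  have jb : (dV R).-integrable (cball 1)
      (EFin \o (fun p => cmod C * (1 - cmod w) ^- m.+2 * (e / D) * cmod (f (toC p) * (wgt p)%:C))).
    exact: integrable_mulr.
  apply: le_trans (cint_bound m1 (cintegrableB m1 jK (jg N)) jb _) _ => [p p1|].
    have p1' : cmod (toC p) < 1 := p1; pose u := (toC p)^* * w.
    have uw : cmod u <= cmod w by rewrite cmodM cmodJ ler_piMl ?cmod_ge0// ltW.
    have u0 : 1 - u != 0 by rewrite /u mulrC kern_neq0.
    have -> : K p - g N p = C * (1 - u) ^- m.+2 * (1 - (1 - u) ^+ m.+2 * binser m.+1 N u) * (f (toC p) * (wgt p)%:C).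
      rewrite /K /g /kern -/C -/u cconjM cconjV cconjX cconjB cconjM conjcK cconj1 cconjR -/u -/C.
      have := expf_neq0 m.+2 u0; move: ((1 - u) ^+ m.+2) (binser _ _ _) => X B X0.
      have -> : C / X * (1 - X * B) = C / X - C * B by rewrite mulrBr mulr1 mulrA divfK.
      by rewrite mulrBl; congr (_ - _); rewrite mulrAC mulrC mulrA.
    rewrite !cmodM ler_wpM2r ?mulr_ge0 ?cmod_ge0// ler_pM ?mulr_ge0 ?cmod_ge0//; last exact: HN.
    rewrite ler_wpM2l ?cmod_ge0// cmodV cmodX lef_pV2 ?posrE ?exprn_gt0 ?cmod_gt0//.
    apply: lerXn2r; rewrite ?nnegrE ?cmod_ge0 ?(ltW d0)//.
    by apply: le_trans (cmodBr _ _); rewrite cmod1 lerD2l lerN2.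
  rewrite RintegralZl// -/I.
  rewrite (_ : _ * _ * I = (cmod C * (1 - cmod w) ^- m.+2 * I) * (e / D)); last by ring.
  rewrite mulrCA ler_piMr ?(ltW e0)// ler_pdivrMr// mul1r /D lerDl//.
apply/eqP; rewrite -subr_eq0 -cmod_eq0 eq_le cmod_ge0 andbT; apply/ler_addgt0Pl => e e0.
rewrite addr0; have e2 : 0 < e / 2 by rewrite divr_gt0.
have [N1 H1] := gK _ e2.
pose r := (cmod w + 1) / 2.
have [r0 wr r1] : [/\ 0 < r, cmod w < r & r < 1].
  by have := cmod_ge0 w; rewrite /r; split; lra.
have [M M0 [_ bM]] := cP r r0 r1.
have [N2 H2] := series_cvg0 M wr e2.
pose N := maxn N1 N2.
rewrite -(subrK (\sum_(k < N) c k * w ^+ k) (f w)) -addrA (splitr e).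
apply: le_trans (cmodD _ _) _; apply: lerD.
  by apply: le_trans (bM _ _ wr) _; apply: ltW; apply: H2; rewrite leq_maxr.
by rewrite cmodC; apply: H1; rewrite leq_maxl.
Qed.

(** Since [kern] exists, [xget] does choose a reproducing kernel, and uniqueness identifies the
    chosen one with [kern] on the disc. *)
Lemma reproducing_kernelE z w : disc z -> disc w -> reproducing_kernel mu z w = kern z w.
Proof.
move=> dz dw; apply: kernel_unique => //; last exact: kern_reproducing.
exact: (xgetPex _ (ex_intro _ _ kern_reproducing)).
Qed.

End reproducing.

(** * The weighted Bergman metric *)

Section metric_computation.
Variable R : realType.
Implicit Types (z w l : R[i]) (t : R).

Lemma is_derive_eps (f : R -> R) (a l : R) :
  (forall e, 0 < e -> exists2 d, 0 < d & forall h, `|h| < d -> `|f (a + h) - f a - l * h| <= e * `|h|) ->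
  is_derive a 1 f l.
Proof.
move=> H.
have fl : h^-1 *: ((f \o shift a) (h *: 1) - f a) @[h --> (0 : R)^'] --> l.
  apply/cvgrPdist_le => e /H[d d0 {}H]; near=> h.
  have h0 : h != 0 by near: h; exact: nbhs_dnbhs_neq.
  have hd : `|h| < d.
    near: h; apply: dnbhs0_lt => //.
  have h0' : 0 < `|h| by rewrite normr_gt0.
  rewrite distrC -(ler_pM2r h0') -normrM /= [h *: 1]mulr1 [h + a]addrC.
  rewrite [X in X * h](_ : _ = h^-1 * (f (a + h) - f a) - l)//.
  by rewrite mulrBl mulrC mulrA divff// mul1r H.
by apply: DeriveDef; [apply/cvg_ex; exists l|exact: cvg_lim fl].
Unshelve. all: by end_near. Qed.

Lemma cdiff_is_derive (g : R[i] -> R[i]) (F : R -> R) l : cdiff g 0 l ->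
  (forall t, F t = complex.Re (g t%:C)) -> is_derive (0 : R) 1 F (complex.Re l).
Proof.
move=> gl FE; apply: is_derive_eps => e /gl[d d0 H]; exists d => // h hd.
have := H h%:C; rewrite cmodR => /(_ hd); rewrite !FE !add0r; apply: le_trans.
rewrite (_ : 0%:C = 0 :> R[i])//; apply: le_trans (Re_cmod _).
by case: (g _) (g 0) l {gl H} => a b [c u] [x y] /=; rewrite mulr0 subr0.
Qed.

(** Along a real line both [z] and [z^*] are affine in the parameter. Allowing complex values of the
    parameter turns the functions at hand into holomorphic ones, and the rules for [cdiff] compute
    their real derivatives. *)
Lemma rderiveE (F : R -> R[i]) (g : R[i] -> R[i]) l d : 0 < d -> cdiff g 0 l ->
  (forall t, `|t| < d -> F t = g t%:C) -> rderive F 0 = l.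
Proof.
move=> d0 gl FE.
have near_d : \forall t \near (0 : R), `|t| < d.
  by apply/nbhs_ballP; exists d => // t; rewrite /ball /= sub0r normrN.
have Re_l : derive1 (fun s => complex.Re (F s)) 0 = complex.Re l.
  have D := cdiff_is_derive gl (F := fun t => complex.Re (g t%:C)) (fun=> erefl).
  rewrite derive1E -(derive_val (is_derive := D)); apply: near_eq_derive.
  by near=> t; rewrite FE//; near: t.
have Im_l : derive1 (fun s => complex.Im (F s)) 0 = complex.Im l.
  have D : is_derive (0 : R) 1 (fun t => complex.Im (g t%:C)) (complex.Im l).
    have -> : complex.Im l = complex.Re (- 'i * l) by case: (l) => a b /=; ring.
    apply: cdiff_is_derive (cdiffZ (- 'i) gl) _ => t.
    by case: (g _) => a b /=; ring.
  rewrite derive1E -(derive_val (is_derive := D)); apply: near_eq_derive.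
  by near=> t; rewrite FE//; near: t.
by rewrite /rderive Re_l Im_l; case: (l).
Unshelve. all: by end_near. Qed.


Lemma rderive_real (u : R -> R) (l : R) : is_derive (0 : R) 1 u l -> rderive (fun t => (u t)%:C) 0 = l%:C.
Proof.
move=> D; rewrite /rderive /= derive1E (derive_val (is_derive := D)).
by rewrite derive1E (derive_val (is_derive := is_derive_cst _ _ _)).
Qed.

Definition pd (F : R[i] -> R[i]) z v : R[i] := rderive (fun t => F (z + t%:C * v)) 0.

Lemma pd1 F z : pd F z 1 = partial_x F z.
Proof.
apply: (congr1 (fun G => rderive G 0)); apply/funext => t.
by apply: (congr1 (fun u => F (z + u))); exact: mulr1.
Qed.

Lemma conjc_i : ('i%C : R[i])^* = - 'i%C.
Proof. by apply/eqP; rewrite eq_complex /= oppr0 !eqxx. Qed.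

Lemma wirtingerE F z : wirtinger F z = (pd F z 1 - 'i%C * pd F z 'i%C) / 2.
Proof. by rewrite pd1. Qed.

Lemma wirtinger_barE F z : wirtinger_bar F z = (pd F z 1 + 'i%C * pd F z 'i%C) / 2.
Proof. by rewrite pd1. Qed.

Lemma disc_shift z v t : cmod v = 1 -> `|t| < 1 - cmod z -> cmod (z + t%:C * v) < 1.
Proof.
move=> v1 tz; apply: le_lt_trans (cmodD _ _) _.
by rewrite cmodM cmodR v1 mulr1 -ltrBrDl.
Qed.

Lemma one_subJ z : 1 - z * z^* = (1 - cmod z ^+ 2)%:C.
Proof. by rewrite mulcJ rmorphB. Qed.

Lemma one_sub_sqr_gt0 z : cmod z < 1 -> 0 < 1 - cmod z ^+ 2.
Proof. by move=> z1; rewrite subr_gt0 exprn_ilt1 ?cmod_ge0. Qed.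

Lemma kern_diagonal m kap z : cmod z < 1 ->
  Defs.diagonal (kern m kap) z = m.+1%:R / (area R * kap) * (1 - cmod z ^+ 2) ^- m.+2.
Proof. by move=> z1; rewrite /Defs.diagonal /kern one_subJ -rmorphXn -fmorphV -rmorphM. Qed.

(** The unweighted kernel is [kern 0 1], whose diagonal is a multiple of [(1 - cmod z ^+ 2) ^- 2].
    Its power of exponent [- d] is therefore a weight with [m = 2 * d], and the weighted kernel has
    exponent [m + 2 = 2 * (d + 1)]. *)
Lemma weighted_diagonal d : exists2 c : R, 0 < c & forall z, disc z ->
  Defs.diagonal (@weighted_bergman_kernel R d) z = c * (1 - cmod z ^+ 2) ^- (2 * d.+1).
Proof.
have A0 := area_gt0 R.
have kE z w : disc z -> disc w -> @bergman_kernel R z w = kern 0 1 z w.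
  move=> dz dw; apply: reproducing_kernelE => // u _; by rewrite expr0 mulr1.
have wE z : disc z -> bergman_weight d z = area R ^+ d * (1 - cmod z ^+ 2) ^+ (2 * d).
  move=> dz; have z1 := (discE z).1 dz.
  rewrite /bergman_weight /Defs.diagonal kE// -/(Defs.diagonal _ _) kern_diagonal// mulr1 div1r -invfM.
  by rewrite -exprVn invrK exprMn exprM.
have Ad : 0 < area R ^+ d by rewrite exprn_gt0.
exists ((2 * d).+1%:R / (area R * area R ^+ d)) => [|z dz]; first by rewrite divr_gt0// mulr_gt0.
rewrite /Defs.diagonal /weighted_bergman_kernel (reproducing_kernelE Ad wE)// -/(Defs.diagonal _ _).
rewrite kern_diagonal//; last exact/discE.
by rewrite mulnS add2n.
Qed.

Lemma pd_log d z v : cmod v = 1 -> cmod z < 1 ->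
  pd (fun z => (ln (Defs.diagonal (@weighted_bergman_kernel R d) z))%:C) z v =
  (2 * d.+1)%:R * (v * z^* + z * v^*) / (1 - z * z^*).
Proof.
move=> v1 z1; have [c c0 cE] := weighted_diagonal d.
(* The complexification of [u]: the conjugate is expanded as for real [t], so that [g] is
   holomorphic in [t]. *)
pose g (t : R[i]) := 1 - (z + t * v) * (z^* + t * v^*).
pose u (t : R) := 1 - cmod (z + t%:C * v) ^+ 2.
have ug t : u t = complex.Re (g t%:C).
  by rewrite /g -[t%:C in X in _ * X]cconjR -cconjM -cconjD one_subJ.
have dg : cdiff g 0 (- (v * z^* + z * v^*)).
  have h1 : cdiff (fun t : R[i] => z + t * v) 0 v.
    have := cdiffD (cdiff_cst z 0) (cdiffM (cdiff_id 0) (cdiff_cst v 0)).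
    by rewrite mul1r mul0r addr0 add0r.
  have h2 : cdiff (fun t : R[i] => z^* + t * v^*) 0 v^*.
    have := cdiffD (cdiff_cst z^* 0) (cdiffM (cdiff_id 0) (cdiff_cst v^* 0)).
    by rewrite mul1r mul0r addr0 add0r.
  have := cdiffB (cdiff_cst 1 0) (cdiffM h1 h2).
  by rewrite !mul0r !addr0 sub0r.
have du := cdiff_is_derive dg ug.
have u0 : u 0 = 1 - cmod z ^+ 2 by rewrite /u mul0r addr0.
have u0p : 0 < u 0 by rewrite u0 one_sub_sqr_gt0.
have dl := is_derive1_comp (is_derive1_ln u0p) du.
have {dl} dL := is_deriveD (is_derive_cst (ln c) (0 : R) 1) (is_deriveZ (- (2 * d.+1)%:R) dl).
have D : is_derive (0 : R) 1 (fun t => ln (Defs.diagonal (weighted_bergman_kernel d) (z + t%:C * v)))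
    (0 + (- (2 * d.+1)%:R) *: ((u 0)^-1 * complex.Re (- (v * z^* + z * v^*)))).
  apply: near_eq_is_derive dL; near=> t.
  have tz : `|t| < 1 - cmod z.
    near: t; apply/nbhs_ballP; exists (1 - cmod z); first by rewrite /= subr_gt0.
    by move=> t; rewrite /ball /= sub0r normrN.
  have zt := disc_shift v1 tz.
  rewrite cE; last exact/discE.
  have ut : 0 < u t by rewrite one_sub_sqr_gt0.
  rewrite lnM ?posrE ?invr_gt0 ?exprn_gt0// lnV ?posrE ?exprn_gt0// lnXn// -[ln _ *+ _]mulr_natl -mulNr.
  by [].
rewrite /pd (rderive_real D).
have reJ : (complex.Re (v * z^* + z * v^*))%:C = v * z^* + z * v^*.
  by clear; case: z v => a b [x y]; apply/eqP; rewrite eq_complex /=; apply/andP; split; apply/eqP; ring.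
have -> : complex.Re (- (v * z^* + z * v^*)) = - complex.Re (v * z^* + z * v^*).
  by case: (v * z^* + z * v^*).
rewrite add0r -[_ *: _]/(_ * _) !mulrN mulNr opprK (rmorphM (real_complex R)) (rmorphM (real_complex R)) /=.
by rewrite reJ u0 (fmorphV (real_complex R)) /= -one_subJ (rmorph_nat (real_complex R)) mulrA mulrAC.
Unshelve. all: by end_near. Qed.

Lemma wirtinger_bar_log d z : cmod z < 1 ->
  wirtinger_bar (fun z => (ln (Defs.diagonal (@weighted_bergman_kernel R d) z))%:C) z =
  (2 * d.+1)%:R * z / (1 - z * z^*).
Proof.
move=> z1; rewrite wirtinger_barE !pd_log ?cmod1 ?cmod_i//.
rewrite cconj1 conjc_i.
have i2 : 'i%C * 'i%C = -1 :> R[i] by rewrite -[X in _ = X](mulCii R[i]).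
rewrite (_ : _ + 'i%C * _ = 2 * ((2 * d.+1)%:R * z / (1 - z * z^*))); last first.
  by ring: i2.
by rewrite mulrC mulKf// pnatr_eq0.
Qed.

Theorem bergman_metricE d z : cmod z < 1 ->
  @bergman_metric R d z = (2 * d.+1)%:R / (1 - z * z^*) ^+ 2.
Proof.
move=> z1; pose M : R[i] := (2 * d.+1)%:R.
have n0 : 1 - z * z^* != 0.
  by rewrite one_subJ -cmod_gt0 cmodR normr_gt0 gt_eqF// one_sub_sqr_gt0.
have pdW v : cmod v = 1 -> pd (wirtinger_bar (fun z => (ln (Defs.diagonal (@weighted_bergman_kernel R d) z))%:C)) z v
    = M * (v * (1 - z * z^*) + z * (v * z^* + z * v^*)) / (1 - z * z^*) ^+ 2.
  move=> v1.
  have h1 : cdiff (fun t : R[i] => z + t * v) 0 v.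
    have := cdiffD (cdiff_cst z 0) (cdiffM (cdiff_id 0) (cdiff_cst v 0)).
    by rewrite mul1r mul0r addr0 add0r.
  have h2 : cdiff (fun t : R[i] => z^* + t * v^*) 0 v^*.
    have := cdiffD (cdiff_cst z^* 0) (cdiffM (cdiff_id 0) (cdiff_cst v^* 0)).
    by rewrite mul1r mul0r addr0 add0r.
  have h3 := cdiffB (cdiff_cst 1 0) (cdiffM h1 h2).
  have d0 : 0 < 1 - cmod z by rewrite subr_gt0.
  have n0' : 1 - (z + 0 * v) * (z^* + 0 * v^*) != 0 by rewrite !mul0r !addr0.
  have h4 := cdiff_div (g := fun t : R[i] => 1 - (z + t * v) * (z^* + t * v^*)) n0' (cdiffZ M h1) h3.
  rewrite /pd (rderiveE d0 h4); last first.
    move=> t td; rewrite wirtinger_bar_log; last exact: disc_shift.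
    by rewrite cconjD cconjM cconjR.
  by rewrite !mul0r !addr0 -/M; congr (_ / _); ring.
rewrite /bergman_metric wirtingerE !pdW ?cmod1 ?cmod_i//.
rewrite cconj1 conjc_i.
have i2 : 'i%C * 'i%C = -1 :> R[i] by rewrite -[X in _ = X](mulCii R[i]).
rewrite (_ : _ - 'i%C * _ = 2 * (M / (1 - z * z^*) ^+ 2)); last by ring: i2.
by rewrite mulrC mulKf// pnatr_eq0.
Qed.

End metric_computation.

(** * Schwarz-Pick and polarization *)

Section moebius.
Variable R : realType.
Implicit Types (b z w l : R[i]).

Definition mob b w : R[i] := (w - b) / (1 - b^* * w).

Lemma one_sub_neq0 z w : cmod z < 1 -> cmod w < 1 -> 1 - z * w != 0.
Proof.
move=> z1 w1; rewrite subr_eq0 eq_sym; apply/eqP => /(congr1 (@cmod R)).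
rewrite cmod1 cmodM => /eqP; rewrite lt_eqF//.
by apply: (le_lt_trans _ w1); rewrite ler_piMl ?cmod_ge0// ltW.
Qed.

Lemma mob_den b w : cmod b < 1 -> cmod w < 1 -> 1 - b^* * w != 0.
Proof. by move=> b1 w1; rewrite one_sub_neq0// cmodJ. Qed.

Lemma mob_diff b w : cmod b < 1 -> cmod w < 1 ->
  cdiff (mob b) w ((1 - b * b^*) / (1 - b^* * w) ^+ 2).
Proof.
move=> b1 w1; have dn := cdiffB (cdiff_id w) (cdiff_cst b w).
have dd := cdiffB (cdiff_cst 1 w) (cdiffZ b^* (cdiff_id w)).
have := cdiff_div (g := fun w => 1 - b^* * w) (mob_den b1 w1) dn dd.
by congr (cdiff _ _ (_ / _)); ring.
Qed.

Lemma mob_idE b w : cmod b < 1 -> cmod w < 1 ->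
  1 - mob b w * (mob b w)^* =
  (1 - b * b^*) * (1 - w * w^*) / ((1 - b^* * w) * (1 - b * w^*)).
Proof.
move=> b1 w1; rewrite /mob cconjM cconjV !cconjB cconj1 cconjM conjcK.
have := mob_den b1 w1; have : 1 - b * w^* != 0 by rewrite one_sub_neq0// cmodJ.
move: b^* w^* => b' w' h1 h2; by field; rewrite h1 h2.
Qed.

Lemma mob_disc b w : cmod b < 1 -> cmod w < 1 -> cmod (mob b w) < 1.
Proof.
move=> b1 w1; rewrite -(@ltr_pXn2r _ 2) ?nnegrE ?cmod_ge0// expr1n -subr_gt0.
rewrite -ltcR -one_subJ mob_idE// [X in _ * X](_ : _ = (cmod (1 - b^* * w) ^+ 2)%:C^-1); last first.
  by rewrite -mulcJ cconjB cconj1 cconjM conjcK.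
rewrite !one_subJ -fmorphV -!rmorphM ltcR !mulr_gt0 ?one_sub_sqr_gt0//.
by rewrite invr_gt0 exprn_gt0// cmod_gt0 mob_den.
Qed.

Lemma mobK b w : cmod b < 1 -> cmod w < 1 -> mob (- b) (mob b w) = w.
Proof.
move=> b1 w1; rewrite /mob (_ : (- b)^* = - b^*); last exact: rmorphN.
have h1 := mob_den b1 w1; have h2 : 1 - b * b^* != 0 by rewrite one_sub_neq0// cmodJ.
have h3 : 1 - - b^* * ((w - b) / (1 - b^* * w)) != 0.
  rewrite (_ : _ - _ = (1 - b * b^*) / (1 - b^* * w)) ?mulf_neq0 ?invr_eq0//.
  by move: b^* h1 h2 => b' h1 h2; field.
apply: (canLR (mulfK h3)).
by move: b^* h1 {h2 h3} => b' h1; field.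
Qed.

Lemma mob0 b : mob b b = 0.
Proof. by rewrite /mob subrr mul0r. Qed.

Lemma disc_automorphism_mob b : cmod b < 1 -> disc_automorphism (mob b).
Proof.
move=> b1; have nb1 : cmod (- b) < 1 by rewrite cmodN.
split; first by move=> z /discE z1; apply: cdiff_derivable (mob_diff b1 z1).
split; first by move=> z /discE z1; apply/discE; exact: mob_disc.
exists (mob (- b)); split.
- by move=> z /discE z1; apply: cdiff_derivable (mob_diff nb1 z1).
- by move=> z /discE z1; apply/discE; exact: mob_disc.
- by move=> z /discE z1; exact: mobK.
- by move=> z /discE z1; rewrite -{1}[b]opprK mobK.
Qed.

(** Cauchy's estimate: [l] is the first Taylor coefficient, hence at most [1 / r] in modulus for
    each [r < 1], and [r] is picked with [1 / r = 1 + e]. *)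
Lemma schwarz0 f l : holo 1 f -> (forall z, cmod z < 1 -> cmod (f z) <= 1) ->
  cdiff f 0 l -> cmod l <= 1.
Proof.
move=> hf f1 fl; apply/ler_addgt0Pl => e e0.
have [df fd] := holoP hf.
pose r := (1 + e)^-1.
have e1 : 0 < 1 + e by rewrite addr_gt0.
have r0 : 0 < r by rewrite invr_gt0.
have r1 : r < 1 by rewrite invf_lt1// ltrDl.
have [M M0 [b1 b2]] := taylor_bound fd r0 r1.
have -> : l = taylor f r 1.
  apply: cdiff_unique fl _; apply: (@cdiff_sq _ _ _ _ (M * r ^- 2 * 2) (r / 2)); first by rewrite divr_gt0.
  move=> h hr; have h2 : cmod h < r by rewrite (lt_trans hr)// ltr_pdivrMr// ltr_pMr// ltr1n.
  have f0 : f 0 = taylor f r 0.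
    have := b2 0 1; rewrite cmod0 => /(_ r0); rewrite big_ord1 mul0r expr1 mulr0 mul0r.
    by move=> H; apply/eqP; rewrite -subr_eq0 -cmod_eq0 eq_le cmod_ge0 andbT expr0 mulr1 in H *.
  have := b2 h 2 h2; rewrite add0r f0 !big_ord_recl big_ord0 expr0 expr1 mulr1 addr0 opprD addrA.
  move/le_trans; apply.
  have K : r / (r - cmod h) <= 2 by rewrite ler_pdivrMr ?subr_gt0//; lra.
  rewrite [X in _ <= X](_ : _ = M * (cmod h / r) ^+ 2 * 2); last first.
    by rewrite expr_div_n [LHS]mulrAC; congr (_ * _); rewrite mulrAC -mulrA.
  by apply: ler_wpM2l K; rewrite mulr_ge0// sqr_ge0.
apply: le_trans (cmean_le (M := 1 + e) r0 _ _) _; last by rewrite addrC.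
  apply: circ_contM; first exact: (holo_circ fd).
  by apply: circ_contV => // [w wr|]; [rewrite expf_neq0// (circ_neq0 r0)|apply: circ_contX; exact: circ_cont_id].
move=> w wr; rewrite cmodM cmodV cmodX wr expr1 /r invrK ler_piMl ?(ltW e1)//.
by apply: f1; rewrite wr.
Qed.

(** Moebius maps before and after [f] move [z] and [f z] to 0, where [schwarz0] applies; their
    derivatives there supply the two factors [1 - cmod _ ^+ 2]. *)
Lemma schwarz_pick f z l : holo 1 f -> (forall z, cmod z < 1 -> cmod (f z) < 1) ->
  cmod z < 1 -> cdiff f z l -> cmod l * (1 - cmod z ^+ 2) <= 1 - cmod (f z) ^+ 2.
Proof.
move=> hf f1 z1 fl; have nz1 : cmod (- z) < 1 by rewrite cmodN.
have fz1 := f1 z z1; set b := f z in fz1 *.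
have c0 : cmod (0 : R[i]) < 1 by rewrite cmod0.
have m0 : mob (- z) 0 = z by rewrite /mob mulr0 subr0 divr1 sub0r opprK.
have dz := mob_diff nz1 c0.
have df : cdiff f (mob (- z) 0) l by rewrite m0.
have db : cdiff (mob b) (f (mob (- z) 0)) ((1 - b * b^*) / (1 - b^* * b) ^+ 2).
  by rewrite m0; exact: mob_diff.
have dg := cdiff_comp (cdiff_comp dz df) db.
have := schwarz0 (f := fun w => mob b (f (mob (- z) w))) _ _ dg.
have H : 0 < 1 - cmod b ^+ 2 by exact: one_sub_sqr_gt0.
have Hz : 0 < 1 - cmod z ^+ 2 by exact: one_sub_sqr_gt0.
rewrite mulr0 subr0 expr1n divr1 [b^* * b]mulrC !one_subJ cmodN cmodM cmodM cmodR (gtr0_norm Hz).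
rewrite -rmorphXn -fmorphV -rmorphM cmodR gtr0_norm ?divr_gt0 ?exprn_gt0//.
move=> H1; have {H1} : (1 - cmod b ^+ 2) / (1 - cmod b ^+ 2) ^+ 2 * (cmod l * (1 - cmod z ^+ 2)) <= 1.
  apply: H1 => [w w1|w w1].
    have [l1 d1] := hf _ (mob_disc nz1 w1).
    by eexists; apply: cdiff_comp (cdiff_comp (mob_diff nz1 w1) d1) (mob_diff fz1 (f1 _ (mob_disc nz1 w1))).
  by apply: ltW; apply: mob_disc => //; apply: f1; exact: mob_disc.
have -> : (1 - cmod b ^+ 2) / (1 - cmod b ^+ 2) ^+ 2 = (1 - cmod b ^+ 2)^-1.
  by rewrite expr2 invfM mulrA divff ?mul1r// gt_eqF.
by rewrite mulrC ler_pdivrMr// mul1r.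
Qed.

(** The mean value theorem on the segment from 0 to [w]. It needs a real-valued function, so it is
    applied through a 1-Lipschitz [p], namely the real and then the imaginary part. *)
Lemma cdiff0_cst rho f : (forall w, cmod w < rho -> cdiff f w 0) ->
  forall w, cmod w < rho -> f w = f 0.
Proof.
move=> fd w wrho.
have seg (t : R) : 0 <= t <= 1 -> cdiff (fun s => f (s * w)) t%:C 0.
  move=> /andP[t0 t1]; have tw : cmod (t%:C * w) < rho.
    by rewrite cmodM cmodR ger0_norm// (le_lt_trans _ wrho)// ler_piMl ?cmod_ge0.
  have := cdiff_comp (cdiffM (cdiff_id t%:C) (cdiff_cst w t%:C)) (fd _ tw).
  by rewrite mul0r.
have main (p : R[i] -> R) : (forall u v, `|p u - p v| <= cmod (u - v)) -> p (f w) = p (f 0).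
  move=> pL; pose u (t : R) := p (f (t%:C * w)).
  have du (t : R) : 0 <= t <= 1 -> is_derive t 1 u 0.
    move=> /seg H; apply: is_derive_eps => e /H[d d0 {}H]; exists d => // h hd.
    have := H h%:C; rewrite cmodR => /(_ hd); rewrite !mul0r !subr0; apply: le_trans.
    by rewrite -rmorphD; exact: pL.
  have [||c _] := @MVT_segment R u (fun=> 0) 0 1 ler01.
  - by move=> t; rewrite in_itv /= => /andP[/ltW t0 /ltW t1]; apply: du; rewrite t0.
  - apply: derivable_within_continuous => t; rewrite in_itv /= => /du D.
    exact: ex_derive.
  - by rewrite mul0r /u (_ : 0%:C = 0 :> R[i])// mul0r (_ : 1%:C = 1 :> R[i])// mul1r => /eqP; rewrite subr_eq0 => /eqP.
apply/eqP; rewrite eq_complex; apply/andP; split; apply/eqP.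
  by apply: (main (@complex.Re R)) => u v; apply: le_trans (Re_cmod _); case: u v => a b [c d].
by apply: (main (@complex.Im R)) => u v; apply: le_trans (Im_cmod _); case: u v => a b [c d].
Qed.

End moebius.

Section cdable.
Variable R : realType.
Implicit Types (f g : R[i] -> R[i]) (z w : R[i]).

Definition cdable f z := exists l, cdiff f z l.

Lemma cdable_cst c z : cdable (fun=> c) z. Proof. by exists 0; exact: cdiff_cst. Qed.
Lemma cdable_id z : cdable id z. Proof. by exists 1; exact: cdiff_id. Qed.
Lemma cdableD f g z : cdable f z -> cdable g z -> cdable (fun w => f w + g w) z.
Proof. by move=> [l fl] [m gm]; eexists; exact: cdiffD fl gm. Qed.
Lemma cdableB f g z : cdable f z -> cdable g z -> cdable (fun w => f w - g w) z.
Proof. by move=> [l fl] [m gm]; eexists; exact: cdiffB fl gm. Qed.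
Lemma cdableM f g z : cdable f z -> cdable g z -> cdable (fun w => f w * g w) z.
Proof. by move=> [l fl] [m gm]; eexists; exact: cdiffM fl gm. Qed.
Lemma cdableX n f z : cdable f z -> cdable (fun w => f w ^+ n) z.
Proof. by move=> [l fl]; eexists; exact: cdiffXf fl. Qed.
Lemma cdable_div f g z : g z != 0 -> cdable f z -> cdable g z -> cdable (fun w => f w / g w) z.
Proof. by move=> gz [l fl] [m gm]; eexists; exact: cdiff_div gz fl gm. Qed.
Lemma cdable_comp f g z : cdable f z -> cdable g (f z) -> cdable (fun w => g (f w)) z.
Proof. by move=> [l fl] [m gm]; eexists; exact: cdiff_comp fl gm. Qed.
Lemma cdable_sum n (F : 'I_n -> R[i] -> R[i]) z : (forall i, cdable (F i) z) ->
  cdable (fun w => \sum_(i < n) F i w) z.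
Proof.
by move=> /choice[L FL]; exists (\sum_(i < n) L i); exact: cdiff_sum.
Qed.

(** The derivative appears as value times logarithmic derivative, the form in which a product
    becomes a sum in [cdiff_log_prod]. *)
Lemma cdiff_logX f z l k : f z != 0 -> cdiff f z l ->
  cdiff (fun w => f w ^+ k) z (f z ^+ k * (k%:R * l / f z)).
Proof.
move=> f0 fl; have := cdiffXf k fl; congr cdiff.
by case: k => [|k]; rewrite ?mul0r ?mulr0// exprS /=; field.
Qed.

Lemma cdiff_log_prod (I : Type) (r : seq I) (p : I -> R[i] -> R[i]) (l : I -> R[i]) z :
  (forall i, cdiff (p i) z (p i z * l i)) ->
  cdiff (fun w => \prod_(i <- r) p i w) z ((\prod_(i <- r) p i z) * \sum_(i <- r) l i).
Proof.
move=> pl; elim: r => [|i r IH].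
  rewrite (_ : (fun w => _) = fun=> 1); last by apply/funext => w; rewrite big_nil.
  by rewrite !big_nil mulr0; exact: cdiff_cst.
rewrite (_ : (fun w => _) = fun w => p i w * \prod_(j <- r) p j w); last first.
  by apply/funext => w; rewrite big_cons.
have := cdiffM (pl i) IH; rewrite !big_cons; congr cdiff; ring.
Qed.

End cdable.

(** * Polarization and the product identity *)

Section polarization.
Variable R : realType.
Implicit Types (z w x y : R[i]).

Lemma holo_zero_real rho (f : R[i] -> R[i]) : holo rho f ->
  (forall t : R, 0 < t -> t < rho -> f t%:C = 0) -> forall z, cmod z < rho -> f z = 0.
Proof.
move=> hf f0 z zr; have r0 : 0 < rho by apply: le_lt_trans zr; exact: cmod_ge0.
apply: (holo_zero hf) zr => e e0; pose t := Num.min (e / 2) (rho / 2).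
have t0 : 0 < t by rewrite lt_min !divr_gt0.
have te : t < e by rewrite gt_min ltr_pdivrMr// ltr_pMr// ltr1n.
have tr : t < rho by rewrite gt_min [X in _ || X]ltr_pdivrMr// ltr_pMr// ltr1n// orbT.
by exists t%:C; rewrite cmodR gtr0_norm// f0.
Qed.

(** The identity theorem is used in one variable at a time, the other being first real and then
    arbitrary. *)
Lemma holo_zero2_real rho (E : R[i] -> R[i] -> R[i]) :
  (forall y, cmod y < rho -> holo rho (E ^~ y)) -> (forall x, cmod x < rho -> holo rho (E x)) ->
  (forall s t : R, 0 < s -> s < rho -> 0 < t -> t < rho -> E s%:C t%:C = 0) ->
  forall x y, cmod x < rho -> cmod y < rho -> E x y = 0.
Proof.
move=> h1 h2 E0 x y xr yr; apply: (holo_zero_real (h2 x xr)) yr => t t0 tr.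
have tr' : cmod t%:C < rho by rewrite cmodR gtr0_norm.
by apply: (holo_zero_real (h1 _ tr')) xr => s s0 sr; exact: E0.
Qed.

Variables (n a : nat) (e : 'I_n -> nat) (F dF : 'I_n -> R[i] -> R[i]).

(** The isometry equation after division by the factor 2 common to all the metrics; [a] and [e i]
    stand for the degrees increased by one. *)
Definition isom := forall z, cmod z < 1 ->
  a%:R / (1 - z * z^*) ^+ 2 =
  \sum_(i < n) (e i)%:R * (dF i z * (dF i z)^*) / (1 - F i z * (F i z)^*) ^+ 2.

Hypothesis FdF : forall i z, cmod z < 1 -> cdiff (F i) z (dF i z).
Hypothesis F1 : forall i z, cmod z < 1 -> cmod (F i z) < 1.
Hypothesis F0 : forall i, F i 0 = 0.
Hypothesis Fisom : isom.

Let G i w := (F i w^*)^*.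
Let dG i w := (dF i w^*)^*.

Let GdG i w : cmod w < 1 -> cdiff (G i) w (dG i w).
Proof. by move=> w1; apply: cdiff_conj; apply: FdF; rewrite cmodJ. Qed.

Let FG i z w : cmod z < 1 -> cmod w < 1 -> 1 - F i z * G i w != 0.
Proof. by move=> z1 w1; rewrite one_sub_neq0 ?F1// cmodJ F1// cmodJ. Qed.

Let H z w := a%:R / (1 - z * w) ^+ 2 -
  \sum_(i < n) (e i)%:R * (dF i z * dG i w) / (1 - F i z * G i w) ^+ 2.

Let cd_H f g x : cdable f x -> cdable g x -> cmod (f x) < 1 -> cmod (g x) < 1 ->
  cdable (fun x => H (f x) (g x)) x.
Proof.
move=> cf cg f1 g1.
have cdF i w : cmod w < 1 -> cdable (dF i) w by move=> w1; exact: (holo_deriv (@FdF i)).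
have cdG i w : cmod w < 1 -> cdable (dG i) w.
  move=> w1; have [|l dl] := cdF i w^*; first by rewrite cmodJ.
  by exists l^*; exact: cdiff_conj.
have cF i w : cmod w < 1 -> cdable (F i) w by move=> w1; exists (dF i w); exact: FdF.
have cG i w : cmod w < 1 -> cdable (G i) w by move=> w1; exists (dG i w); exact: GdG.
apply: cdableB.
  apply: cdable_div; first by rewrite expf_neq0// one_sub_neq0.
    exact: cdable_cst.
  by apply: cdableX; apply: cdableB; [exact: cdable_cst|exact: cdableM].
apply: cdable_sum => i; apply: cdable_div; first by rewrite expf_neq0// FG.
  apply: cdableM; first exact: cdable_cst.
  by apply: cdableM; [exact: (cdable_comp cf (cdF _ _ f1))|exact: (cdable_comp cg (cdG _ _ g1))].
apply: cdableX; apply: cdableB; first exact: cdable_cst.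
by apply: cdableM; [exact: (cdable_comp cf (cF _ _ f1))|exact: (cdable_comp cg (cG _ _ g1))].
Qed.

(* [H (x + iy) (x - iy)] is holomorphic in [x] and in [y] and vanishes for real
   [x], [y], where the second argument is conjugate to the first. *)
Lemma polarization z w : cmod z < 2^-1 -> cmod w < 2^-1 -> H z w = 0.
Proof.
move=> z2 w2; pose E x y := H (x + 'i%C * y) (x - 'i%C * y).
have ci (u : R[i]) : cmod ('i%C * u) = cmod u by rewrite cmodM cmod_i mul1r.
(* Radius 1/2 for [x] and [y] keeps both arguments of [H] in the unit disc, where the [F i] are
   controlled. *)
have bnd x y : cmod x < 2^-1 -> cmod y < 2^-1 -> cmod (x + 'i%C * y) < 1 /\ cmod (x - 'i%C * y) < 1.
  by move=> x2 y2; have := cmodD x ('i%C * y); have := cmodB x ('i%C * y); rewrite ci; split; lra.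
have i2 : 'i%C * 'i%C = -1 :> R[i] by rewrite -[X in _ = X](mulCii R[i]).
have E0 : forall x y, cmod x < 2^-1 -> cmod y < 2^-1 -> E x y = 0.
  apply: holo_zero2_real => [y y2 x x2|x x2 y y2|s t s0 s2 t0 t2].
  - have [b1 b2] := bnd x y x2 y2; apply: cd_H => //.
      by apply: cdableD; [exact: cdable_id|exact: cdable_cst].
    by apply: cdableB; [exact: cdable_id|exact: cdable_cst].
  - have [b1 b2] := bnd x y x2 y2; apply: cd_H => //.
      by apply: cdableD; [exact: cdable_cst|apply: cdableM; [exact: cdable_cst|exact: cdable_id]].
    by apply: cdableB; [exact: cdable_cst|apply: cdableM; [exact: cdable_cst|exact: cdable_id]].
  - have [||b1 _] := bnd s%:C t%:C; rewrite ?cmodR ?gtr0_norm//.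
    have J : s%:C - 'i%C * t%:C = (s%:C + 'i%C * t%:C)^*.
      by rewrite cconjD cconjM !cconjR conjc_i mulNr.
    rewrite /E J /H; apply/eqP; rewrite subr_eq0 Fisom//; apply/eqP; apply: eq_bigr => i _.
    by rewrite /G /dG conjcK.
have zE : z = (z + w) / 2 + 'i%C * (- 'i%C * (z - w) / 2) by field: i2.
have wE : w = (z + w) / 2 - 'i%C * (- 'i%C * (z - w) / 2) by field: i2.
have := E0 ((z + w) / 2) (- 'i%C * (z - w) / 2); rewrite /E -zE -wE; apply.
  rewrite cmodM cmodV -[2]/(2%:R) -(rmorph_nat (real_complex R)) cmodR ger0_norm// ltr_pdivrMr//.
  by apply: le_lt_trans (cmodD _ _) _; lra.
rewrite !cmodM cmodN cmod_i mul1r cmodV -(rmorph_nat (real_complex R)) cmodR ger0_norm// ltr_pdivrMr//.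
by apply: le_lt_trans (cmodB _ _) _; lra.
Qed.

(* [L] is the difference of the logarithmic derivatives in [z] of the two sides; its
   derivative in [w] is [- H]. *)
Theorem prod_identity z w : cmod z < 2^-1 -> cmod w < 2^-1 ->
  \prod_(i < n) (1 - F i z * (F i w^*)^*) ^+ e i = (1 - z * w) ^+ a.
Proof.
have lt2 u : cmod u < 2^-1 -> cmod u < 1 :> R.
  by move=> /lt_trans; apply; rewrite invf_lt1// ltr1n.
pose L z w := \sum_(i < n) (e i)%:R * (dF i z * G i w / (1 - F i z * G i w)) - a%:R * (w / (1 - z * w)).
have L0 u v : cmod u < 2^-1 -> cmod v < 2^-1 -> L u v = 0.
  move=> u2 v2; have -> : L u v = L u 0.
    apply: (cdiff0_cst (rho := 2^-1) (f := L u)) v2 => x x2.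
    rewrite -[X in cdiff _ _ X]oppr0 -(polarization u2 x2) /H opprB.
    apply: cdiffB; first apply: cdiff_sum => i.
      rewrite -mulrA; apply: cdiffZ.
      have h1 := cdiffZ (dF i u) (GdG i (lt2 _ x2)).
      have h2 := cdiffB (cdiff_cst 1 x) (cdiffZ (F i u) (GdG i (lt2 _ x2))).
      have := cdiff_div (g := fun w => 1 - F i u * G i w) (FG i (lt2 _ u2) (lt2 _ x2)) h1 h2.
      by congr (cdiff _ _ (_ / _)); ring.
    apply: cdiffZ.
    have n0 : 1 - u * x != 0 by rewrite one_sub_neq0 ?lt2.
    have h2 := cdiffB (cdiff_cst 1 x) (cdiffZ u (cdiff_id x)).
    have := cdiff_div (g := fun w => 1 - u * w) n0 (cdiff_id x) h2.
    by rewrite -[in X in _ -> X]div1r; congr (cdiff _ _ (_ / _)); ring.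
  rewrite /L mul0r mulr0 subr0 big1// => i _.
  by rewrite /G cconj0 F0 cconj0 mulr0 mul0r mulr0.
move=> z2 w2.
pose P x := \prod_(i < n) (1 - F i x * G i w) ^+ e i; pose Q x := (1 - x * w) ^+ a.
have Q0 x : cmod x < 2^-1 -> Q x != 0 by move=> x2; rewrite expf_neq0// one_sub_neq0 ?lt2.
(* The logarithmic derivative of [P / Q] in [x] is [- L x w], which vanishes, and the quotient is 1
   at 0 because every [F i 0] is 0. *)
suff PQ : P z / Q z = P 0 / Q 0.
  have P01 : P 0 = 1 by rewrite /P big1// => i _; rewrite F0 mul0r subr0 expr1n.
  have Q01 : Q 0 = 1 by rewrite /Q mul0r subr0 expr1n.
  by rewrite -[LHS](divfK (Q0 _ z2)) PQ P01 Q01 divr1 mul1r.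
apply: (cdiff0_cst (rho := 2^-1) (f := fun x => P x / Q x)) z2 => x x2.
have xw : 1 - x * w != 0 by rewrite one_sub_neq0 ?lt2.
have dP : cdiff P x (P x * \sum_(i < n) - ((e i)%:R * (dF i x * G i w / (1 - F i x * G i w)))).
  apply: cdiff_log_prod => i.
  have h := cdiffB (cdiff_cst 1 x) (cdiffM (FdF i (lt2 _ x2)) (cdiff_cst (G i w) x)).
  have := cdiff_logX (f := fun x => 1 - F i x * G i w) (e i) (FG i (lt2 _ x2) (lt2 _ w2)) h.
  by congr (cdiff _ _ (_ * _)); ring.
have dQ : cdiff Q x (Q x * - (a%:R * (w / (1 - x * w)))).
  have h := cdiffB (cdiff_cst 1 x) (cdiffM (cdiff_id x) (cdiff_cst w x)).
  have := cdiff_logX (f := fun x => 1 - x * w) a xw h.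
  by congr (cdiff _ _ (_ * _)); ring.
have := cdiff_div (Q0 _ x2) dP dQ; congr cdiff.
rewrite [X in X / _](_ : _ = P x * Q x * (- L x w)); first by rewrite L0// oppr0 mulr0 mul0r.
by rewrite /L sumrN; ring.
Qed.

End polarization.

(** * The inequality between the degrees and its equality case *)

Section isometries.
Variable R : realType.
Implicit Types (z w b : R[i]).

Lemma isom_mob n a (e : 'I_n -> nat) (f df : 'I_n -> R[i] -> R[i]) (b : 'I_n -> R[i]) :
  (forall i, cmod (b i) < 1) -> (forall i z, cmod z < 1 -> cmod (f i z) < 1) ->
  isom a e f df ->
  isom a e (fun i z => mob (b i) (f i z))
    (fun i z => (1 - b i * (b i)^*) / (1 - (b i)^* * f i z) ^+ 2 * df i z).
Proof.
move=> b1 f1 fi z z1; rewrite fi//; apply: eq_bigr => i _.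
have fz := f1 i z z1; rewrite mob_idE// cconjM cconjM cconjV cconjX !cconjB cconj1 !cconjM !conjcK.
have h1 := mob_den (b1 i) fz.
have h2 : 1 - b i * (f i z)^* != 0 by rewrite one_sub_neq0// cmodJ.
have h3 : 1 - b i * (b i)^* != 0 by rewrite one_sub_neq0// cmodJ.
have h4 : 1 - f i z * (f i z)^* != 0 by rewrite one_sub_neq0// cmodJ.
move: (b i) (b i)^* (f i z) (f i z)^* (df i z) (df i z)^* h1 h2 h3 h4 => x x' y y' u u' h1 h2 h3 h4.
by rewrite [x' * x]mulrC; field; rewrite h1 h2 h3 h4.
Qed.

Section one.
Variables (n a : nat) (e : 'I_n -> nat) (f df : 'I_n -> R[i] -> R[i]).
Hypothesis fd : forall i z, cmod z < 1 -> cdiff (f i) z (df i z).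
Hypothesis f1 : forall i z, cmod z < 1 -> cmod (f i z) < 1.
Hypothesis fi : isom a e f df.

(** The factor by which [f i] stretches Poincare length at [z]; Schwarz-Pick is [s_le1], and the
    isometry equation becomes [s_sum]. *)
Let s i z : R := cmod (df i z) * (1 - cmod z ^+ 2) / (1 - cmod (f i z) ^+ 2).

Let s_ge0 i z : cmod z < 1 -> 0 <= s i z.
Proof.
move=> z1; have h1 := one_sub_sqr_gt0 z1; have h2 := one_sub_sqr_gt0 (f1 i z1).
by rewrite divr_ge0 ?mulr_ge0 ?cmod_ge0 ?ltW.
Qed.

Let s_le1 i z : cmod z < 1 -> s i z <= 1.
Proof.
move=> z1; have h2 := one_sub_sqr_gt0 (f1 i z1); rewrite ler_pdivrMr// mul1r.
by apply: (schwarz_pick _ _ z1 (fd i z1)) => w w1; [exists (df i w); exact: fd|exact: f1].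
Qed.

Let s_sum z : cmod z < 1 -> a%:R = \sum_(i < n) (e i)%:R * s i z ^+ 2.
Proof.
move=> z1; apply: complexI; have h1 := one_sub_sqr_gt0 z1.
have n1 : 1 - z * z^* != 0 by rewrite one_sub_neq0// cmodJ.
rewrite (rmorph_nat (real_complex R)) -[LHS](divfK (expf_neq0 2 n1)) fi// mulr_suml.
rewrite (rmorph_sum (real_complex R)); apply: eq_bigr => i _ /=.
rewrite mulcJ !one_subJ -!(rmorphXn (real_complex R)) -(fmorphV (real_complex R)).
rewrite -(rmorph_nat (real_complex R)) -!(rmorphM (real_complex R)) /=; congr (_%:C).
by rewrite /s expr_div_n exprMn; ring.
Qed.

Lemma isom_leq : (a <= \sum_(i < n) e i)%N.
Proof.
have c0 : cmod (0 : R[i]) < 1 by rewrite cmod0.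
rewrite -(ler_nat R) (s_sum c0) natr_sum; apply: ler_sum => i _.
by rewrite ler_piMr// exprn_ile1 ?s_ge0 ?s_le1.
Qed.

(** The squares of the [s j z] are at most 1 and their sum with the positive weights [e j] is the
    sum of the weights, so all of them are 1 at every [z]. The conclusion is put as an isometry into
    one disc so that [prod_identity] can be applied to it. *)
Lemma isom_eq i : (forall i, (0 < e i)%N) -> a = (\sum_(i < n) e i)%N ->
  isom (n := 1) 1 (fun=> 1%N) (fun=> f i) (fun=> df i).
Proof.
move=> e0 ae z z1; rewrite big_ord1 mul1r.
have s1 : s i z ^+ 2 = 1.
  have le j : s j z ^+ 2 <= 1 by rewrite exprn_ile1 ?s_ge0 ?s_le1.
  have S0 : \sum_(j < n) (e j)%:R * (1 - s j z ^+ 2) = 0.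
    under eq_bigr do rewrite mulrBr mulr1.
    by rewrite sumrB -s_sum// ae natr_sum subrr.
  have /psumr_eq0P := S0; rewrite /= => S1.
  have /S1 : forall j, true -> 0 <= (e j)%:R * (1 - s j z ^+ 2) by move=> j _; rewrite mulr_ge0// subr_ge0.
  move=> /(_ i isT) /eqP; rewrite mulf_eq0 pnatr_eq0 -[e i == 0%N]negbK -lt0n e0 /= subr_eq0.
  by move=> /eqP.
have h1 := one_sub_sqr_gt0 z1; have h2 := one_sub_sqr_gt0 (f1 i z1).
rewrite !one_subJ mulcJ -!(rmorphXn (real_complex R)) -!(fmorphV (real_complex R)).
rewrite mul1r -(rmorphM (real_complex R)) /=; congr (_%:C).
have h3 : (1 - cmod z ^+ 2) ^+ 2 != 0 by rewrite expf_neq0// gt_eqF.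
apply: (mulfI h3); rewrite divff//.
rewrite -[LHS]s1 /s expr_div_n exprMn [RHS]mulrA; congr (_ / _); exact: mulrC.
Qed.

End one.

(** For a single factor with exponents 1 the product identity says that [f z] times the conjugate of
    [f w^*] is [z * w]. Freezing [w] at a nonzero real [c] makes [f] linear near 0, the choice
    [z = w = c] makes the slope unimodular, and the identity theorem extends the formula to the
    disc. *)
Lemma isom1_rot (f df : R[i] -> R[i]) :
  (forall z, cmod z < 1 -> cdiff f z (df z)) -> (forall z, cmod z < 1 -> cmod (f z) < 1) ->
  f 0 = 0 -> isom (n := 1) 1 (fun=> 1%N) (fun=> f) (fun=> df) ->
  exists2 al, cmod al = 1 & forall z, cmod z < 1 -> f z = al * z.
Proof.
move=> fd f1 f0 fi.
have fg z w : cmod z < 2^-1 -> cmod w < 2^-1 -> f z * (f w^*)^* = z * w.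
  move=> z2 w2; have := @prod_identity R 1 1 (fun=> 1%N) (fun=> f) (fun=> df)
    (fun=> fd) (fun=> f1) (fun=> f0) fi z w z2 w2.
  by rewrite big_ord1 !expr1 => /addrI/oppr_inj.
pose c : R[i] := (4^-1 : R)%:C.
have c2 : cmod c < 2^-1 by rewrite cmodR gtr0_norm ?invr_gt0// ltf_pV2 ?posrE// ltr_nat.
have c0 : c != 0 by rewrite -cmod_gt0 cmodR normr_gt0 invr_eq0 pnatr_eq0.
have cJ : c^* = c by exact: cconjR.
have fc : f c * (f c)^* = c * c by rewrite -{2}cJ fg.
have fc0 : (f c)^* != 0.
  by apply/eqP => E; move: fc; rewrite E mulr0 => /esym/eqP; rewrite mulf_eq0 (negPf c0).
pose al := c / (f c)^*.
have fz z : cmod z < 2^-1 -> f z = al * z.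
  move=> z2; have := fg z c z2 c2; rewrite cJ => E.
  by rewrite /al mulrAC [c * z]mulrC -E mulfK.
exists al.
  apply: (@pexpIrn _ 2) => //; rewrite ?nnegrE ?cmod_ge0//.
  apply: complexI; rewrite -mulcJ expr1n.
  move: fc; rewrite fz// cconjM cJ mulrACA => /(canRL (mulfK (mulf_neq0 c0 c0))) ->.
  by rewrite divff// mulf_neq0.
move=> z z1; apply/eqP; rewrite -subr_eq0; apply/eqP.
apply: (holo_zero (rho := 1) (f := fun z => f z - al * z)) z1 => [w w1|d d0].
  by exists (df w - al * 1); apply: cdiffB; [exact: fd|apply: cdiffZ; exact: cdiff_id].
pose t := Num.min (d / 2) 4^-1.
have t0 : 0 < t by rewrite lt_min divr_gt0// invr_gt0 ltr0n.
exists t%:C; rewrite cmodR gtr0_norm//; split => //.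
  by rewrite gt_min ltr_pdivrMr// ltr_pMr// ltr1n.
rewrite fz ?subrr// cmodR gtr0_norm// gt_min [X in _ || X]ltf_pV2 ?posrE// ltr_nat orbT//.
Qed.

End isometries.

(** * Points of ideals over an uncountable field *)

Section amitsur.
Variables (K : fieldType) (A : comAlgType K) (b : nat -> A).
Hypothesis b_span : forall x, exists N (c : nat -> K), x = \sum_(k < N) c k *: b k.
Implicit Types (J : A -> Prop) (x y : A) (c : K) (q : {poly K}).

Definition is_ideal J := [/\ J 0, forall x y, J x -> J y -> J (x + y) & forall x y, J y -> J (x * y)].

Lemma infinite_uniq (T : choiceType) (U : set T) n : infinite_set U ->
  exists s : seq T, [/\ uniq s, size s = n & {in s, forall z, U z}].
Proof.
move=> iU; elim: n => [|n [s [us ss sU]]]; first by exists [::].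
have [x [Ux xs]] : exists z, U z /\ z \notin s.
  apply: contrapT => H; apply: iU; apply: (@sub_finite_set _ _ [set` s]); last exact: finite_seq.
  by move=> z Uz; apply: contrapT => /negP zs; apply: H; exists z.
exists (x :: s); split; rewrite /= ?xs ?ss// => z; rewrite inE => /orP[/eqP ->//|]; exact: sU.
Qed.

Lemma idealN J x : is_ideal J -> J x -> J (- x).
Proof. by move=> [_ _ JM] Jx; rewrite -mulN1r; exact: JM. Qed.

Lemma idealB J x y : is_ideal J -> J x -> J y -> J (x - y).
Proof. by move=> iJ Jx Jy; have [_ JD _] := iJ; apply: JD => //; exact: idealN. Qed.

Lemma ideal_sum J n (F : 'I_n -> A) : is_ideal J -> (forall k, J (F k)) -> J (\sum_(k < n) F k).
Proof. by move=> [J0 JD _] JF; elim/big_ind : _ => // k _; exact: JF. Qed.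

(* For uncountably many [c] the inverses of [y - c] modulo [J] exist and lie in one
   finite-dimensional span; clearing denominators in a linear relation between them
   gives [q]. *)
Lemma amitsur J y (U : set K) : is_ideal J -> ~ countable U ->
  (forall c, U c -> exists v, J ((y - c%:A) * v - 1)) -> exists2 q, q != 0 & J (horner_alg y q).
Proof.
move=> iJ ncU inv.
have /choice[v vP] : forall c, exists v, U c -> J ((y - c%:A) * v - 1).
  by move=> c; have [/inv[v vJ]|nUc] := pselect (U c); [exists v|exists 0].
have /choice[N NP] : forall c, exists N, exists co : nat -> K, v c = \sum_(k < N) co k *: b k.
  by move=> c; exact: b_span.
have /choice[co coP] := NP.
(* An uncountable set cannot be a countable union of finite ones, so one bound [n] on the length of
   the combinations serves infinitely many [c]. *)
have [n iU] : exists n, infinite_set [set c | U c /\ (N c <= n)%N].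
  apply: contrapT => H; apply: ncU.
  apply: (@sub_countable _ _ _ (\bigcup_n [set c | U c /\ (N c <= n)%N])).
    by apply: subset_card_le => c Uc; exists (N c).
  apply: bigcup_countable => // n _; apply: finite_set_countable.
  by apply: contrapT => iU; apply: H; exists n.
have [s [us ss sU]] := infinite_uniq n.+1 iU.
pose t (k : 'I_n.+1) := s`_k.
have tU k : U (t k) /\ (N (t k) <= n)%N by apply: sU; rewrite mem_nth// ss.
have tinj k l : t k = t l -> k = l.
  by move=> /eqP; rewrite nth_uniq ?ss// => /eqP/val_inj.
pose M : 'M[K]_(n.+1, n) := \matrix_(k, j) (if (j < N (t k))%N then co (t k) j else 0).
have vE k : v (t k) = \sum_(j < n) M k j *: b j.
  rewrite coP (big_ord_widen n (fun j => co (t k) j *: b j)); last by case: (tU k).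
  rewrite big_mkcond; apply: eq_bigr => j _; rewrite mxE.
  by case: ifP => // _; rewrite scale0r.
(* [n.+1] vectors in the span of [n] elements are linearly dependent. *)
have /rowV0Pn[u /sub_kermxP uM u0] : kermx M != 0.
  by rewrite -mxrank_eq0 mxrank_ker subn_eq0 -ltnNge ltnS rank_leq_col.
have uv : \sum_k u 0 k *: v (t k) = 0.
  under eq_bigr do rewrite vE scaler_sumr.
  rewrite exchange_big big1//= => j _; under eq_bigr do rewrite scalerA.
  have E : \sum_k u 0 k * M k j = 0 by have := congr1 (fun B : 'rV_n => B 0 j) uM; rewrite !mxE.
  by rewrite -scaler_suml E scale0r.
(* The relation [uv] with [v (t k)] read as the inverse of ['X - t k], cleared of denominators. At
   [t k0] only the summand [k0] survives, hence [q] is nonzero. *)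
pose q := \sum_k u 0 k *: \prod_(l | l != k) ('X - (t l)%:P).
have [k0 uk0] : exists k, u 0 k != 0.
  apply: contrapT => H; move/eqP: u0; apply; apply/rowP => k; rewrite mxE.
  by apply: contrapT => /eqP uk; apply: H; exists k.
have hX c : horner_alg y ('X - c%:P) = y - c%:A.
  by rewrite rmorphB /= horner_algX horner_algC.
exists q.
  apply/eqP => /(congr1 (horner^~ (t k0))); rewrite horner0 horner_sum (bigD1 k0)//=.
  rewrite [X in _ + X]big1 ?addr0 => [|k kk0].
    rewrite hornerZ horner_prod => /eqP; rewrite mulf_eq0 (negPf uk0) /= prodf_seq_eq0.
    move=> /hasP[l _ /andP[lk]]; rewrite hornerXsubC subr_eq0 => /eqP/tinj kl.
    by rewrite kl eqxx in lk.
  rewrite hornerZ horner_prod (bigD1 k0) 1?eq_sym//= hornerXsubC subrr mul0r mulr0//.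
have -> : horner_alg y q = \sum_k (u 0 k)%:A * (\prod_(l | l != k) (y - (t l)%:A)).
  rewrite /q rmorph_sum; apply: eq_bigr => k _; rewrite -mul_polyC (rmorphM (horner_alg y)) /= horner_algC; congr (_ * _).
  by rewrite rmorph_prod; apply: eq_bigr => l _; exact: hX.
have E0 : \prod_l (y - (t l)%:A) * (\sum_k u 0 k *: v (t k)) = 0 by rewrite uv mulr0.
rewrite -[X in J X]subr0 -[X in J (_ - X)]E0 mulr_sumr -sumrB.
apply: ideal_sum => // k; have [_ _ JM] := iJ.
have -> : \prod_l (y - (t l)%:A) = (y - (t k)%:A) * \prod_(l | l != k) (y - (t l)%:A) by rewrite (bigD1 k).
have -> : u 0 k *: v (t k) = (u 0 k)%:A * v (t k) by rewrite mulr_algl.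
rewrite (_ : _ - _ = (- ((u 0 k)%:A * \prod_(l | l != k) (y - (t l)%:A))) * ((y - (t k)%:A) * v (t k) - 1)).
  by apply: JM; apply: vP; case: (tU k).
by ring.
Qed.

Definition adjoin J y c x := exists u v, J u /\ x = u + (y - c%:A) * v.

Lemma adjoin_ideal J y c : is_ideal J -> is_ideal (adjoin J y c).
Proof.
move=> [J0 JD JM]; split.
- by exists 0, 0; split => //; rewrite mulr0 addr0.
- move=> _ _ [u [v [Ju ->]]] [u' [v' [Ju' ->]]]; exists (u + u'), (v + v').
  by split; [exact: JD|ring].
- move=> x _ [u [v [Ju ->]]]; exists (x * u), (x * v).
  by split; [exact: JM|ring].
Qed.

Lemma adjoin_sub J y c x : J x -> adjoin J y c x.
Proof. by move=> Jx; exists x, 0; rewrite mulr0 addr0. Qed.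

Lemma adjoin_gen J y c : is_ideal J -> adjoin J y c (y - c%:A).
Proof. by move=> [J0 _ _]; exists 0, 1; rewrite mulr1 add0r. Qed.

(** Were [y - c] invertible modulo [J] for every [c] in [U], [amitsur] would produce an algebraic
    equation for [y] modulo [J]. *)
Lemma adjoin_proper J y (U : set K) : is_ideal J -> ~ countable U ->
  (forall q, q != 0 -> ~ J (horner_alg y q)) -> exists2 c, U c & ~ adjoin J y c 1.
Proof.
move=> iJ ncU tr; apply: contrapT => H.
have [|q q0 Jq] := @amitsur J y U iJ ncU; last exact: tr Jq.
move=> c Uc; have [u [v [Ju E]]] : adjoin J y c 1.
  by apply: contrapT => nad; apply: H; exists c.
by exists v; rewrite [X in _ * _ - X]E opprD addrCA subrr addr0; exact: idealN.
Qed.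

End amitsur.

(** * The weak Nullstellensatz *)

Section nullstellensatz.
Variables (K : closedFieldType) (A : comAlgType K) (b : nat -> A).
Hypothesis b_span : forall x, exists N (c : nat -> K), x = \sum_(k < N) c k *: b k.
Hypothesis K_uncountable : ~ countable [set: K].
Implicit Types (J : A -> Prop) (x y : A) (c : K) (q : {poly K}).

(** Here [y] may be algebraic modulo [J]. Otherwise every [y - c] is invertible modulo [J]; the
    equation given by [amitsur] splits into such factors over a closed field, and cancelling them
    one by one puts 1 in [J]. *)
Lemma adjoin_proper_closed J y : is_ideal J -> ~ J 1 -> exists c, ~ adjoin J y c 1.
Proof.
move=> iJ nJ1; apply: contrapT => H; have [_ _ JM] := iJ.
have inv c : exists v, J ((y - c%:A) * v - 1).
  have [u [v [Ju E]]] : adjoin J y c 1 by apply: contrapT => nad; apply: H; exists c.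
  by exists v; rewrite [X in _ * _ - X]E opprD addrCA subrr addr0; exact: idealN.
have [q q0 Jq] := amitsur b_span (y := y) iJ K_uncountable (fun c _ => inv c).
have [r qE] := closed_field_poly_normal q.
have cancel c x : J ((y - c%:A) * x) -> J x.
  move=> Jx; have [v Jv] := inv c.
  rewrite (_ : x = v * ((y - c%:A) * x) - x * ((y - c%:A) * v - 1)); last by ring.
  by apply: idealB => //; exact: JM.
have hX c : horner_alg y ('X - c%:P) = y - c%:A.
  by rewrite rmorphB /= horner_algX horner_algC.
have Jp : J (\prod_(z <- r) (y - z%:A)).
  have -> : \prod_(z <- r) (y - z%:A) = ((lead_coef q)^-1)%:A * horner_alg y q.
    rewrite {2}qE -mul_polyC rmorphM /= horner_algC mulrA -!in_algE -rmorphM mulVf ?lead_coef_eq0//.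
    rewrite rmorph1 mul1r rmorph_prod.
    by apply: eq_bigr => z _; rewrite -hX.
  exact: JM.
apply: nJ1; elim: r {qE} Jp => [|z r IH]; first by rewrite big_nil.
by rewrite big_cons => /cancel.
Qed.

(** Elements are specialized one at a time, properness being kept at each stage; a finite list
    suffices, so no maximal ideal has to be chosen. *)
Lemma ideal_point J (ys : seq A) : is_ideal J -> ~ J 1 ->
  exists J', [/\ is_ideal J', ~ J' 1, forall x, J x -> J' x &
    {in ys, forall y, exists c, J' (y - c%:A)}].
Proof.
move=> iJ nJ1; elim: ys => [|y ys [J' [iJ' nJ'1 JJ' H]]]; first by exists J.
have [c nc] := adjoin_proper_closed y iJ' nJ'1.
exists (adjoin J' y c); split => //; first exact: adjoin_ideal.
  by move=> x /JJ'; exact: adjoin_sub.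
move=> z; rewrite inE => /orP[/eqP ->|/H[c' Jc']]; first by exists c; exact: adjoin_gen.
by exists c'; exact: adjoin_sub.
Qed.

End nullstellensatz.

(** * Points of ideals of polynomials *)

Section mpoly_points.
Import (canonicals, coercions) mathcomp.multinomials.mpoly.
Variables (K : closedFieldType) (N : nat).
Hypothesis K_uncountable : ~ countable [set: K].
Local Notation MP := (mpoly.mpoly N K).
Local Notation X_ i := (mpoly.mpolyX K (mpoly.mnm1 i)).

(** The monomials, enumerated by their codes, with 0 at numbers that encode none. *)
Let b (k : nat) : MP := if unpickle k is Some m then mpoly.mpolyX K m else 0.

Let b_span (P : MP) : exists n (c : nat -> K), P = \sum_(k < n) c k *: b k.
Proof.
elim/mpoly.mpolyind: P => [|c m P _ _ [n [c' PE]]].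
  by exists 0%N, (fun=> 0); rewrite big_ord0.
exists (maxn n (pickle m).+1), (fun k => (if (k < n)%N then c' k else 0) + (if k == pickle m then c else 0)).
under eq_bigr do rewrite scalerDl; rewrite big_split addrC; congr (_ + _); last first.
  have mn : (pickle m < maxn n (pickle m).+1)%N by rewrite leq_max ltnSn orbT.
  rewrite (bigD1 (Ordinal mn))//= eqxx big1 ?addr0 => [|k].
    by rewrite /b pickleK.
  by rewrite -val_eqE /= => /negPf ->; rewrite scale0r.
rewrite PE (big_ord_widen (maxn n (pickle m).+1) (fun k => c' k *: b k)) ?leq_maxl// big_mkcond.
by apply: eq_bigr => k _; case: ifP => // _; rewrite scale0r.
Qed.

(** Transcendence of [X_ i] modulo [I] allows its value to be prescribed in [U]; the other
    coordinates are then specialized to unspecified values by [ideal_point]. *)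
Theorem mpoly_point (I : MP -> Prop) (i : 'I_N) (U : set K) :
  is_ideal I -> ~ countable U -> (forall q : {poly K}, q != 0 -> ~ I (horner_alg (X_ i) q)) ->
  exists2 p : 'I_N -> K, U (p i) & forall P, I P -> mpoly.meval p P = 0.
Proof.
move=> iI ncU tr.
have [c Uc pc] := adjoin_proper b_span iI ncU tr.
have iJ1 := adjoin_ideal (X_ i) c iI.
have [J [iJ nJ1 J1J H]] := ideal_point b_span K_uncountable [seq X_ k | k <- enum 'I_N] iJ1 pc.
have /choice[p pP] : forall k, exists c, J (X_ k - c%:A).
  by move=> k; apply: H; apply/mapP; exists k; rewrite ?mem_enum.
have [J0 JD JM] := iJ.
have Jcst (u : K) : J u%:A -> u = 0.
  move=> Ju; apply: contrapT => /eqP u0; apply: nJ1.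
  have := JM (u^-1)%:A _ Ju; by rewrite mulr_algl scalerA mulVf// scale1r.
exists p.
  suff -> : p i = c by [].
  apply/eqP; rewrite -subr_eq0; apply/eqP; apply: Jcst.
  rewrite scalerBl (_ : _ - _ = (X_ i - c%:A) - (X_ i - (p i)%:A)); last by ring.
  by apply: idealB => //; apply: J1J; exact: adjoin_gen.
have Jmul x y u v : J (x - u%:A) -> J (y - v%:A) -> J (x * y - (u * v)%:A).
  move=> Jx Jy; rewrite -[(u * v)%:A]/((u * v) *: 1) -scalerA -[v *: 1]mulr_algl mulr1.
  rewrite -mulr_algl (_ : _ - _ = y * (x - u%:A) + u%:A * (y - v%:A)); last by ring.
  by apply: JD; exact: JM.
have JX k n : J (X_ k ^+ n - (p k ^+ n)%:A).
  elim: n => [|n IH]; first by rewrite !expr0 scale1r subrr.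
  by rewrite !exprS; exact: Jmul.
move=> P IP; apply: Jcst.
(* Modulo [J] each variable is congruent to its value, hence [P] is congruent to its value at [p];
   as [P] lies in [J], so does that value. *)
rewrite -[_%:A](subKr P); apply: idealB => //; first by apply: J1J; exact: adjoin_sub.
elim/mpoly.mpolyind: P {IP} => [|u m P _ _ IH]; first by rewrite rmorph0 scale0r subrr.
rewrite rmorphD /= mpoly.mevalZ mpoly.mevalX scalerDl.
rewrite (_ : _ - _ = (u *: mpoly.mpolyX K m - (u * \prod_(k < N) p k ^+ m k)%:A) + (P - (mpoly.meval p P)%:A)).
  apply: JD => //; rewrite -[u *: mpoly.mpolyX K m]mulr_algl; apply: (Jmul); first by rewrite subrr.
  rewrite mpoly.mpolyXE_id.
  elim/big_rec2 : _ => [|k x y _]; first by rewrite scale1r subrr.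
  by apply: Jmul; exact: JX.
by ring.
Qed.

End mpoly_points.

(** * Jets and multiplicities *)

Section multiplicities.

Lemma coef0_Xn (K : fieldType) (p : {poly K}) m : (forall k, (k < m)%N -> p`_k = 0) ->
  exists q, p = 'X^m * q.
Proof.
move=> p0; exists (drop_poly m p); rewrite mulrC -{1}(poly_take_drop m p).
rewrite (_ : take_poly m p = 0) ?add0r//; apply/polyP => k.
by rewrite coef_take_poly coef0; case: ifP => // /p0.
Qed.

Lemma Xn_mul_inj (K : fieldType) (p q : {poly K}) m l :
  p.[0] != 0 -> q.[0] != 0 -> 'X^m * p = 'X^l * q -> m = l.
Proof.
wlog ml : p q m l / (m <= l)%N.
  move=> H p0 q0 E; have [ml|/ltnW lm] := leqP m l; first exact: H p0 q0 E.
  by apply/esym; apply: H q0 p0 (esym E).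
move=> p0 q0 E; have {}E : p = 'X^(l - m) * q.
  apply: (@mulfI _ 'X^m); first by rewrite -size_poly_eq0 size_polyXn.
  by rewrite E mulrA -exprD subnKC.
apply/eqP; rewrite eqn_leq ml -subn_eq0 /=.
by move: p0; rewrite E hornerM hornerXn expr0n; case: (l - m)%N => // k; rewrite mul0r eqxx.
Qed.

(** The right side has order exactly [a] at 0 because [c] is nonzero, and orders of vanishing add up
    in a product. Positive exponents exclude a zero factor, so that each [T j] has an order. *)
Lemma prod_multiplicity (K : fieldType) n (e : 'I_n -> nat) (T : 'I_n -> {poly K}) a (c : K) (Q : {poly K}) :
  (forall j, (0 < e j)%N) -> c != 0 -> \prod_j T j ^+ e j = c%:P * 'X^a + 'X^(a.+1) * Q ->
  exists m : 'I_n -> nat, (\sum_j e j * m j)%N = a /\ forall j, (T j).[0] = 0 -> (0 < m j)%N.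
Proof.
move=> e0 c0 E.
pose B := c%:P + 'X * Q.
have B0 : B.[0] != 0 by rewrite hornerD hornerC hornerM hornerX mul0r addr0.
have {}E : \prod_j T j ^+ e j = 'X^a * B.
  by rewrite E /B mulrDr mulrA -exprSr mulrC.
have T0 j : T j != 0.
  apply/eqP => Tj; move: B0; rewrite (_ : B = 0) ?horner0 ?eqxx//.
  apply: (@mulfI _ 'X^a); first by rewrite -size_poly_eq0 size_polyXn.
  by rewrite mulr0 -E (bigD1 j)//= Tj expr0n eqn0Ngt e0 mul0r.
have /choice[m mP] : forall j, exists m, exists2 q : {poly K}, q.[0] != 0 & T j = q * 'X^m.
  move=> j; have [m [q rq TE]] := multiplicity_XsubC (T j) 0.
  by exists m, q; [move: rq; rewrite T0|rewrite TE subr0].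
have /choice[q qP] : forall j, exists q : {poly K}, q.[0] != 0 /\ T j = q * 'X^(m j).
  by move=> j; have [q q0 TE] := mP j; exists q.
exists m; split; last first.
  move=> j Tj; rewrite lt0n; apply/eqP => mj; have [q0 TE] := qP j.
  by move: q0; rewrite (_ : q j = T j) ?Tj ?eqxx// TE mj expr0 mulr1.
apply: (@Xn_mul_inj _ (\prod_j q j ^+ e j) B) => //.
  by rewrite horner_prod; apply/prodf_neq0 => j _; rewrite horner_exp expf_neq0//; case: (qP j).
rewrite -E expr_sum -big_split; apply: eq_bigr => j _ /=.
by have [_ ->] := qP j; rewrite exprMn -exprM [(m j * _)%N]mulnC mulrC.
Qed.

End multiplicities.

(** * Jets of holomorphic functions *)

Section jets.
Variable R : realType.
Implicit Types (u v : R[i] -> R[i]).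

(** Agreement to order [N] at 0. The bounds on [u] and [v] belong to the relation so that it is
    stable under products. *)
Definition close N u v := exists M d : R, 0 < d /\ forall h, cmod h < d ->
  [/\ cmod (u h - v h) <= M * cmod h ^+ N, cmod (u h) <= M & cmod (v h) <= M].

Lemma close_cst N c : close N (fun=> c) (fun=> c).
Proof.
exists (cmod c), 1; split => // h _; rewrite subrr cmod0; split => //.
by rewrite mulr_ge0 ?exprn_ge0 ?cmod_ge0.
Qed.

Lemma closeB N u v u' v' : close N u v -> close N u' v' ->
  close N (fun h => u h - u' h) (fun h => v h - v' h).
Proof.
move=> [M [d [d0 H]]] [M' [d' [d'0 H']]]; exists (M + M'), (Num.min d d').
split; first by rewrite lt_min d0.
move=> h; rewrite lt_min => /andP[/H[h1 h2 h3] /H'[h1' h2' h3']]; split.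
- rewrite (_ : _ - _ = (u h - v h) - (u' h - v' h)); last by ring.
  by rewrite mulrDl (le_trans (cmodB _ _))// lerD.
- by rewrite (le_trans (cmodB _ _))// lerD.
- by rewrite (le_trans (cmodB _ _))// lerD.
Qed.

Lemma closeM N u v u' v' : close N u v -> close N u' v' ->
  close N (fun h => u h * u' h) (fun h => v h * v' h).
Proof.
move=> [M [d [d0 H]]] [M' [d' [d'0 H']]]; exists (M * M' + M * M'), (Num.min d d').
split; first by rewrite lt_min d0.
move=> h; rewrite lt_min => /andP[/H[h1 h2 h3] /H'[h1' h2' h3']].
have M0 : 0 <= M := le_trans (cmod_ge0 _) h2.
have M'0 : 0 <= M' := le_trans (cmod_ge0 _) h2'.
have MM : 0 <= M * M' by rewrite mulr_ge0.
split.
- rewrite (_ : _ - _ = (u h - v h) * u' h + v h * (u' h - v' h)); last by ring.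
  rewrite (le_trans (cmodD _ _))// !cmodM mulrDl; apply: lerD.
    by rewrite mulrAC ler_pM ?cmod_ge0.
  by rewrite -mulrA ler_pM ?cmod_ge0.
- by rewrite cmodM ler_wpDr// ler_pM ?cmod_ge0.
- by rewrite cmodM ler_wpDr// ler_pM ?cmod_ge0.
Qed.

Lemma closeX N k u v : close N u v -> close N (fun h => u h ^+ k) (fun h => v h ^+ k).
Proof.
move=> c; elim: k => [|k IH]; first by under eq_fun do rewrite expr0; exact: close_cst.
rewrite (_ : (fun h => u h ^+ k.+1) = fun h => u h * u h ^+ k); last by apply/funext => h; rewrite exprS.
rewrite (_ : (fun h => v h ^+ k.+1) = fun h => v h * v h ^+ k); last by apply/funext => h; rewrite exprS.
exact: closeM.
Qed.

Lemma close_prod N (I : Type) (r : seq I) (U V : I -> R[i] -> R[i]) :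
  (forall i, close N (U i) (V i)) ->
  close N (fun h => \prod_(i <- r) U i h) (fun h => \prod_(i <- r) V i h).
Proof.
move=> c; elim: r => [|i r IH].
  rewrite (_ : (fun h => _) = fun=> 1); last by apply/funext => h; rewrite big_nil.
  rewrite (_ : (fun h => \prod_(i <- [::]) V i h) = fun=> 1); last by apply/funext => h; rewrite big_nil.
  exact: close_cst.
rewrite (_ : (fun h => _) = fun h => U i h * \prod_(j <- r) U j h); last by apply/funext => h; rewrite big_cons.
rewrite (_ : (fun h => \prod_(j <- i :: r) V j h) = fun h => V i h * \prod_(j <- r) V j h); last by apply/funext => h; rewrite big_cons.
exact: closeM.
Qed.

Lemma holo_jet N (f : R[i] -> R[i]) rho z : holo rho f -> cmod z < rho ->
  exists c : nat -> R[i], c 0%N = f z /\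
    close N.+1 (fun h => f (z + h)) (fun h => \sum_(k < N.+1) c k * h ^+ k).
Proof.
move=> hf zr; have d0 : 0 < rho - cmod z by rewrite subr_gt0.
have hz : holo (rho - cmod z) (fun h => f (z + h)).
  move=> h hr; have [|l fl] := hf (z + h); first by rewrite (le_lt_trans (cmodD _ _))// -ltrBrDl.
  by exists (l * 1); apply: cdiff_comp fl; rewrite -[1]add0r; apply: cdiffD (cdiff_cst z h) (cdiff_id h).
have [c cP] := holo_series d0 hz; exists c.
pose r := (rho - cmod z) / 2.
have [r0 r1] : 0 < r /\ r < rho - cmod z by rewrite /r; split; lra.
have [M M0 [b1 b2]] := cP r r0 r1.
split.
  have := b2 0 1%N; rewrite cmod0 => /(_ r0); rewrite big_ord1 addr0 expr0 mulr1 mul0r expr1 mulr0 mul0r => H.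
  by apply/esym/eqP; rewrite -subr_eq0 -cmod_eq0 eq_le cmod_ge0 andbT.
set p := (fun h => \sum_(k < N.+1) _).
pose C := M / r ^+ N.+1 * 2; pose S := \sum_(k < N.+1) cmod (c k) * r ^+ k.
have C0 : 0 <= C by rewrite mulr_ge0// divr_ge0// exprn_ge0// ltW.
have S0 : 0 <= S by apply: sumr_ge0 => k _; rewrite mulr_ge0 ?cmod_ge0// exprn_ge0// ltW.
have H h : cmod h < r / 2 -> cmod (f (z + h) - p h) <= C * cmod h ^+ N.+1 /\ cmod (p h) <= S.
  move=> hr; have hr' : cmod h < r by rewrite (lt_trans hr)// ltr_pdivrMr// ltr_pMr// ltr1n.
  split.
    apply: le_trans (b2 h N.+1 hr') _.
    have K : r / (r - cmod h) <= 2 by rewrite ler_pdivrMr ?subr_gt0//; lra.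
    rewrite [X in _ <= X](_ : _ = M * (cmod h / r) ^+ N.+1 * 2).
      by apply: ler_wpM2l K; rewrite mulr_ge0// exprn_ge0// divr_ge0 ?cmod_ge0// ltW.
    rewrite (expr_div_n (cmod h) r N.+1) /C; move: (cmod h ^+ N.+1) (r ^+ N.+1)^-1 => x y.
    by rewrite [LHS]mulrAC -(mulrA M y x) (mulrC y x).
  rewrite (le_trans (cmod_sum _ _ _))//; apply: ler_sum => k _.
  rewrite cmodM ler_wpM2l ?cmod_ge0// cmodX lerXn2r ?nnegrE ?cmod_ge0 ?(ltW r0)//.
  exact: ltW.
exists (C * (1 + r ^+ N.+1) + S), (r / 2); split; first by rewrite divr_gt0.
move=> h hr; have [h1 h2] := H h hr.
have hr' : cmod h <= r by rewrite ltW// (lt_trans hr)// ltr_pdivrMr// ltr_pMr// ltr1n.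
have rN : 0 <= r ^+ N.+1 by rewrite exprn_ge0// ltW.
have CR : 0 <= C * r ^+ N.+1 by rewrite mulr_ge0.
have hN : cmod h ^+ N.+1 <= r ^+ N.+1 by rewrite lerXn2r ?nnegrE ?cmod_ge0 ?(ltW r0).
split.
- apply: le_trans h1 _; rewrite ler_wpM2r ?exprn_ge0 ?cmod_ge0//.
  by rewrite mulrDr mulr1 -addrA lerDl addr_ge0.
- rewrite -[f _](subrK (p h)) (le_trans (cmodD _ _))// lerD//.
  apply: le_trans h1 _; rewrite mulrDr mulr1.
  by apply: le_trans (ler_wpM2l C0 hN) _; rewrite lerDr.
- by apply: le_trans h2 _; rewrite lerDr mulrDr mulr1 addr_ge0.
Qed.

End jets.

(** * Uncountable sets of complex numbers *)

Section uncountable.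
Variable R : realType.

Lemma itv_uncountable (r : R) : 0 < r -> ~ countable [set x : R | 0 < x <= r].
Proof.
move=> r0 c; have := countable_lebesgue_measure0 c.
have -> : [set x : R | 0 < x <= r] = `]0, r]%classic.
  by apply/seteqP; split => x /=; rewrite in_itv.
rewrite lebesgue_measure_itv /= lte_fin r0 -EFinB subr0 => /eqP; rewrite eqe gt_eqF//.
Qed.

Lemma uncountable_image (U : set R[i]) (g : R[i] -> R) r : 0 < r ->
  (forall x, 0 < x <= r -> exists2 c, U c & g c = x) -> ~ countable U.
Proof.
move=> r0 H cU; apply: (itv_uncountable r0).
apply: (@sub_countable _ _ _ (g @` U)); last exact: card_le_trans (card_image_le g U) cU.
by apply: subset_card_le => x /= /H[c Uc <-]; exists c.
Qed.

Lemma complex_uncountable : ~ countable [set: R[i]].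
Proof.
apply: (@uncountable_image _ (@cmod R) 1) => // x /andP[x0 _].
by exists x%:C; rewrite ?cmodR ?gtr0_norm.
Qed.

End uncountable.

(** * Multiplicities from a point on the variety of jets *)

Section multiplicity_sum.
Variables (R : realType) (n a : nat) (e : 'I_n -> nat) (F : 'I_n -> R[i] -> R[i]).
Local Notation C := R[i].
Hypothesis F_holo : forall i, holo 1 (F i).
Hypothesis F0 : forall i, F i 0 = 0.
Hypothesis e_gt0 : forall i, (0 < e i)%N.
Hypothesis F_id : forall z w, cmod z < 2^-1 -> cmod w < 2^-1 ->
  \prod_(i < n) (1 - F i z * (F i w^*)^*) ^+ e i = (1 - z * w) ^+ a.

(** Coordinates of a jet: [None] is the base point, [Some (j, l)] the coefficient of order [l] of
    [F j] there. *)
Let V : finType := option ('I_n * 'I_a.+1).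

(** The difference of the two sides of [F_id] at the point [v None + 'X], with every [F j] replaced
    by its jet and [s j] in place of the conjugate of [F j w^*]. *)
Definition jet_poly (w : C) (s : 'I_n -> C) (v : V -> C) : {poly C} :=
  \prod_(j < n) (1 - \sum_(l < a.+1) (s j * v (Some (j, l)))%:P * 'X^l) ^+ e j -
  (1 - (w * v None)%:P - w%:P * 'X) ^+ a.

(* The jets of order [a] of the [F j] at the points of a small disc. *)
Lemma jets_exist : exists v : C -> V -> C, [/\ forall z, v z None = z,
  forall z j, cmod z < 2^-1 -> v z (Some (j, ord0)) = F j z &
  forall z w k, cmod z < 2^-1 -> cmod w < 2^-1 -> (k < a.+1)%N ->
    (jet_poly w (fun j => (F j w^*)^*) (v z))`_k = 0].
Proof.
have lt1 z : cmod z < 2^-1 -> cmod z < 1 :> R.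
  by move=> /lt_trans; apply; rewrite invf_lt1// ltr1n.
have /choice[c cP] : forall zj : C * 'I_n, exists c : nat -> C, cmod zj.1 < 2^-1 ->
    c 0%N = F zj.2 zj.1 /\ close a.+1 (fun h => F zj.2 (zj.1 + h)) (fun h => \sum_(k < a.+1) c k * h ^+ k).
  move=> [z j] /=; have [z2|z2] := ltP (cmod z) 2^-1; last by exists (fun=> 0).
  by have [c H] := holo_jet a (F_holo j) (lt1 _ z2); exists c.
exists (fun (z : C) (x : V) => if x is Some (j, l) then c (z, j) l else z); split => //.
  by move=> z j /(cP (z, j))[].
move=> z w k z2 w2 ka; set s := fun j => _.
have z0 : 0 < 2^-1 - cmod z by rewrite subr_gt0.
(* By [F_id], [u h] is the right side at [z + h]; [v] replaces each [F j] by its jet, so the two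
   agree to order [a.+1] and the difference has no lower coefficients. *)
pose u h := \prod_(j < n) (1 - s j * F j (z + h)) ^+ e j.
pose v h := \prod_(j < n) (1 - s j * (\sum_(l < a.+1) c (z, j) l * h ^+ l)) ^+ e j.
have [M [d [d0 H]]] : close a.+1 u v.
  apply: close_prod => j; apply: closeX; apply: closeB; first exact: close_cst.
  apply: closeM; first exact: close_cst.
  by have [_] := cP (z, j) z2.
apply: (@poly_small _ _ a.+1 M (Num.min d (2^-1 - cmod z))) ka; first by rewrite lt_min d0.
move=> h h0; rewrite lt_min => /andP[hd hz]; have [H1 _ _] := H h hd.
have zh : cmod (z + h) < 2^-1 by rewrite (le_lt_trans (cmodD _ _))// -ltrBrDl.
have -> : (jet_poly w s (fun x : V => if x is Some (j, l) then c (z, j) l else z)).[h] = v h - u h; last by rewrite cmodC.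
rewrite /jet_poly hornerD hornerN horner_prod horner_exp; congr (_ - _).
  apply: eq_bigr => j _; rewrite horner_exp !hornerE horner_sum mulr_sumr; congr ((1 - _) ^+ _).
  by apply: eq_bigr => l _; rewrite hornerM hornerC hornerXn mulrA.
rewrite !hornerE /u.
under [RHS]eq_bigr do rewrite mulrC.
rewrite F_id//; congr (_ ^+ _); ring.
Qed.

Section point.
Import (canonicals, coercions) mathcomp.multinomials.mpoly.
Local Notation N := #|V|.
Local Notation MP := (mpoly.mpoly N C).
Local Notation X_ x := (mpoly.mpolyX C (mpoly.mnm1 (enum_rank (x : V)))).

(** The coefficients of [jet_poly] are themselves polynomials in the coordinates of the jet, so an
    ideal of such polynomials can contain them. *)
Lemma jet_poly_mpoly (w : C) (s : 'I_n -> C) : exists P : {poly MP},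
  forall p : 'I_N -> C, map_poly (mpoly.meval p) P = jet_poly w s (fun x => p (enum_rank x)).
Proof.
exists (\prod_(j < n) (1 - \sum_(l < a.+1) (mpoly.mpolyC N (s j) * X_ (Some (j, l)))%:P * 'X^l) ^+ e j -
  (1 - (mpoly.mpolyC N w * X_ None)%:P - (mpoly.mpolyC N w)%:P * 'X) ^+ a) => p.
have mC (x : MP) : map_poly (mpoly.meval p) x%:P = (mpoly.meval p x)%:P by exact: map_polyC.
rewrite rmorphB rmorph_prod; congr (_ - _).
  apply: eq_bigr => j _; rewrite rmorphXn rmorphB rmorph1 rmorph_sum; congr ((1 - _) ^+ _).
  apply: eq_bigr => l _; rewrite rmorphM; congr (_ * _); last exact: map_polyXn.
  by apply: etrans (mC _) _; rewrite rmorphM /= mpoly.mevalC mpoly.mevalXU.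
rewrite rmorphXn; congr (_ ^+ _); rewrite !rmorphB rmorph1; congr (_ - _).
  congr (_ - _); by apply: etrans (mC _) _; rewrite rmorphM /= mpoly.mevalC mpoly.mevalXU.
rewrite rmorphM; congr (_ * _); last exact: map_polyX.
by apply: etrans (mC _) _; rewrite mpoly.mevalC.
Qed.

Lemma meval_horner_alg (p : 'I_N -> C) (x : MP) (q : {poly C}) :
  mpoly.meval p (horner_alg x q) = q.[mpoly.meval p x].
Proof.
elim/poly_ind: q => [|q c IH]; first by rewrite (rmorph0 (horner_alg x)) (rmorph0 (mpoly.meval p)) horner0.
rewrite (rmorphD (horner_alg x)) (rmorphM (horner_alg x)) /= horner_algX horner_algC.
rewrite (rmorphD (mpoly.meval p)) (rmorphM (mpoly.meval p)) /= IH hornerMXaddC.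
by rewrite mpoly.mevalZ (rmorph1 (mpoly.meval p)) mulr1.
Qed.

(** The identity theorem gives a real [t0] below 1/2 with [F i t0] nonzero, and the intermediate
    value theorem on [[0, t0]] does the rest. The lemma is the source of both uncountable sets in
    [exists_multiplicities]. *)
Lemma modulus_values i : (exists2 z, cmod z < 1 & F i z != 0) ->
  exists2 r : R, 0 < r & forall x, 0 < x <= r ->
    exists t : R, [/\ 0 <= t, t < 2^-1 & cmod (F i t%:C) = x].
Proof.
move=> [z0 z01 Fz0].
have [t0 [t00 t02 Ft0]] : exists t : R, [/\ 0 < t, t < 2^-1 & F i t%:C != 0].
  apply: contrapT => H; move/eqP: Fz0; apply; apply: (holo_zero (F_holo i)) z01 => d d0.
  pose t := Num.min (d / 2) 4^-1.
  have t0 : 0 < t by rewrite lt_min divr_gt0// invr_gt0 ltr0n.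
  exists t%:C; rewrite cmodR gtr0_norm//; split => //.
    by rewrite gt_min ltr_pdivrMr// ltr_pMr// ltr1n.
  apply: contrapT => /eqP Ft; apply: H; exists t; split => //.
  by rewrite gt_min [X in _ || X]ltf_pV2 ?posrE// ltr_nat orbT.
exists (cmod (F i t0%:C)); first by rewrite cmod_gt0.
move=> x /andP[x0 xr]; pose u (t : R) := cmod (F i t%:C).
have cu : {within `[0, t0], continuous u}.
  apply: continuous_in_subspaceT => t; rewrite inE /= in_itv /= => /andP[t1 t2].
  have tlt : cmod (t%:C) < 1.
    by rewrite cmodR ger0_norm// (le_lt_trans t2)// (lt_trans t02)// invf_lt1// ltr1n.
  have [l /cdiff_cont cF] := F_holo i tlt.
  apply/cvgrPdist_le => d /cF[r r0 Hr]; near=> y.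
  have yt : cmod ((y - t)%:C) < r.
    rewrite cmodR; near: y; apply/nbhs_ballP; exists r => // y.
    by rewrite /ball /= distrC.
  have := Hr _ yt; rewrite -rmorphD subrKC => H1; apply: le_trans H1.
  rewrite distrC ler_norml; have := cmodBr (F i y%:C) (F i t%:C).
  by have := cmodBr (F i t%:C) (F i y%:C); rewrite cmodC /u => h1 h2; apply/andP; split; lra.
have [|t t1 ut] := @IVT R u 0 t0 x (ltW t00) cu.
  have u0 : u 0 = 0 by rewrite /u (_ : 0%:C = 0 :> C)// F0 cmod0.
  by rewrite u0 ge_min le_max (ltW x0) xr orbT.
move: t1; rewrite in_itv /= => /andP[t1 t2].
by exists t; split => //; exact: le_lt_trans t02.
Unshelve. all: by end_near. Qed.

(* [U] consists of the values [1 / (F i w^* )^*], lying outside the unit disc, hence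
   outside the range of [F i]; a point of [I] reaching one of them is where both
   sides of [F_id] vanish. *)
Theorem exists_multiplicities i : (exists2 z, cmod z < 1 & F i z != 0) ->
  exists m : 'I_n -> nat, (\sum_j e j * m j)%N = a /\ (0 < m i)%N.
Proof.
move=> /modulus_values[r r0 Fr]; have [v [v_id v_val v_jet]] := jets_exist.
(* The relations shared by all jets at small points. [w] does not enter, so it can be read off
   afterwards from the coordinate [p i0] lying in [U]. *)
pose I (P : MP) := forall z, cmod z < 2^-1 -> mpoly.meval (fun k => v z (enum_val k)) P = 0.
have iI : is_ideal I.
  split => [z _|x y Ix Iy z z2|x y Iy z z2]; first exact: rmorph0.
    by rewrite rmorphD /= Ix// Iy// addr0.
  by rewrite rmorphM /= Iy// mulr0.
pose i0 : 'I_N := enum_rank (Some (i, ord0) : V).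
pose U : set C := [set c | exists w, [/\ cmod w < 2^-1, (F i w^*)^* != 0 & c = ((F i w^*)^*)^-1]].
have ncU : ~ countable U.
  apply: (@uncountable_image _ U (fun c => (cmod c)^-1) r) => // x /[dup] x0 /Fr[t [t0 t2 tx]].
  have tC : cmod (t%:C) < 2^-1 by rewrite cmodR ger0_norm.
  exists ((F i (t%:C)^*)^*)^-1; last by rewrite cmodV invrK cmodJ cconjR.
  exists t%:C; split => //; rewrite -cmod_gt0 cmodJ cconjR tx; by case/andP: x0.
(* If [q] of this coordinate were in [I], then [q] would vanish at all values [F i t], which are
   uncountably many. *)
have tr (q : {poly C}) : q != 0 -> ~ I (horner_alg (mpoly.mpolyX C (mpoly.mnm1 i0)) q).
  move=> q0 Iq; have rq t : 0 <= t -> t < 2^-1 -> root q (F i t%:C).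
    move=> t0 t2; have tC : cmod (t%:C) < 2^-1 by rewrite cmodR ger0_norm.
    by have := Iq _ tC; rewrite meval_horner_alg mpoly.mevalXU enum_rankK v_val// => /eqP.
  apply: (@uncountable_image _ [set c | root q c] (@cmod R) r r0); last first.
    have [rs qE] := closed_field_poly_normal q.
    apply: finite_set_countable; apply: (@sub_finite_set _ _ [set` rs]); last exact: finite_seq.
    move=> c /=; rewrite qE rootZ ?lead_coef_eq0// root_prod_XsubC//.
  by move=> x /Fr[t [t0 t2 tx]]; exists (F i t%:C) => //; exact: rq.
have [p [w [w2 s0 pi]] pI] := mpoly_point (@complex_uncountable R) iI ncU tr.
pose s j := (F j w^*)^*.
have [P PE] := jet_poly_mpoly w s.
pose p' x := p (enum_rank x).
(* For this [w] the coefficients of order at most [a] are polynomials that vanish at every jet by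
   [v_jet]; they lie in [I] and so vanish at [p]. *)
have [Q QE] : exists Q, jet_poly w s p' = 'X^(a.+1) * Q.
  apply: coef0_Xn => k ka; rewrite -PE coef_map; apply: pI => z z2.
  rewrite -coef_map PE /=.
  rewrite (_ : (fun x => _) = v z); first exact: v_jet.
  by apply/funext => x; rewrite enum_rankK.
pose T j : {poly C} := 1 - \sum_(l < a.+1) (s j * p' (Some (j, l)))%:P * 'X^l.
have TE : \prod_j T j ^+ e j = (1 - (w * p' None)%:P - w%:P * 'X) ^+ a + 'X^(a.+1) * Q.
  by apply/eqP; rewrite addrC -subr_eq -QE.
have Ti : (T i).[0] = 0.
  rewrite hornerD hornerN hornerC horner_sum big_ord_recl big1 => [|l _].
    by rewrite addr0 hornerM hornerC hornerXn /= expr0 mulr1 /p' -/i0 pi mulfV// subrr.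
  by rewrite hornerM hornerXn lift0 expr0n mulr0.
(* The left side of [TE] vanishes at 0 through its factor [T i], hence so does the right side; its
   first term is then the [a]-th power of [- w 'X], of order exactly [a]. *)
have w0 : 1 - w * p' None = 0.
  have := congr1 (horner^~ 0) TE; rewrite horner_prod (bigD1 i)//= horner_exp Ti expr0n.
  rewrite eqn0Ngt e_gt0 mul0r hornerD hornerM hornerXn expr0n mul0r addr0 !hornerE subr0.
  by move=> /esym/eqP; rewrite expf_eq0 => /andP[_ /eqP].
have wn : w != 0.
  by apply/eqP => E; move/eqP: w0; rewrite E mul0r subr0 oner_eq0.
have wa : (- w) ^+ a != 0 by rewrite expf_neq0// oppr_eq0.
have TE' : \prod_j T j ^+ e j = ((- w) ^+ a)%:P * 'X^a + 'X^(a.+1) * Q.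
  rewrite TE; congr (_ + _); rewrite -[X in X - _ - _]/(1%:P) -polyCB w0 sub0r -mulNr -polyCN exprMn.
  by rewrite polyC_exp.
have [m [mE mP]] := prod_multiplicity e_gt0 wa TE'.
by exists m; split => //; exact: mP.
Qed.

End point.
End multiplicity_sum.

(** * Isometries into polydiscs *)

Lemma list_of_multiplicities n a (e m : 'I_n -> nat) i :
  (\sum_j e j * m j)%N = a -> (0 < m i)%N ->
  exists (j : nat) (k : 'I_j.+1 -> 'I_n), k ord0 = i /\ (\sum_(r < j.+1) e (k r))%N = a.
Proof.
(* Each [j] is repeated [m j] times, except that one copy of [i] is set aside to head the list. *)
move=> ma mi; pose s := flatten [seq nseq (m j - (j == i)) j | j <- index_enum 'I_n].
exists (size s), (fun r => nth i (i :: s) r); split => //.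
have -> : (\sum_(r < (size s).+1) e (nth i (i :: s) r) = \sum_(x <- i :: s) e x)%N.
  by rewrite (big_nth i) big_mkord.
rewrite big_cons big_flatten big_map -ma (bigD1 i)//= [in RHS](bigD1 i)//= addnA; congr (_ + _)%N.
  by rewrite big_nseq iter_addn_0 eqxx -mulnS subn1 prednK.
apply: eq_bigr => j /negPf ji.
by rewrite big_nseq iter_addn_0 ji subn0.
Qed.

Section main.
Variables (R : realType) (d n : nat) (dd : 'I_n -> nat) (f : 'I_n -> R[i] -> R[i]).
Hypothesis f_isom : holomorphic_isometry d dd f.
Hypothesis f_nonconst : forall i, nonconstant_on_disc (f i).

Let df i := cderive (f i).
Let e i := (dd i + 1)%N.

Let fd i z : cmod z < 1 -> cdiff (f i) z (df i z).
Proof. by move=> /discE z1; apply: derivable_cdiff; case: f_isom => H _ _; exact: H. Qed.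

Let f1 i z : cmod z < 1 -> cmod (f i z) < 1.
Proof. by move=> /discE z1; apply/discE; case: f_isom => _ H _; exact: H. Qed.

Let e0 i : (0 < e i)%N. Proof. by rewrite /e addn1. Qed.

Let f_iso : isom (d + 1) e f df.
Proof.
move=> z z1; have [_ _ /(_ z)] := f_isom; rewrite bergman_metricE//.
have two : (2 : R[i]) != 0 by rewrite pnatr_eq0.
move=> H; apply: (mulfI two); rewrite mulrA -natrM addn1 H; last exact/discE.
rewrite mulr_sumr; apply: eq_bigr => i _.
rewrite /pullback bergman_metricE ?f1// /e addn1 natrM -/(df i z).
by rewrite -[Num.conj _]/(conjc _) mulrAC !mulrA.
Qed.

Let b i := f i 0.
Let b1 i : cmod (b i) < 1. Proof. by rewrite f1// cmod0. Qed.

Let F i z := mob (b i) (f i z).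
Let dF i z := (1 - b i * (b i)^*) / (1 - (b i)^* * f i z) ^+ 2 * df i z.

Let FdF i z : cmod z < 1 -> cdiff (F i) z (dF i z).
Proof. by move=> z1; apply: cdiff_comp (fd i z1) (mob_diff (b1 i) (f1 i z1)). Qed.

Let F1 i z : cmod z < 1 -> cmod (F i z) < 1.
Proof. by move=> z1; rewrite mob_disc// f1. Qed.

Let F0 i : F i 0 = 0. Proof. exact: mob0. Qed.

Lemma rigidity i : (d + 1)%N = (\sum_(i < n) e i)%N ->
  exists2 al, cmod al = 1 & forall z, cmod z < 1 -> F i z = al * z.
Proof.
move=> de; have H := isom_eq fd f1 f_iso i e0 de.
apply: (isom1_rot (FdF i) (F1 i) (F0 i)).
exact: (isom_mob (fun=> b1 i) (fun=> f1 i) H).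
Qed.

Lemma multiset_sum i : exists (j : nat) (k : 'I_j.+1 -> 'I_n),
  k ord0 = i /\ (\sum_(r < j.+1) e (k r))%N = (d + 1)%N.
Proof.
have Fid := prod_identity FdF F1 F0 (isom_mob b1 f1 f_iso).
have Fh j : holo 1 (F j) by move=> z z1; exists (dF j z); exact: FdF.
have [|m [ma mi]] := exists_multiplicities Fh F0 e0 Fid (i := i).
  have [z [w [/discE z1 /discE w1 fzw]]] := f_nonconst i.
  apply: contrapT => H; apply: fzw.
  (* If [F i] vanished identically, undoing the Moebius map would make [f i] constant. *)
  have Fz u : cmod u < 1 -> f i u = mob (- b i) 0.
    move=> u1; rewrite -(mobK (b1 i) (f1 i u1)) -/(F i u); congr mob.
    by apply: contrapT => /eqP Fu; apply: H; exists u.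
  by rewrite !Fz.
exact: list_of_multiplicities ma mi.
Qed.

Lemma isometry_sum_le : (d + 1 <= \sum_(i < n) e i)%N.
Proof. exact: isom_leq fd f1 f_iso. Qed.

End main.

Theorem theorem1p2 (R : realType) (d n : nat) (dd : 'I_n -> nat)
    (f : 'I_n -> R[i] -> R[i])
    (f_isom : holomorphic_isometry d dd f)
    (f_nonconst : forall i, nonconstant_on_disc (f i)) :
  [/\ (d + 1 <= \sum_(i < n) (dd i + 1))%N,
      (d + 1 = \sum_(i < n) (dd i + 1))%N ->
        exists alpha : 'I_n -> R[i],
          (forall i, `|alpha i| = 1) /\
          exists (psi : R[i] -> R[i]) (phi : 'I_n -> R[i] -> R[i]),
            [/\ disc_automorphism psi,
                forall i, disc_automorphism (phi i) &
                forall i z, disc z -> phi i (f i (psi z)) = alpha i * z],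
      forall i : 'I_n, exists (j : nat) (k : 'I_j.+1 -> 'I_n),
        k ord0 = i /\ (\sum_(r < j.+1) (dd (k r) + 1) = d + 1)%N &
      forall i : 'I_n, (dd i <= d)%N].
Proof.
have sums := multiset_sum f_isom f_nonconst.
split => //; first exact: (isometry_sum_le f_isom).
- move=> de; have /choice[al alP] : forall i, exists al, cmod al = 1 /\
      forall z, cmod z < 1 -> mob (f i 0) (f i z) = al * z.
    by move=> i; have [al al1 H] := rigidity f_isom i de; exists al.
  exists al; split; first by move=> i; rewrite cmodE; have [-> _] := alP i.
  have b1 i : cmod (f i 0) < 1.
    by apply/discE; have [_ H _] := f_isom; apply: H; apply/discE; rewrite cmod0.
  (* Moving each [f i 0] to 0 in the target already yields rotations, so the source is left
     unchanged. *)
  exists id, (fun i => mob (f i 0)); split.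
  + split; first by move=> z _; apply: cdiff_derivable (cdiff_id z).
    by split=> //; exists id; split => // z _; apply: cdiff_derivable (cdiff_id z).
  + by move=> i; exact: disc_automorphism_mob.
  + by move=> i z /discE z1; have [_ ->] := alP i.
- move=> i; have [j [k [ki ks]]] := sums i.
  (* [dd i + 1] is the first summand of the list through [i]. *)
  by rewrite -(leq_add2r 1) -ks big_ord_recl ki leq_addr.
Qed.
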